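(* Let $n\ge1$ and $p\ge 1$ be integers, let $a\ge 1$ be a real constant with $2p<n+2a$, let $\alpha>1$, and set $\tau=(n+2a+2p)-\alpha(n+2a-2p)$. Let $u\ge 0$, $u\in C^{2p}(\overline{B_1}\setminus\{0\})$, with $u(x',x_{n+1})=u(x',-x_{n+1})$, satisfy $$(-\widetilde\Delta_{n+1,a})^p u=|x|^{-\tau}u^{\alpha}\quad\text{in } B_1\setminus\{0\}\subset\mathbb R^{n+1},$$ and assume that $|x_{n+1}|^{2a-1}|x|^{-\tau}u^{\alpha}\in L^1(B_1)$. Set $v_i=|x_{n+1}|^{2a-1}(-\widetilde\Delta_{n+1,a})^i u$. Then for every $i=0,\dots,p-1$, $$\int_{\partial B_1}\left[\frac{\partial v_i}{\partial r}-(2a-1)v_i\right]dS+\lim_{s\to0}\int_{B_1\setminus B_s}v_{i+1}\,dx=0 .$$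
   Context: $B_s$ is the open ball of radius $s$ centered at the origin in $\mathbb R^{n+1}$, $x=(x',x_{n+1})$ with $x'\in\mathbb R^n$, and $\partial/\partial r$ is the radial derivative, $r=|x|$. $\widetilde\Delta_{n+1,a}=\sum_{i=1}^{n+1}\partial_{x_i}^2+\frac{2a-1}{x_{n+1}}\partial_{x_{n+1}}$, applied to functions even in $x_{n+1}$; at points with $x_{n+1}=0$ the term $\frac{1}{x_{n+1}}\partial_{x_{n+1}}u$ is understood as its continuous extension $\partial_{x_{n+1}}^2u$. Powers of $\widetilde\Delta_{n+1,a}$ are iterates. The existence of the limit as a finite number is part of the conclusion. *)

(* Defs.v *)
From HB Require Import structures.
From mathcomp Require Import all_boot all_order all_algebra.
From mathcomp Require Import all_classical all_reals all_analysis.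
From mathcomp Require Import measurable_realfun.
Import Order.TTheory GRing.Theory Num.Theory.
Import numFieldNormedType.Exports.
Set Implicit Arguments.
Unset Strict Implicit.
Unset Printing Implicit Defensive.
Local Open Scope classical_set_scope.
Local Open Scope ring_scope.

Definition rV_display : measure_display.
Proof. exact: default_measure_display. Qed.

Section rV_measurable.
Variables (R : realType) (n : nat).

Let coord (i : 'I_n) (x : 'rV[R]_n) : R := x ord0 i.

Let mrV0 : g_sigma_preimage coord set0.
Proof. exact: sigma_algebra0. Qed.

Let mrVC A : g_sigma_preimage coord A -> g_sigma_preimage coord (~` A).
Proof. exact: sigma_algebraC. Qed.

Let mrVU (F : _^nat) : (forall i, g_sigma_preimage coord (F i)) ->
  g_sigma_preimage coord (\bigcup_i (F i)).
Proof. exact: sigma_algebra_bigcup. Qed.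

HB.instance Definition _ := @isMeasurable.Build rV_display
  'rV[R]_n (g_sigma_preimage coord) mrV0 mrVC mrVU.

Lemma measurable_rV_coord (i : 'I_n) :
  measurable_fun [set: 'rV[R]_n] (fun x : 'rV[R]_n => x ord0 i : R).
Proof.
move=> _ Y mY; rewrite setTI; apply: sub_sigma_algebra => /=.
rewrite -bigcup_seq/=; exists i => /=; first by rewrite mem_index_enum.
by exists Y => //; rewrite setTI.
Qed.

Lemma measurable_fun_rV d (T : measurableType d) (f : T -> 'rV[R]_n) :
  (forall i, measurable_fun [set: T] (fun t => f t ord0 i : R)) ->
  measurable_fun [set: T] f.
Proof.
move=> mf.
have prefS : g_sigma_preimage (fun i => coord i \o f) `<=` measurable.
  apply: smallest_sub; first exact: sigma_algebra_measurable.
  move=> A; rewrite -bigcup_seq => -[i _] [B mB <-].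
  exact: mf.
move=> _ A mA.
apply: prefS; rewrite g_sigma_preimage_comp; exists A => //.
Qed.
End rV_measurable.

Definition rV_rcons (R : realType) (n : nat) (z : 'rV[R]_n * R) : 'rV[R]_n.+1 :=
  \row_i (if unlift ord_max i is Some j then z.1 ord0 j else z.2).

Lemma measurable_rV_rcons (R : realType) (n : nat) :
  measurable_fun [set: 'rV[R]_n * R] (@rV_rcons R n).
Proof.
apply: measurable_fun_rV => i.
have [j ij|ij] := unliftP ord_max i.
  rewrite (_ : (fun _ => _) = (fun x : 'rV[R]_n => x ord0 j : R) \o fst).
    by apply: measurableT_comp => //; exact: measurable_rV_coord.
  by apply/funext => z /=; rewrite mxE ij liftK.
rewrite (_ : (fun _ => _) = snd)//.
by apply/funext => z /=; rewrite mxE ij unlift_none.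
Qed.

(* Lebesgue measure on R^n (on the product sigma-algebra, i.e. the Borel sets),
   as the n-fold product of the one-dimensional one. *)
Fixpoint lebesgue_rV (R : realType) (n : nat) : set 'rV[R]_n -> \bar R :=
  if n is m.+1 then
    pushforward (@lebesgue_rV R m \x @lebesgue_measure R)%E (@rV_rcons R m)
  else dirac (0 : 'rV[R]_0).
Arguments lebesgue_rV {R} n.

Lemma lebesgue_rV_measure (R : realType) (n : nat) :
  {mu : {measure set 'rV[R]_n -> \bar R} | lebesgue_rV n = mu}.
Proof.
elim: n => [|n [mu IH]].
  by exists (dirac (0 : 'rV[R]_0)).
have mf := @measurable_rV_rcons R n.
unshelve eexists (pushforward (mu \x @lebesgue_measure R)%E (@rV_rcons R n)) => //.
by rewrite /= IH.
Qed.

Section lebesgue_rV_isMeasure.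
Local Open Scope ereal_scope.
Variables (R : realType) (n : nat).
Local Notation lam := (@lebesgue_rV R n).

Let lam0 : lam set0 = 0.
Proof. by have [mu ->] := lebesgue_rV_measure R n; exact: measure0. Qed.

Let lam_ge0 A : 0 <= lam A.
Proof. by have [mu ->] := lebesgue_rV_measure R n; exact: measure_ge0. Qed.

Let lam_sigma_additive : semi_sigma_additive lam.
Proof.
have [mu ->] := lebesgue_rV_measure R n.
exact: measure_semi_sigma_additive.
Qed.

HB.instance Definition _ := isMeasure.Build _ _ _ lam
  lam0 lam_ge0 lam_sigma_additive.
End lebesgue_rV_isMeasure.

(* The library norm on 'rV[R]_n is the sup norm. *)
Definition enorm (R : realType) (n : nat) (x : 'rV[R]_n) : R :=
  Num.sqrt (\sum_i x ord0 i ^+ 2).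

Definition eball (R : realType) (n : nat) (s : R) : set 'rV[R]_n :=
  [set x | enorm x < s].

Definition ecball (R : realType) (n : nat) (s : R) : set 'rV[R]_n :=
  [set x | enorm x <= s].

Definition esphere (R : realType) (n : nat) (s : R) : set 'rV[R]_n :=
  [set x | enorm x = s].

Arguments eball {R n} s.
Arguments ecball {R n} s.
Arguments esphere {R n} s.

Definition edir (R : realType) (n : nat) (x : 'rV[R]_n) : 'rV[R]_n :=
  (enorm x)^-1 *: x.

Lemma measurable_enorm (R : realType) (n : nat) :
  measurable_fun [set: 'rV[R]_n] (@enorm R n : _ -> R).
Proof.
rewrite (_ : @enorm R n = (@powR R)^~ 2^-1 \o
    (fun x : 'rV[R]_n => \sum_i x ord0 i ^+ 2)); last first.
  apply/funext => x /=; rewrite powR12_sqrt//.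
  by apply: sumr_ge0 => i _; exact: sqr_ge0.
apply: measurableT_comp => //.
apply: measurable_sum => i.
by apply: measurable_funX; exact: measurable_rV_coord.
Qed.

Lemma measurable_eball (R : realType) (n : nat) (s : R) :
  measurable (eball s : set 'rV[R]_n).
Proof.
rewrite (_ : eball s = [set: 'rV[R]_n] `&` (@enorm R n) @^-1` `]-oo, s[).
  by apply: measurable_enorm => //; exact: measurable_itv.
by apply/seteqP; split => x /=; rewrite in_itv/=; [|case].
Qed.

Lemma measurable_edir (R : realType) (n : nat) :
  measurable_fun [set: 'rV[R]_n] (@edir R n).
Proof.
apply: measurable_fun_rV => i.
rewrite (_ : (fun _ => _) = (fun x : 'rV[R]_n => enorm x `^ (-1)) \*
    (fun x : 'rV[R]_n => x ord0 i)); last first.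
  by apply/funext => x /=; rewrite mxE powR_inv1// sqrtr_ge0.
apply: measurable_funM; last exact: measurable_rV_coord.
by apply: (measurableT_comp (measurable_powR _)); exact: measurable_enorm.
Qed.

(* Surface measure of the unit sphere of R^n: the measure of A is n times the
   volume of the cone {x in B_1 | x / |x| in A}. Outside the sphere it could only
   charge the origin, since [edir 0 = 0]. *)
Definition sphere_measure (R : realType) (n : nat) : set 'rV[R]_n -> \bar R :=
  fun A => (n%:R%:E * lebesgue_rV n ((@edir R n) @^-1` A `&` eball 1))%E.
Arguments sphere_measure {R} n.

Lemma sphere_measure_measure (R : realType) (n : nat) :
  {mu : {measure set 'rV[R]_n -> \bar R} | sphere_measure n = mu}.
Proof.
have mf := @measurable_edir R n.
unshelve eexists (mscale (n%:R%:nng : {nonneg R})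
  (pushforward (mrestr (@lebesgue_rV R n) (@measurable_eball R n 1)) (@edir R n))) => //.
Qed.

Section sphere_measure_isMeasure.
Local Open Scope ereal_scope.
Variables (R : realType) (n : nat).
Local Notation sigma := (@sphere_measure R n).

Let sigma0 : sigma set0 = 0.
Proof. by have [mu ->] := sphere_measure_measure R n; exact: measure0. Qed.

Let sigma_ge0 A : 0 <= sigma A.
Proof. by have [mu ->] := sphere_measure_measure R n; exact: measure_ge0. Qed.

Let sigma_sigma_additive : semi_sigma_additive sigma.
Proof.
have [mu ->] := sphere_measure_measure R n.
exact: measure_semi_sigma_additive.
Qed.

HB.instance Definition _ := isMeasure.Build _ _ _ sigma
  sigma0 sigma_ge0 sigma_sigma_additive.
End sphere_measure_isMeasure.

Definition pderiv (R : realType) (n : nat) (i : 'I_n) (f : 'rV[R]_n -> R) :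
    'rV[R]_n -> R :=
  fun x => 'D_(delta_mx ord0 i) f x.

Definition mpderiv (R : realType) (n : nat) (s : seq 'I_n) (f : 'rV[R]_n -> R) :
    'rV[R]_n -> R :=
  foldr (@pderiv R n) f s.

(* C^k(D), where D lies between the open set U and its closure: the partial
   derivatives of order at most k exist in U and extend continuously to D, and
   f is its own extension. *)
Definition Ck_upto (R : realType) (n : nat) (k : nat) (U D : set 'rV[R]_n)
    (f : 'rV[R]_n -> R) : Prop :=
  [/\ {within D, continuous f},
      (forall (s : seq 'I_n) (i : 'I_n) (x : 'rV[R]_n), (size s < k)%N -> U x ->
        derivable (mpderiv s f) x (delta_mx ord0 i)) &
      (forall s : seq 'I_n, (size s <= k)%N ->
        exists g : 'rV[R]_n -> R, {within D, continuous g} /\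
          {in U, g =1 mpderiv s f})].

(* x_{n+1} *)
Definition xlast (R : realType) (n : nat) (x : 'rV[R]_n.+1) : R :=
  x ord0 ord_max.

Definition xreflect (R : realType) (n : nat) (x : 'rV[R]_n.+1) : 'rV[R]_n.+1 :=
  \row_i (if i == ord_max then - x ord0 i else x ord0 i).

(* For f even in x_{n+1}, f_{n+1} / x_{n+1} extends by f_{n+1,n+1} to
   x_{n+1} = 0. *)
Definition lapA (R : realType) (n : nat) (a : R) (f : 'rV[R]_n.+1 -> R) :
    'rV[R]_n.+1 -> R :=
  fun x => \sum_i pderiv i (pderiv i f) x +
    (2 * a - 1) * (if xlast x == 0 then pderiv ord_max (pderiv ord_max f) x
                   else pderiv ord_max f x / xlast x).

Definition neg_lapA_iter (R : realType) (n : nat) (a : R) (k : nat)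
    (f : 'rV[R]_n.+1 -> R) : 'rV[R]_n.+1 -> R :=
  iter k (fun g x => - lapA a g x) f.

(* A function on the open unit ball, extended by its limit values to the
   boundary. *)
Definition ball_ext (R : realType) (n : nat) (f : 'rV[R]_n -> R) : 'rV[R]_n -> R :=
  fun x => if enorm x < 1 then f x
           else lim (f y @[y --> within (eball 1) (nbhs x)]).

Definition v_ (R : realType) (n : nat) (a : R) (u : 'rV[R]_n.+1 -> R) (i : nat) :
    'rV[R]_n.+1 -> R :=
  fun x => `|xlast x| `^ (2 * a - 1) * ball_ext (neg_lapA_iter a i u) x.

(* One-sided (h < 0), so that it makes sense on the boundary of the ball. *)
Definition radial_deriv (R : realType) (n : nat) (f : 'rV[R]_n -> R) :
    'rV[R]_n -> R :=
  fun x => lim ((f (x + h *: edir x) - f x) / h @[h --> (0:R)^'-]).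

(* Main.v *)
From HB Require Import structures.
Require Import Defs.
From mathcomp Require Import all_boot all_order all_algebra.
From mathcomp Require Import all_classical all_reals all_analysis.
From mathcomp Require Import measurable_realfun lra ring.
Import Order.TTheory GRing.Theory Num.Theory.
Import numFieldNormedType.Exports.
Set Implicit Arguments.
Unset Strict Implicit.
Unset Printing Implicit Defensive.
Local Open Scope classical_set_scope.
Local Open Scope ring_scope.

(** Put N = n + 1, D = n + 2a, b = 2a - 1, and let L be the weighted Laplacian and
    u_i = (-L)^i u. The operator has divergence form, |x_N|^b L f = div (|x_N|^b grad f).
    Hence the integrals U_i(r) of |x_N|^b u_i(r x) over the unit sphere and the inward
    fluxes P_i = - r^(D-1) U_i' satisfy the radial system

      U_i' = - r^(1-D) P_i,    P_i' = r^(D-1) U_(i+1)    (i < p).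

    Integrating the second equation, the integral of v_(i+1) over B_1 minus B_s is
    P_i(1-) - P_i(s) (outer_inflow). As the weight is homogeneous of degree b, P_i(1-) is
    minus the integral over the unit sphere of d_r v_i - b v_i
    (sphere_mean_radial_deriv). So the theorem says that P_i(s) -> 0 as s -> 0: no flux
    escapes at the origin (flux_cvg0).

    First, all the fluxes have limits. The last one is nondecreasing since u_p >= 0, and
    it is bounded below because its increments are integrals of the source, which is
    integrable (inflow_bounded_below). If P_(i+1) converges then U_(i+1) = O(r^(2-D)), so
    P_i' = O(r) and P_i converges. Suppose now that j is the first index whose limit is
    not zero. Integrating the system from level j down to level 0, where each level gains
    two powers of r, shows that U_0 has the sign of this limit and |U_0| >= c r^(2j+2-D)
    (flux_blowup); the sign is positive because u >= 0. The integrated form of X^alpha >= K^(alpha-1) (X - K), with K a small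
    multiple of r^(2j+2-D), bounds U_p below by a multiple of
    r^(-tau) r^(-alpha (D-2j-2)), and by the choice of tau this is at least c r^(-D). Then
    P_(p-1)' >= c / r, and P_(p-1) tends to -oo at 0, a contradiction.

    It remains to justify the radial system for functions of class C^2 up to the sphere
    which are even in x_N. The iterates u_i are of class C^(2p-2i): the singular term
    f_N / x_N is a vertical average of f_NN away from the x_N-axis, and a harmless
    quotient away from the plane x_N = 0 (CK_dquot). For a radial cut-off phi, each
    component of |x_N|^b phi(|x|) grad f is differentiable along the lines of its own
    direction and vanishes at their ends, so its derivative has integral zero along these
    lines, and by Fubini in the whole space (integral_lines_eq0). In polar coordinates
    (integral_polar, integral_shell) the sum over the components is the weak form of the
    radial equation, from which the lemma of du Bois-Reymond recovers the derivative
    (radial_equation). *)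

(** * Euclidean geometry and Borel sets *)

Section geometry.
Variables (R : realType) (n : nat).
Implicit Types (x y : 'rV[R]_n).

Lemma enorm_ge0 x : 0 <= enorm x.
Proof. exact: sqrtr_ge0. Qed.

Lemma sumsq_ge0 x : 0 <= \sum_i x ord0 i ^+ 2.
Proof. by apply: sumr_ge0 => i _; exact: sqr_ge0. Qed.

Lemma sqr_enorm x : enorm x ^+ 2 = \sum_i x ord0 i ^+ 2.
Proof. by rewrite sqr_sqrtr// sumsq_ge0. Qed.

Lemma coord_le_enorm x i : `|x ord0 i| <= enorm x.
Proof.
rewrite -sqrtr_sqr ler_wsqrtr// (bigD1 i)//= lerDl.
by apply: sumr_ge0 => j _; exact: sqr_ge0.
Qed.

Lemma norm_le_enorm x : `|x| <= enorm x.
Proof.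
rewrite [leLHS]mx_normrE; apply/bigmax_leP; split; first exact: enorm_ge0.
by move=> [i j] _ /=; rewrite (ord1 i) coord_le_enorm.
Qed.

Lemma enorm_eq0 x : (enorm x == 0) = (x == 0).
Proof.
apply/eqP/eqP => [x0|->].
  by apply/eqP; rewrite -normr_le0 -x0 norm_le_enorm.
by rewrite /enorm big1 ?sqrtr0// => i _; rewrite mxE expr0n.
Qed.

Lemma enorm0 : enorm (0 : 'rV[R]_n) = 0.
Proof. by apply/eqP; rewrite enorm_eq0. Qed.

Lemma enorm_gt0 x : (0 < enorm x) = (x != 0).
Proof. by rewrite lt_neqAle enorm_ge0 andbT eq_sym enorm_eq0. Qed.

Lemma enormZ c x : enorm (c *: x) = `|c| * enorm x.
Proof.
rewrite /enorm -sqrtr_sqr -sqrtrM ?sqr_ge0// mulr_sumr.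
by congr Num.sqrt; apply: eq_bigr => i _; rewrite mxE exprMn.
Qed.

Lemma cvg_sumf (T : Type) (F : set_system T) (I : Type) (r : seq I) (f : I -> T -> R)
    (l : I -> R) : Filter F -> (forall i, f i x @[x --> F] --> l i) ->
  (\sum_(i <- r) f i x) @[x --> F] --> \sum_(i <- r) l i.
Proof.
move=> FF fl; elim: r => [|i r IH].
  rewrite big_nil (_ : (fun _ => _) = cst 0); first exact: cvg_cst.
  by apply/funext => z; rewrite big_nil.
rewrite big_cons (_ : (fun _ => _) = fun z => f i z + \sum_(j <- r) f j z).
  exact: cvgD.
by apply/funext => z; rewrite big_cons.
Qed.

Lemma enorm_continuous : continuous (@enorm R n).
Proof.
move=> x; apply: (continuous_comp _ (@sqrt_continuous R _)).
apply: (@cvg_sumf _ (nbhs x) _ _ (fun i (y : 'rV[R]_n) => y ord0 i ^+ 2)) => i.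
by apply: (@continuous_comp _ _ _ (fun y : 'rV[R]_n => y ord0 i) (fun r => r ^+ 2)); [exact: coord_continuous|exact: exprn_continuous].
Qed.

Lemma open_eball s : open (eball s : set 'rV[R]_n).
Proof.
rewrite (_ : eball s = (@enorm R n) @^-1` [set r | r < s]) //.
by apply: open_comp => // x _; exact: enorm_continuous.
Qed.

Lemma closed_ecball s : closed (ecball s : set 'rV[R]_n).
Proof.
rewrite (_ : ecball s = (@enorm R n) @^-1` [set r | r <= s]) //.
apply: preimage_closed; last exact: closed_le.
by move=> x _; exact: enorm_continuous.
Qed.

Lemma open_enorm_gt s : open [set x : 'rV[R]_n | s < enorm x].
Proof.
rewrite (_ : mkset _ = (@enorm R n) @^-1` [set r | s < r]) //.
by apply: open_comp => // x _; exact: enorm_continuous.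
Qed.

Lemma compact_ecball_sub (s : R) (A : set 'rV[R]_n) :
  closed A -> A `<=` ecball s -> compact A.
Proof.
move=> cA As; apply: bounded_closed_compact => //.
exists s; split; first exact: num_real.
by move=> M sM x Ax /=; rewrite (le_trans (norm_le_enorm x))// (le_trans (As _ Ax))// ltW.
Qed.

End geometry.

Section borel_rV.
Variables (R : realType) (n : nat).

Lemma measurable_ball_rV (x : 'rV[R]_n) (e : R) : 0 < e -> measurable (ball x e).
Proof.
move=> e0; rewrite (_ : ball x e = \bigcap_(i in [set: 'I_n])
   ([set: 'rV[R]_n] `&` (fun y : 'rV[R]_n => y ord0 i) @^-1` `]x ord0 i - e, x ord0 i + e[)).
  apply: fin_bigcap_measurable => // i _.
  by apply: measurable_rV_coord => //; exact: measurable_itv.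
apply/seteqP; split => y /=.
  move=> [_ xy] i _; split => //=; have := xy ord0 i.
  by rewrite /ball/= in_itv/= ltr_norml => /andP[]; lra.
move=> xy; split => // i j; rewrite (ord1 i) /ball/=.
have [_] := xy j I; rewrite /= in_itv/= => /andP[? ?].
by rewrite ltr_norml; apply/andP; split; lra.
Qed.

Let q2r (q : 'rV[rat]_n) : 'rV[R]_n := \row_i ratr (q ord0 i).

(** Balls of the sup norm with rational centres are boxes and form a countable basis. *)
Lemma open_measurable_rV (A : set 'rV[R]_n) : open A -> measurable A.
Proof.
move=> oA.
rewrite (_ : A = \bigcup_(q : 'rV[rat]_n) \bigcup_(k : nat)
    (if `[< ball (q2r q) k.+1%:R^-1 `<=` A >] then ball (q2r q) k.+1%:R^-1 else set0)).
  apply: countable_bigcupT_measurable => [|q]; first exact: countableP.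
  apply: bigcupT_measurable => k.
  by case: ifPn => // _; exact: measurable_ball_rV.
apply/seteqP; split => x; last first.
  by move=> [q _ [k _]]; case: ifPn => [/asboolP + ?|//]; apply.
move=> Ax; have /nbhs_ballP[e /= e0 eA] : nbhs x A by exact: open_nbhs_nbhs.
have [k ke] : exists k : nat, k.+1%:R^-1 < e / 2.
  have [k _ /(_ k (leqnn k))] := near_infty_natSinv_lt (PosNum (divr_gt0 e0 (ltr0n R 2))).
  by exists k.
have qx i : exists q : rat, `|x ord0 i - ratr q| < k.+1%:R^-1.
  have [|q] := rat_in_itvoo (_ : x ord0 i - k.+1%:R^-1 < x ord0 i + k.+1%:R^-1).
    by rewrite ltrD2l gtrN.
  rewrite in_itv/= => /andP[q1 q2].
  by exists q; rewrite ltr_distlC q1 q2.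
have [q qE] := choice qx.
have xq : ball (q2r (\row_i q i)) k.+1%:R^-1 x.
  split => // i j; rewrite (ord1 i) /ball/= !mxE distrC; exact: qE.
exists (\row_i q i) => //; exists k => //.
case: ifPn => //; case/asboolP => y yq.
apply: eA; rewrite (splitr e); apply: (@ball_triangle _ _ (q2r (\row_i q i))).
  by apply: (@le_ball _ _ _ k.+1%:R^-1); [exact: ltW|exact: ball_sym].
by apply: (@le_ball _ _ _ k.+1%:R^-1); [exact: ltW|].
Qed.

Lemma continuous_on_measurable_rV (A : set 'rV[R]_n) (f : 'rV[R]_n -> R) :
  open A -> (forall x, A x -> {for x, continuous f}) -> measurable_fun A f.
Proof.
move=> oA cf; apply: (measurability _ (RGenOpens.measurableE R)) => // _ [_ [a [b ->] <-]].
apply: open_measurable_rV; rewrite openE => x [Ax /= fx]; rewrite /interior.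
apply: filterI; first exact: open_nbhs_nbhs.
by apply: (cf x Ax); apply: open_nbhs_nbhs; split => //; exact: interval_open.
Qed.

Lemma continuous_measurable_rV (f : 'rV[R]_n -> R) :
  continuous f -> measurable_fun setT f.
Proof.
by move=> cf; apply: continuous_on_measurable_rV => [|x _]; [exact: openT|exact: cf].
Qed.

End borel_rV.

(** * Functions of class C^k up to the unit sphere *)

Section CK.
Variables (R : realType) (n : nat).
Local Notation V := 'rV[R]_n.+1.
Local Notation e_ i := (delta_mx (ord0 : 'I_1) i : V).
Local Notation BF x := (within (eball 1) (nbhs (x : V))).
Implicit Types (x y : V) (f g : V -> R) (U : set V).

(** Localised to U, so that membership can be checked separately on two open sets that
    cover everything but the origin. Boundary values are limits from inside the ball,
    along the filter BF x; at an interior point such a limit is plain continuity. *)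
Fixpoint CK U (k : nat) f : Prop :=
  (forall x, U x -> (ecball 1 `\ 0) x -> cvg (f y @[y --> BF x])) /\
  (if k is k'.+1 then forall i,
     (forall x, U x -> (eball 1 `\ 0) x -> derivable f x (e_ i)) /\
     CK U k' (pderiv i f) else True).

(** The points r x with r -> 1- approach x from inside, even when |x| = 1. *)
Lemma BF_proper x : (ecball 1 `\ 0) x -> ProperFilter (BF x).
Proof.
move=> [x1 x0]; apply: within_nbhs_proper => A Ax.
have xn0 : 0 < enorm x by rewrite enorm_gt0; apply/eqP.
have c1 : (fun r : R => r *: x) r @[r --> 1^'-] --> x.
  rewrite -[X in _ --> X]scale1r; apply: cvg_at_left_filter.
  by apply: cvgZr_tmp; exact: cvg_id.
have c2 : \forall r \near 1^'-, A (r *: x) by exact: c1.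
have : \forall r \near (1 : R)^'-, A (r *: x) /\ (eball 1) (r *: x).
  near=> r; split; first by near: r.
  have r1 : r < 1 by near: r; exact: nbhs_left_lt.
  have r0 : 0 < r by near: r; exact: nbhs_left_gt.
  rewrite /eball/= enormZ gtr0_norm//; apply: le_lt_trans r1.
  by rewrite ler_piMr// ltW.
move/filter_ex => [r [? ?]]; exists (r *: x); by split.
Unshelve. all: by end_near. Qed.

Lemma BF_nbhs x : eball 1 x -> BF x = nbhs x.
Proof. by move=> x1; apply: within_interior; apply: open_nbhs_nbhs; split => //; exact: open_eball. Qed.

Lemma near_neq0 x : x != 0 -> \forall y \near x, y <> 0.
Proof.
rewrite -enorm_gt0 => x0; have := open_nbhs_nbhs (conj (@open_enorm_gt R n.+1 0) x0).
by apply: filterS => y /= + y0; rewrite y0 enorm0 ltxx.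
Qed.

Lemma near_punct U x : open U -> U x -> (eball 1 `\ 0) x ->
  \forall y \near x, U y /\ (eball 1 `\ 0) y.
Proof.
move=> oU Ux [x1 x0]; near=> y; split; [|split].
- by near: y; apply: open_nbhs_nbhs.
- by near: y; apply: open_nbhs_nbhs; split => //; exact: open_eball.
- by near: y; apply: near_neq0; apply/eqP.
Unshelve. all: by end_near. Qed.

Lemma near_BF U x : open U -> U x -> (ecball 1 `\ 0) x ->
  \forall y \near BF x, U y /\ (eball 1 `\ 0) y.
Proof.
move=> oU Ux [x1 x0]; rewrite near_withinE; near=> y => y1; split; [|split => //].
- by near: y; apply: open_nbhs_nbhs.
- by near: y; apply: near_neq0; apply/eqP.
Unshelve. all: by end_near. Qed.

Lemma sub_punct x : (eball 1 `\ 0) x -> (ecball 1 `\ 0) x.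
Proof. by move=> [x1 x0]; split => //; rewrite /ecball/= ltW. Qed.

Lemma CK_cvg U k f : CK U k f -> forall x, U x -> (ecball 1 `\ 0) x ->
  cvg (f y @[y --> BF x]).
Proof. by case: k => [|k] []. Qed.

Lemma CK0 U k f : CK U k f -> CK U 0 f.
Proof. by move=> h; split => // x; exact: CK_cvg h x. Qed.

Lemma CK_derivable U k f : CK U k.+1 f -> forall i x, U x -> (eball 1 `\ 0) x ->
  derivable f x (e_ i).
Proof. by move=> [_ h] i; exact: (h i).1. Qed.

Lemma CK_pderiv U k f : CK U k.+1 f -> forall i, CK U k (pderiv i f).
Proof. by move=> [_ h] i; exact: (h i).2. Qed.

Lemma CK_continuous U k f x : CK U k f -> U x -> (eball 1 `\ 0) x ->
  {for x, continuous f}.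
Proof.
move=> h Ux xB; have /cvg_ex[l] := CK_cvg h Ux (sub_punct xB).
rewrite BF_nbhs; last by case: xB.
move=> fl; suff lf : l = f x by rewrite lf in fl.
apply/eqP; rewrite -subr_eq0 -normr_le0; apply/ler_addgt0Pl => e e0; rewrite addr0.
by move/cvgrPdist_le : fl => /(_ _ e0) /nbhs_singleton.
Qed.

Lemma CK_eq U k f g : open U ->
  (forall x, U x -> (eball 1 `\ 0) x -> f x = g x) -> CK U k f -> CK U k g.
Proof.
move=> oU; elim: k f g => [|k IH] f g fg [cf df]; split => //.
- move=> x Ux xB; have /cvg_ex[l fl] := cf _ Ux xB; apply/cvg_ex; exists l.
  apply: cvg_trans fl; apply: near_eq_cvg.
  by apply: filterS (near_BF oU Ux xB) => y [? ?]; rewrite fg.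
- move=> x Ux xB; have /cvg_ex[l fl] := cf _ Ux xB; apply/cvg_ex; exists l.
  apply: cvg_trans fl; apply: near_eq_cvg.
  by apply: filterS (near_BF oU Ux xB) => y [? ?]; rewrite fg.
move=> i; have [dfi cfi] := df i; split.
  move=> x Ux xB; apply: near_eq_derivable (dfi _ Ux xB).
  by apply: filterS (near_punct oU Ux xB) => y [? ?]; rewrite fg.
apply: IH cfi => x Ux xB; apply: near_eq_derive.
by apply: filterS (near_punct oU Ux xB) => y [? ?]; rewrite fg.
Qed.

Lemma CK_pred U k f : CK U k.+1 f -> CK U k f.
Proof.
elim: k f => [|k IH] f; first exact: CK0.
move=> [cf df]; split => // i; have [d1 d2] := df i.
by split => //; exact: IH.
Qed.

Lemma CK_le U k m f : (k <= m)%N -> CK U m f -> CK U k f.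
Proof.
move=> /subnK <-; elim: (m - k)%N => // d IH; rewrite addSn => /CK_pred; exact: IH.
Qed.

Lemma CK_cst U k c : open U -> CK U k (cst c).
Proof.
move=> oU; elim: k c => [|k IH] c; split => //; try (by move=> x _ _; exact: is_cvg_cst).
move=> i; split; first by move=> x _ _; exact: derivable_cst.
by apply: (@CK_eq _ _ (cst 0)) => // x _ _; rewrite /pderiv derive_cst.
Qed.

Lemma CKD U k f g : open U -> CK U k f -> CK U k g -> CK U k (fun x => f x + g x).
Proof.
move=> oU; elim: k f g => [|k IH] f g [cf df] [cg dg]; split => //;
  try (by move=> x Ux xB; apply: is_cvgD; [exact: cf|exact: cg]).
move=> i; have [df1 df2] := df i; have [dg1 dg2] := dg i; split.
  by move=> x Ux xB; apply: derivableD; [exact: df1|exact: dg1].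
apply: CK_eq (IH _ _ df2 dg2) => // x Ux xB; rewrite /pderiv.
by rewrite [RHS]deriveD//; [exact: df1|exact: dg1].
Qed.

Lemma CKM U k f g : open U -> CK U k f -> CK U k g -> CK U k (fun x => f x * g x).
Proof.
move=> oU; elim: k f g => [|k IH] f g hf hg; split => //;
  try (by move=> x Ux xB; apply: is_cvgM; [exact: CK_cvg hf _ Ux xB|exact: CK_cvg hg _ Ux xB]).
move=> i; split.
  by move=> x Ux xB; apply: derivableM; [exact: CK_derivable hf _ _ Ux xB|exact: CK_derivable hg _ _ Ux xB].
apply: (@CK_eq _ _ (fun x => f x * pderiv i g x + g x * pderiv i f x)) => //.
  move=> x Ux xB; rewrite /pderiv [RHS]deriveM//.
    exact: CK_derivable hf _ _ Ux xB.
  exact: CK_derivable hg _ _ Ux xB.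
by apply: CKD => //; apply: IH; (try exact: CK_pred); exact: CK_pderiv.
Qed.

Lemma CKZ U k c f : open U -> CK U k f -> CK U k (fun x => c * f x).
Proof. by move=> oU; apply: (@CKM _ _ (cst c)) => //; exact: CK_cst. Qed.

Lemma CK_sum U k (I : Type) (r : seq I) (F : I -> V -> R) : open U ->
  (forall i, CK U k (F i)) -> CK U k (fun x => \sum_(i <- r) F i x).
Proof.
move=> oU hF; elim: r => [|i r IH].
  by apply: CK_eq (CK_cst k 0 oU) => // x _ _; rewrite big_nil.
by apply: CK_eq (CKD oU (hF i) IH) => // x _ _; rewrite big_cons.
Qed.

Lemma CK_setU U1 U2 k f : CK U1 k f -> CK U2 k f -> CK (U1 `|` U2) k f.
Proof.
elim: k f => [|k IH] f [c1 d1] [c2 d2]; split => //;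
  try (by move=> x [Ux|Ux] xB; [exact: c1|exact: c2]).
move=> i; split; first by move=> x [Ux|Ux] xB; [exact: (d1 i).1|exact: (d2 i).1].
by apply: IH; [exact: (d1 i).2|exact: (d2 i).2].
Qed.

Lemma CK_subset U1 U2 k f : U1 `<=` U2 -> CK U2 k f -> CK U1 k f.
Proof.
move=> U12; elim: k f => [|k IH] f [c1 d1]; split => //;
  try (by move=> x Ux xB; apply: c1 => //; exact: U12).
move=> i; split; first by move=> x Ux xB; apply: (d1 i).1 => //; exact: U12.
by apply: IH; exact: (d1 i).2.
Qed.

Lemma is_derive_coord x i j : is_derive x (e_ i) (fun y : V => y ord0 j) (i == j)%:R.
Proof.
have c : (fun h : R => h^-1 *: (((fun y : V => y ord0 j) \o shift x) (h *: e_ i) - x ord0 j))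
    @ 0^' --> ((i == j)%:R : R).
  apply: (@cvg_trans _ ((fun=> (i == j)%:R : R) @ (0 : R)^')); last exact: cvg_cst.
  apply: near_eq_cvg; near=> h => /=.
  have h0 : h != 0 by near: h; exact: nbhs_dnbhs_neq.
  by rewrite /shift !mxE/= addrK eq_sym scalerA mulVf// scale1r.
split; first by apply/cvg_ex; eexists; exact: c.
exact: cvg_lim c.
Unshelve. all: by end_near. Qed.

Lemma continuous_coord j : continuous (fun y : V => y ord0 j).
Proof. exact: coord_continuous. Qed.

Definition offplane : set V := [set x | xlast x != 0].

Lemma open_offplane : open offplane.
Proof.
rewrite (_ : offplane = (fun y : V => y ord0 ord_max) @^-1` [set r | r != 0]) //.
apply: open_comp; first by move=> x _; exact: continuous_coord.
exact: open_neq.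
Qed.

Lemma CK_inv_xlast k : CK offplane k (fun x => (xlast x)^-1).
Proof.
have oU := open_offplane.
have cc x : offplane x -> cvg ((xlast y)^-1 @[y --> BF x]).
  move=> x0; apply/cvg_ex; exists (xlast x)^-1; apply: cvg_within_filter.
  by apply: cvgV => //; exact: continuous_coord.
elim: k => [|k IH]; split => //; try (by move=> x Ux _; exact: cc).
move=> i; split.
  move=> x Ux xB; apply: derivableV => //.
  by have [] := is_derive_coord x i ord_max.
apply: (@CK_eq _ _ (fun x => - (i == ord_max)%:R * ((xlast x)^-1 * (xlast x)^-1))) => //.
  move=> x Ux xB; rewrite /pderiv deriveV//; last by have [] := is_derive_coord x i ord_max.
  have -> : 'D_(e_ i) (@xlast R n) x = (i == ord_max)%:R.
    by have /@derive_val := is_derive_coord x i ord_max.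
  by rewrite expr2 invfM /GRing.scale/= mulNr mulrC mulNr.
by apply: CKZ => //; exact: CKM.
Qed.

End CK.

(** * Averages over vertical segments *)

Lemma subr_via (R : zmodType) (a b c : R) : b - c = (a - c) - (a - b).
Proof. by rewrite opprB [RHS]addrC addrA subrK. Qed.

Lemma subr_via_swap (R : zmodType) (a b c : R) : b - c = (b - a) - (c - a).
Proof. by rewrite opprB addrA subrK. Qed.

Section vertical.
Variables (R : realType) (n : nat).
Local Notation V := 'rV[R]_n.+1.
Local Notation e_ i := (delta_mx (ord0 : 'I_1) i : V).
Local Notation BF x := (within (eball 1) (nbhs (x : V))).
Local Notation mu := (@lebesgue_measure R).
Implicit Types (x y z : V) (f g h : V -> R) (U : set V).

Lemma is_derive_line f z v (c s : R) : derivable f (z + (s * c) *: v) v ->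
  is_derive s 1 (fun s => f (z + (s * c) *: v)) (c * 'D_v f (z + (s * c) *: v)).
Proof.
move=> df.
have line r : derivable f (z + r *: v) v ->
    is_derive r 1 (fun s => f (z + s *: v)) ('D_v f (z + r *: v)).
  move=> dfr; have dfr' := dfr.
  have /cvg_ex[l hl] := dfr.
  have hl' : h^-1 *: ((fun s => f (z + s *: v)) (h *: 1 + r) - f (z + r *: v)) @[h --> 0^'] --> l.
    apply: cvg_trans hl; apply: near_eq_cvg; near=> h => /=.
    by rewrite scaler1 scalerDl addrCA.
  split; first by apply/cvg_ex; exists l; exact: hl'.
  by rewrite /derive (cvg_lim _ hl')// (cvg_lim _ hl).
have := line _ df; set D := 'D_v f _ => dl.
have dc : is_derive s 1 (fun s => s * c : R) c.
  have -> : *%R^~ c = c *: (id : R -> R) by apply/funext => r /=; rewrite mulrC.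
  by apply: is_derive_eq; rewrite /GRing.scale/= mulr1.
have := @is_derive1_comp R (fun s => f (z + s *: v)) (fun s => s * c) s D c dl dc.
by rewrite mulrC.
Unshelve. all: by end_near. Qed.

(** Multiplication of the last coordinate by t, written as a displacement along the last
    basis vector because it will be differentiated along lines of that direction. *)
Definition vscale (t : R) x : V := x + ((t - 1) * xlast x) *: e_ ord_max.

Lemma vscaleE t x i : vscale t x ord0 i = if i == ord_max then t * x ord0 i else x ord0 i.
Proof.
rewrite /vscale !mxE eqxx/=; case: eqP => [->|]; rewrite ?mulr1 ?mulr0 ?addr0//.
by rewrite mulrBl mul1r addrC subrK.
Qed.

Lemma vscale1 x : vscale 1 x = x.
Proof. by rewrite /vscale subrr mul0r scale0r addr0. Qed.

Lemma vscale0_vscale t x : vscale 0 (vscale t x) = vscale 0 x.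
Proof. by apply/rowP => i; rewrite !vscaleE; case: eqP; rewrite ?mul0r. Qed.

Lemma enorm_vscale s t x : 0 <= s -> s <= t -> enorm (vscale s x) <= enorm (vscale t x).
Proof.
move=> s0 st; apply: ler_wsqrtr; apply: ler_sum => i _; rewrite !vscaleE.
case: eqP => // _; rewrite !exprMn ler_wpM2r ?sqr_ge0//.
by rewrite lerXn2r// nnegrE// (le_trans s0).
Qed.

Lemma cvg_vscale (T : Type) (F : set_system T) (a : T -> R) (b : T -> V) t x : Filter F ->
  a u @[u --> F] --> t -> b u @[u --> F] --> x -> vscale (a u) (b u) @[u --> F] --> vscale t x.
Proof.
move=> FF ha hb; apply: cvgD => //; apply: cvgZr_tmp; apply: cvgM.
  by apply: cvgB => //; exact: cvg_cst.
by apply: (cvg_comp _ _ hb); exact: continuous_coord.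
Qed.

(** For x off the x_N-axis the vertical segment from x to the plane x_N = 0 avoids the
    origin. *)
Definition offaxis : set V := [set x | 0 < enorm (vscale 0 x)].

Lemma open_offaxis : open offaxis.
Proof.
rewrite (_ : offaxis = (vscale 0) @^-1` [set x | 0 < enorm x]) //.
apply: open_comp; last exact: open_enorm_gt.
by move=> x _; apply: (@cvg_vscale _ (nbhs x) (fun=> 0) id); [exact: cvg_cst|exact: cvg_id].
Qed.

Lemma offaxis_vscale t x : offaxis x -> offaxis (vscale t x).
Proof. by rewrite /offaxis/= vscale0_vscale. Qed.

Lemma offaxis_neq0 x : offaxis x -> x <> 0.
Proof.
by move=> + x0; rewrite /offaxis/= x0 /vscale /xlast mxE mulr0 scale0r addr0 enorm0 ltxx.
Qed.

Lemma ecball_vscale t x : 0 <= t <= 1 -> ecball 1 x -> ecball 1 (vscale t x).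
Proof.
move=> /andP[t0 t1]; rewrite /ecball/= => x1; apply: le_trans x1.
by rewrite -[in leRHS](vscale1 x) enorm_vscale.
Qed.

Lemma eball_vscale t x : 0 <= t <= 1 -> eball 1 x -> eball 1 (vscale t x).
Proof.
move=> /andP[t0 t1]; rewrite /eball/= => x1; apply: le_lt_trans x1.
by rewrite -[in leRHS](vscale1 x) enorm_vscale.
Qed.

Lemma offaxis_punct t x : 0 <= t <= 1 -> offaxis x -> eball 1 x -> (eball 1 `\ 0) (vscale t x).
Proof.
by move=> t01 ax x1; split; [exact: eball_vscale|exact/offaxis_neq0/offaxis_vscale].
Qed.

Definition ext f x := lim (f y @[y --> BF x]).

Lemma ext_cvg U k f x : CK U k f -> U x -> (ecball 1 `\ 0) x ->
  f y @[y --> BF x] --> ext f x.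
Proof. by move=> hf Ux xB; have := CK_cvg hf Ux xB. Qed.

Lemma ext_in U k f x : CK U k f -> U x -> (eball 1 `\ 0) x -> ext f x = f x.
Proof.
move=> hf Ux xB; rewrite /ext BF_nbhs; last by case: xB.
by apply: cvg_lim => //; exact: CK_continuous hf Ux xB.
Qed.

(** Uniformity in t comes from the compactness of the vertical segment. *)
Lemma vertical_unif k h x (e : R) : CK offaxis k h -> offaxis x -> (ecball 1 `\ 0) x -> 0 < e ->
  \forall y \near BF x, forall t, 0 <= t <= 1 -> `|h (vscale t y) - ext h (vscale t x)| <= e.
Proof.
move=> hh ax xB e0; have := @segment_compact R 0 1.
move=> /compact_near_coveringP/near_covering_withinP.
have PF := BF_proper xB.
move=> /(_ V (BF x) (fun y t => `|h (vscale t y) - ext h (vscale t x)| <= e) _) H.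
apply: (filterS _ (H _)) => [y hy t t01|t]; first by apply: hy; rewrite /= in_itv/=.
rewrite /= in_itv/= => t01.
set z := vscale t x; have az : offaxis z by exact: offaxis_vscale.
have zB : (ecball 1 `\ 0) z.
  by split; [apply: ecball_vscale => //; case: xB|exact: offaxis_neq0].
have hz := ext_cvg hh az zB.
have := hz => /cvgrPdist_le /(_ _ (divr_gt0 e0 (ltr0n R 2))).
rewrite near_withinE => /nbhs_interior W.
have [/= [A B] /= [At Bx] AB] : \forall t' \near t & y \near nbhs x,
   (interior [set x0 | eball 1 x0 -> `|ext h z - h x0| <= e / 2]) (vscale t' y).
  have : vscale u.1 u.2 @[u --> (t, x)] --> z.
    by apply: cvg_vscale; [exact: cvg_fst|exact: cvg_snd].
  by move=> /(_ _ W).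
exists (A, B `&` eball 1) => /=.
  by split => //; apply: filterI; [exact: cvg_within Bx|exact: withinT].
move=> [t' y] /= [At' [By y1]]; rewrite in_itv/= => t'01.
have h1 : `|ext h z - h (vscale t' y)| <= e / 2.
  have /interior_subset := AB (t', y) (conj At' By).
  by apply; exact: eball_vscale.
have h2 : `|ext h z - ext h (vscale t' x)| <= e / 2.
  have az' : offaxis (vscale t' x) by exact: offaxis_vscale.
  have zB' : (ecball 1 `\ 0) (vscale t' x).
    by split; [apply: ecball_vscale => //; case: xB|exact: offaxis_neq0].
  have PF' := BF_proper zB'.
  have c : `|ext h z - h w| @[w --> BF (vscale t' x)] --> `|ext h z - ext h (vscale t' x)|.
    by apply: cvg_norm; apply: cvgB; [exact: cvg_cst|exact: (ext_cvg hh az' zB')].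
  apply: (@closed_cvg _ _ _ PF' _ _ (@closed_le R (e / 2)) _ _ c).
  have := AB (t', x) (conj At' (nbhs_singleton Bx)).
  by rewrite near_withinE; apply: filterS => w; exact.
rewrite (subr_via (ext h z)).
by rewrite (le_trans (ler_normB _ _))// (splitr e) lerD.
Unshelve. all: by end_near. Qed.

(** The exponent m counts derivatives in x_N: each of them brings out a factor t. *)
Definition vint (m : nat) h x : R := \int[mu]_(t in `[0, 1]) (t ^+ m * h (vscale t x)).

Lemma vertical_continuous k h x : CK offaxis k h -> offaxis x -> eball 1 x ->
  {in `[0, 1], continuous (fun t => h (vscale t x))}.
Proof.
move=> hh ax x1 t; rewrite in_itv/= => t01.
apply: (@continuous_comp _ _ _ (fun t => vscale t x) h).
  by apply: cvg_vscale; [exact: cvg_id|exact: cvg_cst].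
by apply: CK_continuous hh _ _; [exact: offaxis_vscale|exact: offaxis_punct].
Qed.

Lemma vint_continuous m k h x : CK offaxis k h -> offaxis x -> eball 1 x ->
  {within `[0, 1], continuous (fun t => t ^+ m * h (vscale t x))}.
Proof.
move=> hh ax x1; apply: continuous_in_subspaceT => t; rewrite inE/= => t01.
apply: cvgM; first exact: exprn_continuous.
exact: vertical_continuous hh ax x1 t t01.
Qed.

Lemma vint_integrable m k h x : CK offaxis k h -> offaxis x -> eball 1 x ->
  mu.-integrable `[0, 1] (EFin \o (fun t => t ^+ m * h (vscale t x))).
Proof.
move=> hh ax x1; apply: continuous_compact_integrable; first exact: segment_compact.
exact: vint_continuous hh ax x1.
Qed.

Lemma le_Rintegral01 (g : R -> R) (e : R) : mu.-integrable `[0, 1] (EFin \o g) ->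
  (forall t, 0 <= t <= 1 -> `|g t| <= e) -> `|\int[mu]_(t in `[0, 1]) g t| <= e.
Proof.
move=> ig ge; apply: (le_trans (le_normr_Rintegral _ ig)) => //.
have -> : e = \int[mu]_(t in `[0, 1]) (cst e t).
  rewrite Rintegral_cst//= lebesgue_measure_itv/= lte_fin ltr01 oppr0 adde0/=.
  by rewrite mulr1.
apply: le_Rintegral => //.
- exact: integrable_norm ig.
- apply: continuous_compact_integrable; first exact: segment_compact.
  by apply: continuous_subspaceT; exact: cst_continuous.
Qed.

(** Near a boundary point the integrands are uniformly close to each other along the
    vertical segments, which makes their integrals a Cauchy filter. *)
Lemma vint_cvg m k h x : CK offaxis k h -> offaxis x -> (ecball 1 `\ 0) x ->
  cvg (vint m h y @[y --> BF x]).
Proof.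
move=> hh ax xB; have PF := BF_proper xB.
apply/cauchy_cvgP/cauchy_exP => e e0.
have un := vertical_unif hh ax xB (divr_gt0 e0 (ltr0n R 4)).
have ob := near_BF open_offaxis ax xB.
have [y0 [un0 [ay0 [y01 _]]]] := filter_ex (filterI un ob).
exists (vint m h y0).
suff : \forall y \near BF x, ball (vint m h y0) e (vint m h y) by [].
near=> y.
have [ay [y1 _]] : offaxis y /\ (eball 1 `\ 0) y by near: y.
have uny : forall t, 0 <= t <= 1 -> `|h (vscale t y) - ext h (vscale t x)| <= e / 4 by near: y.
rewrite /ball/= /vint -RintegralB//; [|exact: vint_integrable hh _ _..].
apply: (@le_lt_trans _ _ (e / 2)); last by rewrite ltr_pdivrMr// ltr_pMr// ltr1n.
apply: le_Rintegral01.
  under [_ \o _]eq_fun do rewrite EFinB.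
  by apply: integrableB => //; exact: vint_integrable hh _ _.
move=> t /[dup] t01 /andP[t0 t1]; rewrite -mulrBr normrM ger0_norm ?exprn_ge0//.
apply: (@le_trans _ _ (1 * `|h (vscale t y0) - h (vscale t y)|)).
  by rewrite ler_wpM2r// exprn_ile1.
rewrite mul1r (subr_via_swap (ext h (vscale t x))).
rewrite (le_trans (ler_normB _ _))// (_ : e / 2 = e / 4 + e / 4); last by field.
by apply: lerD; [exact: un0|exact: uny].
Unshelve. all: by end_near. Qed.

Lemma vscaleD t x s i : vscale t (x + s *: e_ i) =
  vscale t x + (s * (if i == ord_max then t else 1)) *: e_ i.
Proof.
apply/rowP => j; rewrite vscaleE [in RHS]mxE vscaleE !mxE eqxx/=.
case: (eqVneq j i) => [->|_]; last by rewrite !mulr0 !addr0.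
by case: eqP => _; rewrite ?mulr1// mulrDr [t * s]mulrC.
Qed.

Lemma is_derive_vint m k h x i : CK offaxis k.+1 h -> offaxis x -> (eball 1 `\ 0) x ->
  is_derive x (e_ i) (vint m h) (vint (m + (i == ord_max)) (pderiv i h) x).
Proof.
move=> hh ax xB.
have [d /= d0 dP] : exists2 d : R, 0 < d & forall s : R, `|s| < d ->
    (offaxis (x + s *: e_ i) /\ (eball 1 `\ 0) (x + s *: e_ i)) /\
    forall t, 0 <= t <= 1 -> `|pderiv i h (vscale t (x + s *: e_ i)) - pderiv i h (vscale t x)| <= 1.
  have xC := sub_punct xB.
  have n1 := near_punct open_offaxis ax xB.
  have n2 := vertical_unif (CK_pderiv hh i) ax xC ltr01.
  rewrite BF_nbhs in n2; last by case: xB.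
  have c : (x + s *: e_ i) @[s --> (0 : R)] --> x.
    rewrite -[X in _ --> X]addr0 -[X in _ + X](scale0r (e_ i)).
    by apply: cvgD; [exact: cvg_cst|apply: cvgZr_tmp; exact: cvg_id].
  have n3 := c _ (@filterI _ (nbhs x) (nbhs_filter x) _ _ n1 n2).
  move: n3 => /nbhs_ballP [d /= d0 dP].
  exists d => // s sd; have [] : (offaxis (x + s *: e_ i) /\ (eball 1 `\ 0) (x + s *: e_ i)) /\
    (forall t, 0 <= t <= 1 -> `|pderiv i h (vscale t (x + s *: e_ i)) - ext (pderiv i h) (vscale t x)| <= 1).
    by apply: dP; rewrite /ball/= sub0r normrN.
  move=> p1 p2; split => // t t01; rewrite -(@ext_in offaxis k _ (vscale t x)); first exact: p2.
  - exact: CK_pderiv.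
  - exact: offaxis_vscale.
  - by apply: offaxis_punct => //; case: xB.
pose c (t : R) := if i == ord_max then t else 1.
have cE t : c t = t ^+ (i == ord_max) by rewrite /c; case: eqP.
pose F (s t : R) := t ^+ m * h (vscale t (x + s *: e_ i)).
pose I : set R := `]- d, d[%classic.
have Id s : I s -> `|s| < d by rewrite /I/= in_itv/= ltr_norml.
have dF s t : I s -> `[0, 1]%classic t -> is_derive s 1 (F ^~ t)
    (t ^+ m * (c t * pderiv i h (vscale t (x + s *: e_ i)))).
  move=> /Id sI; rewrite /= in_itv/= => t01; have [[as_ [sB _]] _] := dP _ sI.
  have der : derivable h (vscale t (x + s *: e_ i)) (e_ i).
    by apply: CK_derivable hh _ _ _ _; [exact: offaxis_vscale|exact: offaxis_punct].
  rewrite (_ : F ^~ t = t ^+ m *: (fun s => h (vscale t x + (s * c t) *: e_ i))); last first.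
    by apply/funext => r; rewrite /F vscaleD.
  apply: is_deriveZ; rewrite vscaleD; apply: is_derive_line.
  by rewrite -vscaleD.
pose G (t : R) := `|pderiv i h (vscale t x)| + 1.
have Ix : I 0 by rewrite /I/= in_itv/= oppr_lt0 d0.
(* for |s| < d the derivatives stay within 1 of those at s = 0, so G dominates them *)
have main := @cvg_differentiation_under_integral R _ _ mu F `[0, 1]%classic
  (measurable_itv _) 0 (- d) d Ix _ _ G _ _ _.
have intF s : I s -> mu.-integrable `[0, 1] (EFin \o F s).
  by move=> /Id sI; have [[as_ [sB _]] _] := dP _ sI; exact: vint_integrable hh as_ sB.
have intG : mu.-integrable `[0, 1] (EFin \o G).
  apply: continuous_compact_integrable; first exact: segment_compact.
  apply: continuous_in_subspaceT => t; rewrite inE/= => t01.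
  apply: cvgD; last exact: cvg_cst.
  apply: cvg_norm; apply: vertical_continuous t01; [exact: CK_pderiv hh i|exact: ax|by case: xB].
have d1F s t : I s -> `[0, 1]%classic t -> partial1of2 F s t =
   t ^+ m * (c t * pderiv i h (vscale t (x + s *: e_ i))).
  by move=> sI t01; rewrite partial1of2E; have /@derive_val := dF s t sI t01.
have {}main := main intF (fun s t sI t01 => @ex_derive _ _ _ _ _ _ _ (dF s t sI t01)).
have {}main := main (fun t => addr_ge0 (normr_ge0 _) ler01) intG.
have bnd s t : I s -> `[0, 1]%classic t -> `|partial1of2 F s t| <= G t.
  move=> sI t01; rewrite d1F//; move: t01; rewrite /= in_itv/= => /[dup] t01 /andP[t0 t1].
  have [_ /(_ _ t01) b] := dP _ (Id _ sI).
  rewrite cE mulrA -exprD normrM ger0_norm ?exprn_ge0//.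
  apply: (@le_trans _ _ (1 * `|pderiv i h (vscale t (x + s *: e_ i))|)).
    by rewrite ler_wpM2r// exprn_ile1.
  rewrite mul1r /G -lerBlDl (le_trans _ b)//.
  exact: lerB_dist.
have {}main := main bnd.
have E : \int[mu]_(y in `[0, 1]) partial1of2 F 0 y = vint (m + (i == ord_max)) (pderiv i h) x.
  apply: eq_Rintegral => t; rewrite inE/= => t01.
  by rewrite d1F// cE scale0r addr0 mulrA -exprD.
rewrite E in main.
have main' : h0^-1 *: ((vint m h \o shift x) (h0 *: e_ i) - vint m h x) @[h0 --> (0 : R)^'] -->
     vint (m + (i == ord_max)) (pderiv i h) x.
  apply: cvg_trans main; apply: near_eq_cvg; near=> h0.
  by rewrite /F /vint /shift/= addr0 scale0r addr0 [x + _]addrC.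
split; first by apply/cvg_ex; eexists; exact: main'.
exact: cvg_lim main'.
Unshelve. all: by end_near. Qed.

Lemma CK_vint m k h : CK offaxis k h -> CK offaxis k (vint m h).
Proof.
elim: k m h => [|k IH] m h hh; split => //;
  try (by move=> x ax xB; exact: vint_cvg hh ax xB).
move=> i; split.
  by move=> x ax xB; have /@ex_derive := is_derive_vint m i hh ax xB.
apply: (@CK_eq _ _ _ _ (vint (m + (i == ord_max)) (pderiv i h))).
- exact: open_offaxis.
- by move=> x ax xB; rewrite [RHS]/pderiv; have /@derive_val := is_derive_vint m i hh ax xB.
- by apply: IH; exact: CK_pderiv.
Qed.

End vertical.

(** * The weighted Laplacian on even functions *)

Section parity.
Variables (R : realType) (n : nat).
Local Notation V := 'rV[R]_n.+1.
Local Notation e_ i := (delta_mx (ord0 : 'I_1) i : V).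
Local Notation BF x := (within (eball 1) (nbhs (x : V))).
Local Notation mu := (@lebesgue_measure R).
Implicit Types (x y z : V) (f g h : V -> R) (U : set V).

(** Used with s = 1 for functions even in x_N and s = -1 for odd ones. *)
Definition parity (s : R) f := forall x, (eball 1 `\ 0) x -> f (xreflect x) = s * f x.

Lemma enorm_xreflect x : enorm (xreflect x) = enorm x.
Proof.
congr Num.sqrt; apply: eq_bigr => i _; rewrite mxE.
by case: eqP => //; rewrite sqrrN.
Qed.

Lemma punct_xreflect x : (eball 1 `\ 0) x -> (eball 1 `\ 0) (xreflect x).
Proof.
move=> [x1 /eqP x0]; split; first by rewrite /eball/= enorm_xreflect.
by apply/eqP; rewrite -enorm_eq0 enorm_xreflect enorm_eq0.
Qed.

Lemma xreflectD x r i : xreflect x + r *: e_ i =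
  xreflect (x + (r * (-1) ^+ (i == ord_max)) *: e_ i).
Proof.
apply/rowP => j; rewrite !mxE eqxx/=.
case: (eqVneq j i) => [->|_]; last by rewrite !mulr0 !addr0.
by case: eqP => _; rewrite ?expr1 ?expr0 !mulr1// opprD mulrN1 opprK.
Qed.

Lemma cvg_ray x (v : V) (c : R) : x + (r * c) *: v @[r --> (0 : R)] --> x.
Proof.
have : continuous (fun r : R => x + (r * c) *: v).
  move=> r; apply: cvgD; first exact: cvg_cst.
  by apply: cvgZr_tmp; apply: cvgM; [exact: cvg_id|exact: cvg_cst].
by move/(_ 0); rewrite /continuous_at mul0r scale0r addr0.
Qed.

Lemma parity_pderiv s f i : CK setT 1 f -> parity s f ->
  parity (s * (-1) ^+ (i == ord_max)) (pderiv i f).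
Proof.
move=> hf pf x xB; set c := (-1) ^+ _.
have d1 : is_derive (0 : R) 1 (fun r => f (xreflect x + (r * 1) *: e_ i)) (1 * pderiv i f (xreflect x)).
  have := @is_derive_line R n f (xreflect x) (e_ i) 1 0; rewrite mul0r scale0r addr0; apply.
  by apply: CK_derivable hf _ _ _ _ => //; exact: punct_xreflect.
have d2 : is_derive (0 : R) 1 (s *: (fun r => f (x + (r * c) *: e_ i))) (s *: (c * pderiv i f x)).
  apply: is_deriveZ.
  have := @is_derive_line R n f x (e_ i) c 0; rewrite mul0r scale0r addr0; apply.
  by apply: CK_derivable hf _ _ _ _.
have cc := @cvg_ray x (e_ i) c.
have nr : \forall r \near (0 : R), (eball 1 `\ 0) (x + (r * c) *: e_ i).
  apply: cc; apply: filterS (near_punct openT I xB) => y; by case.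
have : 'D_1 (fun r : R => f (xreflect x + (r * 1) *: e_ i)) 0 =
       'D_1 (s *: (fun r : R => f (x + (r * c) *: e_ i))) (0 : R).
  apply: near_eq_derive; apply: filterS nr => r rB.
  by rewrite mulr1 xreflectD pf.
have /@derive_val -> := d1; have /@derive_val -> := d2.
by rewrite mul1r => ->; rewrite /GRing.scale/= mulrA.
Qed.

(** Only the origin is both on the plane x_N = 0 and on the x_N-axis. *)
Lemma CK_full k f : CK (@offplane R n `|` @offaxis R n) k f -> CK setT k f.
Proof.
have cover x : x <> 0 -> (@offplane R n `|` @offaxis R n) x.
  move=> x0; case: (eqVneq (xlast x) 0) => xl; last by left.
  right; rewrite /offaxis/= enorm_gt0; apply/eqP => v0; apply: x0.
  apply/rowP => i; have /rowP/(_ i) := v0; rewrite vscaleE mxE.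
  by case: eqP => // ->; rewrite -[RHS]xl.
elim: k f => [|k IH] f [c1 d1]; split => //;
  try (by move=> x _ xB; apply: c1 => //; apply: cover; case: xB).
move=> i; split; first by move=> x _ xB; apply: (d1 i).1 => //; apply: cover; case: xB.
by apply: IH; exact: (d1 i).2.
Qed.

(** The singular term f_N / x_N of the operator. *)
Definition dquot f x := if xlast x == 0 then pderiv ord_max (pderiv ord_max f) x
  else pderiv ord_max f x / xlast x.

Lemma vscale_line t x : vscale t x = vscale 0 x + (t * xlast x) *: e_ ord_max.
Proof. by rewrite /vscale -addrA -scalerDl -mulrDl sub0r [-1 + t]addrC. Qed.

Lemma odd_vscale0 f x : parity (-1) f -> offaxis x -> eball 1 x -> f (vscale 0 x) = 0.
Proof.
move=> pf ax x1; have := pf (vscale 0 x).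
have -> : xreflect (vscale 0 x) = vscale 0 x.
  by apply/rowP => i; rewrite !mxE; case: eqP => // ->; rewrite eqxx/= mulr1 sub0r mulN1r subrr oppr0.
move=> H; have {}H : f (vscale 0 x) = - 1 * f (vscale 0 x).
  by apply: H; apply: offaxis_punct => //; rewrite lexx ler01.
by move: H; lra.
Qed.

(** As f_N is odd it vanishes on the plane, and f_N(x) is the integral of its own
    derivative along the vertical segment from the plane to x, of length |x_N|. *)
Lemma dquot_vint f x : CK setT 2 f -> parity 1 f -> offaxis x -> (eball 1 `\ 0) x ->
  dquot f x = vint 0 (pderiv ord_max (pderiv ord_max f)) x.
Proof.
move=> hf pf ax [x1 x0]; rewrite /dquot /vint.
under [RHS]eq_Rintegral do rewrite expr0 mul1r.
case: eqP => [xl0|/eqP xl0].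
  under [RHS]eq_Rintegral do rewrite /vscale xl0 mulr0 scale0r addr0.
  rewrite Rintegral_cst//= lebesgue_measure_itv/= lte_fin ltr01 oppr0 adde0/=.
  by rewrite mulr1.
have h2 := CK_pderiv (CK_pderiv hf ord_max) ord_max.
have h1 := CK_pderiv hf ord_max.
pose F t := (xlast x)^-1 * pderiv ord_max f (vscale t x).
have dF (t : R) : 0 <= t <= 1 -> is_derive t 1 F (pderiv ord_max (pderiv ord_max f) (vscale t x)).
  move=> t01.
  have L := @is_derive_line R n (pderiv ord_max f) (vscale 0 x) (e_ ord_max) (xlast x) t.
  rewrite -vscale_line in L.
  have der : derivable (pderiv ord_max f) (vscale t x) (e_ ord_max).
    by apply: CK_derivable h1 _ _ _ _ => //; exact: offaxis_punct.
  have := is_deriveZ (xlast x)^-1 (L der); rewrite [X in is_derive _ _ _ X](mulKf xl0).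
  rewrite (_ : (xlast x)^-1 \*: _ = F)//.
  by apply/funext => r; rewrite /F [in RHS]vscale_line.
have cF (t : R) : 0 <= t <= 1 -> {for t, continuous F}.
  by move=> t01; apply: differentiable_continuous; apply/derivable1_diffP; have [] := dF t t01.
have := @continuous_FTC2 R (fun t => pderiv ord_max (pderiv ord_max f) (vscale t x)) F 0 1 ltr01.
rewrite /Rintegral => ->.
- rewrite -EFinB /= /F vscale1 odd_vscale0//; first by rewrite mulr0 subr0 mulrC.
  by have := parity_pderiv ord_max (CK_pred hf) pf; rewrite eqxx expr1 mul1r.
- apply: continuous_in_subspaceT => t; rewrite inE/= => t01.
  by apply: vertical_continuous t01 => //; apply: CK_subset h2.
- split.
  + move=> t; rewrite in_itv/= => /andP[t0 t1].
    by have [] := dF t _; rewrite ?(ltW t0) ?(ltW t1).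
  + by apply: cvg_at_right_filter; apply: cF; rewrite lexx ler01.
  + by apply: cvg_at_left_filter; apply: cF; rewrite lexx ler01.
- move=> t; rewrite in_itv/= => /andP[t0 t1].
  have /dF/@derive_val E : 0 <= t <= 1 by rewrite !ltW.
  by rewrite derive1E E.
Qed.

(** Off the plane this is a quotient of smooth functions; off the axis it is a vertical
    average of f_NN. Either way at most two derivatives are lost, like for the rest of the
    operator. *)
Lemma CK_dquot k f : CK setT k.+2 f -> parity 1 f -> CK setT k (dquot f).
Proof.
move=> hf pf; apply: CK_full; apply: CK_setU.
  apply: (@CK_eq _ _ _ _ (fun x => pderiv ord_max f x * (xlast x)^-1)).
  - exact: open_offplane.
  - by move=> x; rewrite /offplane/= /dquot => /negbTE ->.
  apply: CKM; [exact: open_offplane| |exact: CK_inv_xlast].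
  by apply: (@CK_subset _ _ _ setT) => //; apply: CK_pred; exact: CK_pderiv.
apply: (@CK_eq _ _ _ _ (vint 0 (pderiv ord_max (pderiv ord_max f)))).
- exact: open_offaxis.
- by move=> x ax xB; rewrite dquot_vint//; apply: CK_le hf.
- by apply: CK_vint; apply: (@CK_subset _ _ _ setT) => //; do 2!apply: CK_pderiv.
Qed.

Lemma CK_lapA k a f : CK setT k.+2 f -> parity 1 f -> CK setT k (lapA a f).
Proof.
move=> hf pf; apply: CKD; first exact: openT.
  by apply: CK_sum => [|i]; [exact: openT|do 2!apply: CK_pderiv].
by apply: CKZ; [exact: openT|exact: CK_dquot].
Qed.

Lemma parity_lapA a f : CK setT 2 f -> parity 1 f -> parity 1 (lapA a f).
Proof.
move=> hf pf x xB; rewrite mul1r /lapA.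
have p1 i : parity ((-1) ^+ (i == ord_max)) (pderiv i f).
  by have := parity_pderiv i (CK_pred hf) pf; rewrite mul1r.
have p2 i : parity 1 (pderiv i (pderiv i f)).
  by have := parity_pderiv i (CK_pderiv hf i) (p1 i); rewrite -expr2 sqrr_sign.
have E1 : \sum_i pderiv i (pderiv i f) (xreflect x) = \sum_i pderiv i (pderiv i f) x.
  by apply: eq_bigr => i _; rewrite (p2 i x xB) mul1r.
have E2 : dquot f (xreflect x) = dquot f x.
  rewrite /dquot /xlast mxE eqxx oppr_eq0.
  case: ifP => _; first by rewrite (p2 ord_max x xB) mul1r.
  by rewrite (p1 ord_max x xB) eqxx expr1 mulN1r invrN mulrNN.
exact: (congr2 (fun c d => c + (2 * a - 1) * d) E1 E2).
Qed.

Lemma CK_neg_lapA_iter a (p i : nat) f : CK setT (2 * p) f -> parity 1 f -> (i <= p)%N ->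
  CK setT (2 * (p - i)) (neg_lapA_iter a i f) /\ parity 1 (neg_lapA_iter a i f).
Proof.
move=> hf pf; elim: i => [|i IH] ip; first by rewrite subn0.
have {IH} [h1 h2] := IH (ltnW ip).
have E : (2 * (p - i) = (2 * (p - i.+1)).+2)%N.
  rewrite subnS; have : (0 < p - i)%N by rewrite subn_gt0.
  by case: (p - i)%N => // q _; rewrite mulnS.
rewrite E in h1; split.
  apply: (@CK_eq _ _ _ _ (fun x => -1 * lapA a (neg_lapA_iter a i f) x)).
  - exact: openT.
  - by move=> x _ _; rewrite mulN1r.
  - by apply: CKZ; [exact: openT|exact: CK_lapA].
move=> x xB; rewrite /= mul1r parity_lapA ?mul1r//.
exact: CK_le h1.
Qed.

Lemma Ck_upto_CK k f : Ck_upto k (eball 1 `\ 0) (ecball 1 `\ 0) f -> CK setT k f.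
Proof.
move=> [_ dC eC].
suff H : forall m s, (size s + m <= k)%N -> CK setT m (mpderiv s f) by apply: (H k [::]).
elim => [|m IH] s sm.
  split => // x _ xB.
  have [|g [gc gE]] := eC s; first by rewrite addn0 in sm.
  have gx : g y @[y --> BF x] --> g x.
    have h := (subspace_continuousP _ _).1 gc x xB.
    have NB := near_BF openT I xB; rewrite near_withinE in NB.
    apply: cvg_trans h; apply: cvg_app => P H.
    have {}H : \forall y \near x, (ecball 1 `\ 0) y -> P y := H.
    suff : \forall y \near x, eball 1 y -> P y by [].
    apply: filterS2 H NB => y h1 h2 y1.
    by apply: h1; apply: sub_punct; exact: (h2 y1).2.
  apply/cvg_ex; exists (g x); apply: cvg_trans gx; apply: near_eq_cvg.
  by apply: filterS (near_BF openT I xB) => y [_ yB]; rewrite gE// inE.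
have sm' : (size s <= k)%N by rewrite (leq_trans _ sm)// leq_addr.
have [c0 _] : CK setT 0 (mpderiv s f).
  by apply: CK_le (IH _ _) => //; rewrite (leq_trans _ sm)// leq_add2l.
split => // i; split.
  by move=> x _ xB; apply: dC => //; rewrite (leq_trans _ sm)// addnS ltnS leq_addr.
by apply: (IH (i :: s)); rewrite /= addSnnS.
Qed.

End parity.

(** * Derivatives along rays *)

Section calculus.
Variables (R : realType) (n : nat).
Local Notation V := 'rV[R]_n.+1.
Local Notation e_ i := (delta_mx (ord0 : 'I_1) i : V).
Local Notation BF x := (within (eball 1) (nbhs (x : V))).
Implicit Types (x y z v w : V) (f g h : V -> R).

(** Membership in the class only speaks of partial derivatives. Displacements are
    decomposed into steps along the coordinates, and the mean value theorem turns each
    step into a partial derivative at a nearby point, which is continuous. *)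
Lemma coord_increment f k x w (c : R) i : CK setT k.+1 f -> (eball 1 `\ 0) x ->
  h^-1 * (f (x + h *: w + (h * c) *: e_ i) - f (x + h *: w)) @[h --> (0 : R)^']
    --> c * pderiv i f x.
Proof.
move=> hf xB; apply/cvgrPdist_le => e e0.
have C0 : 0 < `|c| + 1 by rewrite ltr_wpDl.
have := CK_continuous (CK_pderiv hf i) I xB.
move=> /cvgrPdist_le /(_ _ (divr_gt0 e0 C0)) n1.
have /nbhs_ballP[d /= d0 dP] := @filterI _ (nbhs x) (nbhs_filter x) _ _ n1 (near_punct openT I xB).
pose K := `|w| + `|c *: e_ i| + 1.
have K0 : 0 < K by rewrite ltr_wpDl// addr_ge0.
near=> h.
have h0 : h != 0 by near: h; exact: nbhs_dnbhs_neq.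
have hd : `|h| < d / K.
  near: h; apply: dnbhs0_lt; exact: divr_gt0.
have inB (s : R) : 0 <= s <= 1 -> ball x d (x + h *: w + (s * (h * c)) *: e_ i).
  move=> /andP[s0 s1]; rewrite -ball_normE/= -addrA opprD addrA subrr sub0r normrN.
  rewrite mulrCA -scalerA -scalerDr normrZ; apply: le_lt_trans (_ : `|h| * K < d).
    rewrite ler_wpM2l// (le_trans (ler_normD _ _))// /K -addrA lerD2l.
    rewrite -scalerA normrZ ger0_norm// (le_trans (ler_piMl _ s1))//.
    by rewrite lerDl.
  by rewrite -ltr_pdivlMr.
have dl (s : R) : 0 <= s <= 1 -> is_derive s 1 (fun s => f (x + h *: w + (s * (h * c)) *: e_ i))
    (h * c * pderiv i f (x + h *: w + (s * (h * c)) *: e_ i)).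
  move=> s01; apply: is_derive_line.
  by have [_ [_ yB]] := dP _ (inB _ s01); exact: CK_derivable hf _ _ _ yB.
have [||s] := @MVT R (fun s => f (x + h *: w + (s * (h * c)) *: e_ i))
   (fun s => h * c * pderiv i f (x + h *: w + (s * (h * c)) *: e_ i)) 0 1 ltr01.
- by move=> s; rewrite in_itv/= => /andP[s0 s1]; apply: dl; rewrite !ltW.
- apply: continuous_in_subspaceT => s; rewrite inE/= in_itv/= => s01.
  by apply: differentiable_continuous; apply/derivable1_diffP; have [] := dl s s01.
rewrite in_itv/= => /andP[s0 s1]; rewrite mul1r mul0r scale0r addr0 subr0 mulr1 => ->.
rewrite -mulrA mulKf// -mulrBr normrM.
have [E _] := dP _ (inB s ltac:(by rewrite !ltW)).
rewrite (le_trans (ler_wpM2l _ E))// mulrA ler_pdivrMr// mulrC ler_pM2l// lerDl.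
exact: ler01.
Unshelve. all: by end_near. Qed.

Lemma directional_cvg f k x v : CK setT k.+1 f -> (eball 1 `\ 0) x ->
  h^-1 * (f (x + h *: v) - f x) @[h --> (0 : R)^'] --> \sum_i v ord0 i * pderiv i f x.
Proof.
move=> hf xB.
suff H (r : seq 'I_n.+1) :
  h^-1 * (f (x + h *: \sum_(i <- r) v ord0 i *: e_ i) - f x) @[h --> (0 : R)^']
    --> \sum_(i <- r) v ord0 i * pderiv i f x.
  by have := H (index_enum _); rewrite -row_sum_delta.
elim: r => [|i r IH].
  rewrite !big_nil; under eq_fun do rewrite scaler0 addr0 subrr mulr0.
  exact: cvg_cst.
rewrite big_cons; set w := \sum_(j <- r) v ord0 j *: e_ j in IH *.
have H1 := @coord_increment f k x w (v ord0 i) i hf xB.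
suff -> : (fun h : R => h^-1 * (f (x + h *: (v ord0 i *: e_ i + w)) - f x)) =
    (fun h : R => h^-1 * (f (x + h *: w + (h * v ord0 i) *: e_ i) - f (x + h *: w)) +
       h^-1 * (f (x + h *: w) - f x)) by rewrite big_cons; exact: cvgD.
apply/funext => h; rewrite scalerDr [h *: (_ *: _) + _]addrC scalerA addrA.
by rewrite -mulrDr addrA subrK.
Qed.

Lemma is_derive_ray f k v (r : R) : CK setT k.+1 f -> (eball 1 `\ 0) (r *: v) ->
  is_derive r 1 (fun r => f (r *: v)) (\sum_i v ord0 i * pderiv i f (r *: v)).
Proof.
move=> hf xB; have := @directional_cvg f k _ v hf xB.
set l := \sum_i _ => H.
have {}H : h^-1 *: (((fun r => f (r *: v)) \o shift r) (h *: (1:R)) - f (r *: v)) @[h --> (0 : R)^'] --> l.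
  apply: cvg_trans H; apply: near_eq_cvg; near=> h => /=.
  by rewrite scaler1 /shift/= scalerDl [h *: v + _]addrC.
split; first by apply/cvg_ex; exists l; exact: H.
exact: cvg_lim H.
Unshelve. all: by end_near. Qed.

(** The closed annulus is compact, and f has limits at its outer boundary as well. *)
Lemma bounded_annulus f k (s : R) : CK setT k f -> 0 < s ->
  exists2 M, 0 <= M & forall x, s <= enorm x -> enorm x < 1 -> `|f x| <= M.
Proof.
move=> hf s0; pose K : set V := [set x | s <= enorm x] `&` ecball 1.
have cK : compact K.
  apply: (@compact_ecball_sub _ _ 1); last by move=> x [].
  apply: closedI; last exact: closed_ecball.
  rewrite (_ : mkset _ = (@enorm R n.+1) @^-1` [set r | s <= r])//.
  apply: preimage_closed; last exact: closed_ge.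
  by move=> x _; exact: enorm_continuous.
have : \forall M \near +oo%R, K `<=` (fun x => enorm x < 1 -> `|f x| <= M).
  apply: (compact_near_coveringP _).1 cK _ (+oo%R) (fun M x => enorm x < 1 -> `|f x| <= M) _ _.
  move=> x [sx x1].
  have xB : (ecball 1 `\ 0) x.
    by split => //; move/eqP; rewrite -enorm_eq0 => /eqP x0; move: sx; rewrite /= x0 leNgt s0.
  have /cvgrPdist_le /(_ _ ltr01) := ext_cvg hf I xB.
  rewrite near_withinE => n1.
  exists ([set y | eball 1 y -> `|ext f x - f y| <= 1], [set M | `|ext f x| + 1 <= M]) => /=.
    by split => //; exact: nbhs_pinfty_ge.
  move=> [y M] /= [h1 h2] y1; apply: le_trans h2.
  by rewrite -lerBlDl (le_trans _ (h1 y1))// distrC lerB_dist.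
move=> [M [_ MP]]; exists (Num.max 0 (M + 1)); first by rewrite le_max lexx.
move=> x sx x1; apply: le_trans (_ : M + 1 <= _); last by rewrite le_max lexx orbT.
by apply: MP => //; [rewrite ltrDl|split => //; exact: ltW].
Qed.

End calculus.

(** * Fubini on coordinate lines and scaling of volumes *)

Section lebesgue_rV_theory.
Variable R : realType.
Local Notation leb := (@lebesgue_measure R).

Definition box (n : nat) (k : R) : set 'rV[R]_n := [set x | forall i, `|x ord0 i| <= k].

Lemma measurable_box n k : measurable (@box n k).
Proof.
rewrite (_ : box k = \bigcap_(i in [set: 'I_n])
   ([set: 'rV[R]_n] `&` (fun y : 'rV[R]_n => y ord0 i) @^-1` `[- k, k])).
  apply: fin_bigcap_measurable => // i _.
  by apply: measurable_rV_coord => //; exact: measurable_itv.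
apply/seteqP; split => x /= xk.
  by move=> i _; split => //=; rewrite in_itv/= -ler_norml.
by move=> i; have [_] := xk i I; rewrite /= in_itv/= -ler_norml.
Qed.

Lemma rV_rcons_last n (x : 'rV[R]_n) t : rV_rcons (x, t) ord0 ord_max = t.
Proof. by rewrite mxE unlift_none. Qed.

Lemma rV_rcons_lift n (x : 'rV[R]_n) t i :
  rV_rcons (x, t) ord0 (lift ord_max i) = x ord0 i.
Proof. by rewrite mxE liftK. Qed.

Lemma ord_cases n (P : 'I_n.+1 -> Prop) :
  P ord_max -> (forall j : 'I_n, P (lift ord_max j)) -> forall i, P i.
Proof. by move=> Pm Pl i; case: (unliftP ord_max i) => [j|] ->. Qed.

Lemma box_rcons n k (x : 'rV[R]_n) t :
  box k (rV_rcons (x, t)) <-> box k x /\ `|t| <= k.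
Proof.
split=> [xk|[xk tk]].
  split; last by have := xk ord_max; rewrite rV_rcons_last.
  by move=> i; have := xk (lift ord_max i); rewrite rV_rcons_lift.
apply: ord_cases => [|j]; first by rewrite rV_rcons_last.
by rewrite rV_rcons_lift.
Qed.

Lemma lebesgue_rV_box n k : (lebesgue_rV n (@box n k) < +oo)%E.
Proof.
elim: n => [|n IH]; first by rewrite /= diracE; case: (_ \in _); rewrite ltry.
rewrite /= /pushforward.
have -> : @rV_rcons R n @^-1` (@box n.+1 k) = @box n k `*` `[- k, k].
  apply/seteqP; split => -[x t] /=.
    by move=> /box_rcons[? ?]; split => //=; rewrite in_itv/= -ler_norml.
  by move=> [/= ? ?]; apply/box_rcons; split => //; rewrite ler_norml.
rewrite product_measure1E//; last exact: measurable_box.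
apply: lte_mul_pinfty => //.
  by rewrite ge0_fin_numE.
have /= H := @lebesgue_measure_itv R `[(- k)%R, k].
by rewrite [ltLHS]H; case: ifP => _; rewrite ltry.
Qed.

Lemma sigma_finite_lebesgue_rV n : sigma_finite setT (@lebesgue_rV R n).
Proof.
exists (fun k : nat => @box n k%:R).
  apply/esym/seteqP; split => // x _.
  have [k xk] : exists k : nat, `|x| <= k%:R.
    by exists (Num.bound `|x|); rewrite ltW// archi_boundP.
  exists k => // i; apply: le_trans xk.
  rewrite [leRHS]mx_normrE; apply: le_trans (le_bigmax _ _ (ord0, i)).
  by [].
by move=> k; split; [exact: measurable_box|exact: lebesgue_rV_box].
Qed.

HB.instance Definition _ n := @Measure_isSigmaFinite.Build _ _ _ (@lebesgue_rV R n)
  (@sigma_finite_lebesgue_rV n).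

Local Open Scope ereal_scope.

Lemma integral_rVS n (f : 'rV[R]_n.+1 -> \bar R) :
  measurable_fun setT f -> (@lebesgue_rV R n.+1).-integrable setT f ->
  \int[lebesgue_rV n.+1]_x f x =
  \int[@lebesgue_rV R n \x leb]_z f (rV_rcons z).
Proof.
move=> mf intf.
have intf' : (@lebesgue_rV R n \x leb).-integrable (@rV_rcons R n @^-1` setT) (f \o @rV_rcons R n).
  rewrite preimage_setT; apply/integrableP; split.
    by apply: measurableT_comp => //; exact: measurable_rV_rcons.
  have /integrableP[_] := intf; apply: le_lt_trans.
  rewrite /= ge0_integral_pushforward//; first exact: measurable_rV_rcons.
  by apply: measurableT_comp.
by rewrite /= integral_pushforward//; exact: measurable_rV_rcons.
Qed.

Lemma integrable_rVS n (f : 'rV[R]_n.+1 -> \bar R) :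
  measurable_fun setT f -> (@lebesgue_rV R n.+1).-integrable setT f ->
  (@lebesgue_rV R n \x leb).-integrable setT (f \o @rV_rcons R n).
Proof.
move=> mf intf; apply/integrableP; split.
  by apply: measurableT_comp => //; exact: measurable_rV_rcons.
have /integrableP[_] := intf; apply: le_lt_trans.
rewrite /= ge0_integral_pushforward//; first exact: measurable_rV_rcons.
by apply: measurableT_comp.
Qed.

Lemma ge0_integral_rVS n (f : 'rV[R]_n.+1 -> \bar R) :
  measurable_fun setT f -> (forall x, 0 <= f x) ->
  \int[lebesgue_rV n.+1]_x f x =
  \int[@lebesgue_rV R n \x leb]_z f (rV_rcons z).
Proof.
move=> mf f0.
by rewrite /= ge0_integral_pushforward//; exact: measurable_rV_rcons.
Qed.

Lemma integrable_box n (f : 'rV[R]_n -> R) (M k : R) : measurable_fun setT f ->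
  (forall x, `|f x| <= M)%R -> (forall x, ~ box k x -> f x = 0%R) ->
  (@lebesgue_rV R n).-integrable setT (EFin \o f).
Proof.
move=> mf fM f0.
have -> : EFin \o f = (EFin \o f) \_ (@box n k).
  by apply/funext => x; rewrite patchE; case: ifPn => // /negP; rewrite inE => /f0 /= ->.
apply: (integrable_mkcond _ (@measurable_box n k)).1.
apply: measurable_bounded_integrable; first exact: measurable_box.
- exact: lebesgue_rV_box.
- exact: measurable_funTS.
- by exists M; split => [|K MK x _]; [exact: num_real|rewrite /= (le_trans (fM x))// ltW].
Qed.

Definition setcoord n (x : 'rV[R]_n) (j : 'I_n) (t : R) : 'rV[R]_n :=
  \row_i (if i == j then t else x ord0 i).

Lemma eq_row n (x y : 'rV[R]_n) : (forall i, x ord0 i = y ord0 i) -> x = y.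
Proof. by move=> xy; apply/rowP => i; exact: xy. Qed.

Lemma setcoordE n (x : 'rV[R]_n) (j i : 'I_n) (t : R) :
  setcoord x j t ord0 i = if i == j then t else x ord0 i.
Proof. by rewrite mxE. Qed.

(** By Fubini. Whatever the axis j, the induction splits off the last coordinate, as the
    recursive definition of the measure does, until it meets j. *)
Lemma integral_lines_eq0 n (j : 'I_n) (g : 'rV[R]_n -> R) (M k : R) :
  measurable_fun setT g -> (forall x, `|g x| <= M)%R ->
  (forall x, ~ box k x -> g x = 0%R) ->
  (forall x, \int[leb]_t (g (setcoord x j t))%:E = 0) ->
  \int[lebesgue_rV n]_x (g x)%:E = 0.
Proof.
elim: n j g => [[]//|n IH] j g mg gM g0 gl.
have ig := integrable_box mg gM g0.
have mgE : measurable_fun setT (EFin \o g) by exact/measurable_EFinP.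
have ig' := integrable_rVS mgE ig.
rewrite (integral_rVS mgE ig); case: (unliftP ord_max j) gl => [i ->|->] gl; last first.
  rewrite -integral12_prod_meas1//; apply: integral0_eq => x _.
  rewrite /fubini_F -[RHS](gl (rV_rcons (x, 0%R))); apply: eq_integral => t _ /=.
  congr (g _)%:E; apply: eq_row; apply: ord_cases => [|l]; rewrite setcoordE.
    by rewrite eqxx; exact: rV_rcons_last.
  by rewrite !rV_rcons_lift eq_sym (negbTE (neq_lift _ _)).
rewrite -integral21_prod_meas1//; apply: integral0_eq => t _.
rewrite /fubini_G.
apply: (IH i (fun x => g (rV_rcons (x, t)))).
- apply: (measurableT_comp mg); apply: (measurableT_comp (@measurable_rV_rcons R n)).
  exact: measurable_pair2.
- by move=> x; exact: gM.
- by move=> x xk; apply: g0 => /box_rcons[].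
- move=> x; rewrite -[RHS](gl (rV_rcons (x, t))); apply: eq_integral => s _.
  congr (g _)%:E; apply: eq_row; apply: ord_cases => [|l]; rewrite setcoordE.
    by rewrite !rV_rcons_last (negbTE (neq_lift _ _)).
  by rewrite !rV_rcons_lift setcoordE (inj_eq lift_inj).
Qed.

Lemma ge0_integral_scale1 (f : R -> \bar R) (c : R) : (0 < c)%R ->
  measurable_fun setT f -> (forall x, 0 <= f x) ->
  \int[leb]_x f (c * x)%R = (c^-1)%:E * \int[leb]_x f x.
Proof.
move=> c0 mf f0.
have mc : measurable_fun [set: R] ( *%R c) by exact: mulrl_measurable.
have ci0 : (0 <= c)%R := ltW c0.
pose mulc (t : measurableTypeR R) : measurableTypeR R := (c * t)%R.
have [p pE] : {p : {measure set (measurableTypeR R) -> \bar R} | p = pushforward leb mulc :> (set _ -> \bar R)}.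
  by unshelve eexists (pushforward leb mulc).
have key A : measurable A -> leb A = mscale (NngNum ci0) p A.
  move=> mA; rewrite (@lebesgue_measure_unique R (mscale (NngNum ci0) p))//.
  move=> X [[a b] _ <-].
  have pab : p `]a, b]%classic = leb (mulc @^-1` `]a, b]) by rewrite pE.
  transitivity (c%:E * p `]a, b]%classic); last by [].
  rewrite pab.
  have -> : mulc @^-1` `]a, b] = `](c^-1 * a)%R, (c^-1 * b)%R]%classic.
    by apply/seteqP; split => t /=; rewrite !in_itv/= ler_pdivlMl// ltr_pdivrMl.
  have H (r s : R) : leb `]r, s] = (if (r < s)%R then (s - r)%:E else 0).
    by rewrite lebesgue_measure_itv/= lte_fin.
  rewrite !H ltr_pM2l ?invr_gt0//; case: ifP => _; last by rewrite mule0.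
  by rewrite -EFinM -mulrBr mulVKf// gt_eqF.
have E : \int[leb]_x f x = \int[mscale (NngNum ci0) p]_x f x.
  by apply: eq_measure_integral => A mA _; exact: key.
rewrite E ge0_integral_mscale// pE ge0_integral_pushforward//=.
by rewrite muleA -EFinM mulVf ?mul1e// gt_eqF.
Qed.

Lemma rV_rcons_scale n (c : R) z : (c *: @rV_rcons R n z = rV_rcons (c *: z.1, c * z.2))%R.
Proof.
by case: z => x t; apply: eq_row; apply: ord_cases => [|i]; rewrite [LHS]mxE
  ?rV_rcons_last ?rV_rcons_lift ?[RHS]mxE.
Qed.

Lemma measurable_scale_rV n (c : R) : measurable_fun [set: 'rV[R]_n] ( *:%R c).
Proof.
apply: measurable_fun_rV => i; rewrite (_ : (fun _ => _) = (fun x : 'rV[R]_n => c * x ord0 i)%R).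
  by apply: measurable_funM => //; exact: measurable_rV_coord.
by apply/funext => x; rewrite mxE.
Qed.

Lemma ge0_integral_scale n (f : 'rV[R]_n -> \bar R) (c : R) : (0 < c)%R ->
  measurable_fun setT f -> (forall x, 0 <= f x) ->
  \int[lebesgue_rV n]_x f (c *: x)%R = (c^-1 ^+ n)%:E * \int[lebesgue_rV n]_x f x.
Proof.
elim: n f => [|n IH] f c0 mf f0.
  rewrite expr0 mul1e; apply: eq_integral => x _; congr (f _).
  by apply: eq_row => -[].
rewrite !ge0_integral_rVS//; last first.
  by apply: (measurableT_comp mf); exact: measurable_scale_rV.
have mfr : measurable_fun [set: ('rV[R]_n * measurableTypeR R)%type] (f \o @rV_rcons R n).
  by apply: (measurableT_comp mf); exact: measurable_rV_rcons.
rewrite !fubini_tonelli1//; last first.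
  apply: (measurableT_comp mf); apply: (measurableT_comp (@measurable_scale_rV _ c)).
  exact: measurable_rV_rcons.
rewrite /fubini_F.
pose g x := \int[leb]_t f (rV_rcons (x, t)).
have mg : measurable_fun setT g.
  exact: (@measurable_fun_fubini_tonelli_F _ _ _ (measurableTypeR R) _ leb _ mfr (fun z => f0 _)).
have g0 x : 0 <= g x by exact: integral_ge0.
transitivity (\int[lebesgue_rV n]_x ((c^-1)%:E * g (c *: x)%R)).
  apply: eq_integral => x _ /=.
  under eq_integral do rewrite rV_rcons_scale/=.
  rewrite (@ge0_integral_scale1 (fun t => f (rV_rcons ((c *: x)%R, t))))//.
  by apply: (measurableT_comp mfr); exact: measurable_pair1.
have mgc : measurable_fun setT (fun x : 'rV[R]_n => g (c *: x)%R).
  by apply: (measurableT_comp mg); exact: measurable_scale_rV.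
have cV0 : 0 <= (c^-1)%:E by rewrite lee_fin invr_ge0 ltW.
rewrite (ge0_integralZl _ measurableT mgc (fun x _ => g0 _) cV0).
by rewrite IH// muleA -EFinM exprS.
Qed.

Lemma lebesgue_rV_scale n (A : set 'rV[R]_n) (c : R) : (0 < c)%R -> measurable A ->
  lebesgue_rV n ( *:%R c @^-1` A) = (c^-1 ^+ n)%:E * lebesgue_rV n A.
Proof.
move=> c0 mA; have := @ge0_integral_scale n (fun x => (\1_A x)%:E) c c0.
have -> : \int[lebesgue_rV n]_x (\1_A x)%:E = lebesgue_rV n A.
  by rewrite integral_indic// setIT.
move=> <-; last 2 first.
- exact/measurable_EFinP/measurable_indic.
- by move=> x; rewrite lee_fin.
rewrite (eq_integral (fun x => (\1_( *:%R c @^-1` A) x)%:E)).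
  rewrite integral_indic ?setIT//.
  by rewrite -[X in measurable X]setTI; exact: measurable_scale_rV.
by move=> x _; rewrite !indicE; congr (_%:R%:E); apply/idP/idP; rewrite !inE.
Qed.

End lebesgue_rV_theory.

(** * Polar coordinates *)

Section restriction.
Local Open Scope ereal_scope.
Context d (T : measurableType d) (R : realType) (mu : {measure set T -> \bar R}).

Lemma integral_mrestr (D : set T) (mD : measurable D) (f : T -> \bar R) :
  (mrestr mu mD).-integrable setT f ->
  \int[mrestr mu mD]_x f x = \int[mu]_(x in D) f x.
Proof.
move=> fi; have mC : measurable (~` D) by exact: measurableC.
have nC : mrestr mu mD (~` D) = 0 by rewrite /mrestr setICl measure0.
rewrite [LHS](negligible_integral mC)//=.
rewrite setDE setCK setTI; apply: eq_measure_integral => A mA AD.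
by rewrite /= /mrestr setIidl.
Qed.

Lemma integrable_mrestr (D : set T) (mD : measurable D) (f : T -> R) (M : R) :
  mu D < +oo -> measurable_fun setT f -> (forall x, `|f x| <= M)%R ->
  (mrestr mu mD).-integrable setT (EFin \o f).
Proof.
move=> muD mf fM; apply: measurable_bounded_integrable => //.
  by rewrite /= /mrestr setTI.
by exists M; split => [|K MK x _]; [exact: num_real|rewrite /= (le_trans (fM x))// ltW].
Qed.

Lemma integral_mscale (k : {nonneg R}) (f : T -> \bar R) : mu.-integrable setT f ->
  \int[mscale k mu]_x f x = k%:num%:E * \int[mu]_x f x.
Proof.
move=> fi; have /integrableP[mf _] := fi.
rewrite [LHS]integralE [in RHS]integralE !ge0_integral_mscale//.
- have p1 := integrable_pos_fin_num measurableT fi; have p2 := integrable_neg_fin_num measurableT fi.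
  case: (\int[mu]_x f^\+ x) p1 => // r _; case: (\int[mu]_x f^\- x) p2 => // t _.
  by rewrite muleBr.
- exact: measurable_funeneg.
- exact: measurable_funepos.
Qed.

End restriction.

Section polar.
Local Open Scope ereal_scope.
Variables (R : realType) (n : nat).
Local Notation V := 'rV[R]_n.+1.
Local Notation lam := (@lebesgue_rV R n.+1).
Local Notation leb := (@lebesgue_measure R).
Local Notation sig := (@sphere_measure R n.+1).
Local Notation N := (n.+1%:R : R).

Lemma eball_box : (eball 1 : set V) `<=` box 1.
Proof.
by move=> x; rewrite /eball/= => x1 i; rewrite ltW// (le_lt_trans (coord_le_enorm _ _)).
Qed.

Lemma lebesgue_rV_eball : lam (eball 1) < +oo.
Proof.
apply: (le_lt_trans _ (@lebesgue_rV_box R n.+1 1)).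
apply: le_measure; rewrite ?inE; [exact: measurable_eball|exact: measurable_box|].
exact: eball_box.
Qed.

Lemma fin_num_sphere_measure : fin_num_fun sig.
Proof.
move=> A mA; rewrite ge0_fin_numE// /sphere_measure lte_mul_pinfty//.
apply: le_lt_trans lebesgue_rV_eball; apply: le_measure; rewrite ?inE.
- apply: measurableI; last exact: measurable_eball.
  by rewrite -[X in measurable X]setTI; exact: measurable_edir.
- exact: measurable_eball.
- exact: subIsetr.
Qed.

HB.instance Definition _ := @Measure_isFinite.Build _ _ _ sig fin_num_sphere_measure.

Definition unit_cone (A : set V) : set V := @edir R n.+1 @^-1` A `&` eball 1.

Lemma measurable_unit_cone A : measurable A -> measurable (unit_cone A).
Proof.
move=> mA; apply: measurableI; last exact: measurable_eball.
by rewrite -[X in measurable X]setTI; exact: measurable_edir.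
Qed.

Lemma edirZ (c : R) x : (0 < c)%R -> edir (c *: x : V) = edir x.
Proof.
move=> c0; rewrite /edir enormZ gtr0_norm// scalerA invfM mulrAC.
by rewrite mulVf ?mul1r// gt_eqF.
Qed.

Lemma enorm_edir (x : V) : (enorm x *: edir x)%R = x.
Proof.
case: (eqVneq x 0%R) => [->|x0]; first by rewrite enorm0 scale0r.
by rewrite /edir scalerA divff ?scale1r// enorm_eq0.
Qed.

Definition nroot (q : R) : R := (q `^ N^-1)%R.

Lemma nroot_exp (r : R) : (0 <= r)%R -> nroot (r ^+ n.+1) = r.
Proof.
by move=> r0; rewrite /nroot -powR_mulrn// -powRrM divff ?powRr1// pnatr_eq0.
Qed.

Lemma exp_nroot (q : R) : (0 <= q)%R -> (nroot q ^+ n.+1 = q)%R.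
Proof.
by move=> q0; rewrite /nroot -powR_mulrn ?powR_ge0// -powRrM mulVf ?powRr1// pnatr_eq0.
Qed.

Lemma nroot_gt0 (q : R) : (0 < q)%R -> (0 < nroot q)%R.
Proof. by move=> q0; rewrite /nroot powR_gt0. Qed.

Lemma unit_cone_dilate (A : set V) (q : R) : measurable A -> (0 < q)%R ->
  lam (@edir R n.+1 @^-1` A `&` eball (nroot q)) = q%:E * lam (unit_cone A).
Proof.
move=> mA q0; have r0 := nroot_gt0 q0.
have -> : @edir R n.+1 @^-1` A `&` eball (nroot q) = ( *:%R (nroot q)^-1) @^-1` unit_cone A.
  apply/seteqP; split => x /=; rewrite /unit_cone /eball /= edirZ ?invr_gt0// enormZ;
    by rewrite gtr0_norm ?invr_gt0// ltr_pdivrMl// mulr1.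
rewrite lebesgue_rV_scale ?invr_gt0//; last exact: measurable_unit_cone.
by rewrite invrK exp_nroot// ltW.
Qed.

Definition radius_pow (x : V) : measurableTypeR R := (enorm x ^+ n.+1)%R.

Lemma measurable_radius_pow : measurable_fun [set: V] radius_pow.
Proof. by apply: measurable_funX; exact: measurable_enorm. Qed.

Lemma unit_itv_fin : leb `[0%R, 1%R[%classic < +oo.
Proof. by rewrite lebesgue_measure_itv/= lte_fin ltr01 -EFinB ltry. Qed.

Local Notation munit := (measurable_itv `[0%R, 1%R[ : measurable (`[0%R, 1%R[%classic : set (measurableTypeR R))).

(** Dilations make the law of |x|^N on a cone over A uniform: this is the whole
    content of polar coordinates for a surface measure defined through cones. *)
Lemma cone_radius_law (A : set V) (B : set (measurableTypeR R)) :
  measurable A -> measurable B ->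
  lam (unit_cone A `&` radius_pow @^-1` B) = lam (unit_cone A) * mrestr leb munit B.
Proof.
move=> mA mB; have mC := measurable_unit_cone mA.
have finC : lam (unit_cone A) \is a fin_num.
  rewrite ge0_fin_numE//; apply: le_lt_trans lebesgue_rV_eball.
  by apply: le_measure; rewrite ?inE//; [exact: measurable_eball|exact: subIsetr].
pose c : {nonneg R} := NngNum (fine_ge0 (measure_ge0 lam (unit_cone A))).
have cE : (c%:num)%:E = lam (unit_cone A) by rewrite /= fineK.
have [k kE] : {k : {measure set (measurableTypeR R) -> \bar R} |
    k = pushforward (mrestr lam mC) radius_pow :> (set _ -> \bar R)}.
  unshelve eexists (pushforward (mrestr lam mC) radius_pow) => //.
  exact: measurable_radius_pow.
have E0 : lam (unit_cone A `&` radius_pow @^-1` B) = k B.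
  by rewrite kE /pushforward /mrestr setIC.
rewrite E0 -cE.
have -> : (c%:num)%:E * mrestr leb munit B = mscale c (mrestr leb munit) B by [].
pose G : set (set (measurableTypeR R)) := [set X | exists q : R, X = `]-oo, q[%classic].
apply: (@measure_unique _ _ (measurableTypeR R) G (fun i => `]-oo, i%:R[%classic)) => //.
- exact: RGenInftyO.measurableE.
- move=> _ _ [q ->] [q' ->]; exists (Num.min q q').
  by apply/seteqP; split => x /=; rewrite !in_itv/= lt_min => /andP.
- by move=> i; exists i%:R.
- apply/seteqP; split => // x _; exists (Num.bound `|x|) => //=.
  by rewrite in_itv/= (le_lt_trans (ler_norm x))// archi_boundP.
- move=> _ [q ->].
  have -> : k `]-oo, q[%classic = lam (unit_cone A `&` radius_pow @^-1` `]-oo, q[).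
    by rewrite kE /pushforward /mrestr setIC.
  transitivity (lam (unit_cone A) * leb (`]-oo, q[ `&` `[0%R, 1%R[)); last by rewrite -cE.
  have [q0|q0] := leP q 0%R.
    rewrite (_ : _ `&` _ = set0); last first.
      apply/seteqP; split => // x [_] /=; rewrite in_itv/= /radius_pow => h.
      have := lt_le_trans h q0.
      by rewrite ltNge exprn_ge0// enorm_ge0.
    rewrite measure0 (_ : _ `&` _ = set0) ?measure0 ?mule0//.
    apply/seteqP; split => // x []; rewrite /= !in_itv/= => h /andP[x0 _].
    by have := lt_le_trans h q0; rewrite ltNge x0.
  pose m := Num.min q 1%R; have m0 : (0 < m)%R by rewrite lt_min q0 ltr01.
  have -> : `]-oo, q[ `&` `[0%R, 1%R[ = `[0%R, m[%classic.
    apply/seteqP; split => x /=; rewrite !in_itv/= lt_min.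
      by move=> [-> /andP[-> ->]].
    by move=> /and3P[-> -> ->].
  have -> : unit_cone A `&` radius_pow @^-1` `]-oo, q[ =
      @edir R n.+1 @^-1` A `&` eball (nroot m).
    apply/seteqP; split => x; rewrite /unit_cone /eball/= in_itv/= /radius_pow.
      move=> [[Ax x1] xq]; split => //.
      rewrite -(@ltr_pXn2r _ n.+1)// ?nnegrE ?enorm_ge0 ?ltW ?nroot_gt0//.
      rewrite exp_nroot ?ltW// lt_min xq/=.
      by rewrite exprn_ilt1// enorm_ge0.
    move=> [Ax xm]; have : (enorm x ^+ n.+1 < m)%R.
      by rewrite -(exp_nroot (ltW m0)) ltr_pXn2r// nnegrE ?enorm_ge0// ltW// nroot_gt0.
    rewrite lt_min => /andP[-> xn]; split => //; split => //.
    by rewrite -(@ltr_pXn2r _ n.+1)// ?nnegrE ?enorm_ge0// expr1n.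
  rewrite unit_cone_dilate// muleC; congr (_ * _).
  by rewrite lebesgue_measure_itv/= lte_fin m0 sube0.
- move=> i; rewrite kE /pushforward /mrestr.
  apply: (@le_lt_trans _ _ (lam (unit_cone A))); last by rewrite ltey_eq finC.
  apply: le_measure; rewrite ?inE//.
  apply: measurableI => //; rewrite -[X in measurable X]setTI.
  by apply: measurable_radius_pow.
Qed.

Definition polar_coord (x : V) : V * measurableTypeR R := (edir x, radius_pow x).

Lemma measurable_polar_coord : measurable_fun [set: V] polar_coord.
Proof. by apply: measurable_fun_pair; [exact: measurable_edir|exact: measurable_radius_pow]. Qed.

Lemma measurable_ray : measurable_fun [set: V * measurableTypeR R]
  (fun z => nroot z.2 *: z.1)%R.
Proof.
apply: measurable_fun_rV => i.
rewrite (_ : (fun _ => _) = (fun z : V * measurableTypeR R => nroot z.2 * z.1 ord0 i)%R); last first.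
  by apply/funext => z; rewrite mxE.
apply: measurable_funM.
  by apply: (measurableT_comp (measurable_powR N^-1)); exact: measurable_snd.
by apply: (measurableT_comp (@measurable_rV_coord R n.+1 i)); exact: measurable_fst.
Qed.

(** Integration in polar coordinates, in the variable q = |x|^N, which is uniformly
    distributed along the rays. *)
Lemma integral_polar (H : V -> R) (M : R) : measurable_fun setT H ->
  (forall x, `|H x| <= M)%R ->
  N%:E * \int[lam]_(x in eball 1) (H x)%:E =
  \int[leb]_(q in `[0%R, 1%R[) \int[sig]_x (H (nroot q *: x))%:E.
Proof.
move=> mH HM.
pose meb := @measurable_eball R n.+1 1.
pose K (z : V * measurableTypeR R) : R := H (nroot z.2 *: z.1).
have mK : measurable_fun setT K by apply: (measurableT_comp mH); exact: measurable_ray.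
pose m2 := mfrestr munit unit_itv_fin.
have [p pE] : {p : {measure set (V * measurableTypeR R) -> \bar R} |
    p = pushforward (mrestr lam meb) polar_coord :> (set _ -> \bar R)}.
  unshelve eexists (pushforward (mrestr lam meb) polar_coord) => //.
  exact: measurable_polar_coord.
have pT : p setT < +oo.
  by rewrite pE /pushforward preimage_setT /mrestr setTI; exact: lebesgue_rV_eball.
have Kb : [bounded K x | x in setT].
  by exists M; split => [|L ML x _]; [exact: num_real|rewrite /= (le_trans (HM _))// ltW].
have ipK : p.-integrable setT (EFin \o K) by apply: measurable_bounded_integrable.
pose Nn : {nonneg R} := NngNum (ler0n R n.+1).
have agree X : measurable X -> (sig \x m2) X = mscale Nn p X.
  move=> mX; apply: product_measure_unique => // A B mA mB.
  transitivity (N%:E * p (A `*` B)); first by [].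
  have -> : p (A `*` B) = lam (unit_cone A `&` radius_pow @^-1` B).
    rewrite pE /pushforward /mrestr; congr (lam _).
    by apply/seteqP; split => x; rewrite /unit_cone /=; [move=> [[? ?] ?]|move=> [[? ?] ?]].
  by rewrite cone_radius_law// muleA.
have E1 : \int[sig \x m2]_z (K z)%:E = N%:E * \int[p]_z (K z)%:E.
  rewrite -(integral_mscale Nn ipK); apply: eq_measure_integral => X mX _.
  exact: agree.
have E2 : \int[p]_z (K z)%:E = \int[lam]_(x in eball 1) (H x)%:E.
  have iKp : (mrestr lam meb).-integrable setT (EFin \o (K \o polar_coord)).
    apply: (integrable_mrestr meb (M := M)).
    + exact: lebesgue_rV_eball.
    + by apply: (measurableT_comp mK); exact: measurable_polar_coord.
    + by move=> x; exact: HM.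
  have mKE : measurable_fun setT (EFin \o K) by exact/measurable_EFinP.
  have Ep := @integral_pushforward _ _ _ _ _ polar_coord measurable_polar_coord
    (mrestr lam meb) setT (EFin \o K) mKE iKp measurableT.
  rewrite pE; apply: (etrans Ep).
  rewrite preimage_setT; apply: (etrans (integral_mrestr iKp)).
  apply: eq_integral => x _ /=.
  by rewrite /K /polar_coord /= /radius_pow nroot_exp ?enorm_ge0// enorm_edir.
have i2 : (sig \x m2).-integrable setT (EFin \o K).
  apply: measurable_bounded_integrable => //.
  rewrite [ltLHS](agree _ measurableT).
  exact: (@lte_mul_pinfty _ N%:E (p setT) (ler0n R n.+1) isT pT).
rewrite -E2 -E1 -integral21_prod_meas1//.
have mKE : measurable_fun setT (EFin \o K) by exact/measurable_EFinP.
have mG : m2.-integrable setT (fubini_G sig (EFin \o K)).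
  apply/integrableP; split; first exact: (measurable_fubini_G i2).
  have mA : measurable_fun setT (fun z : V * measurableTypeR R => `|(K z)%:E|).
    exact: measurableT_comp.
  have /integrableP[_] := i2.
  rewrite (@fubini_tonelli2 _ _ _ _ _ sig m2 (fun z => `|(K z)%:E|) mA (fun z => abse_ge0 _)).
  apply: le_lt_trans; apply: ge0_le_integral => //.
  - by apply: measurableT_comp => //; exact: (measurable_fubini_G i2).
  - exact: (@measurable_fun_fubini_tonelli_G _ _ _ _ _ sig (fun z => `|(K z)%:E|) mA (fun z => abse_ge0 _)).
  - move=> q _; apply: le_abse_integral => //.
    by apply: (measurableT_comp mKE); exact: measurable_pair2.
exact: (integral_mrestr mG).
Qed.

End polar.

(** * The radial system near the origin *)

Section radial_ode.
Variable R : realType.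
Implicit Types (f g df dg : R -> R) (d e c r : R).

Lemma MVT_der f df (x y : R) : x < y ->
  (forall r, x <= r <= y -> is_derive r 1 f (df r)) ->
  exists2 c, x < c < y & f y - f x = df c * (y - x).
Proof.
move=> xy Df.
have [z|z|z] := @MVT R f df x y xy.
- by rewrite in_itv/= => /andP[xz zy]; apply: Df; rewrite !ltW.
- apply: derivable_within_continuous => t; rewrite in_itv/= => /Df.
  by move=> [].
by rewrite in_itv/= => zI E; exists z.
Qed.

Lemma increasing_of_derive f df d : (forall r, 0 < r < d -> is_derive r 1 f (df r)) ->
  (forall r, 0 < r < d -> 0 <= df r) ->
  forall x y, 0 < x -> x <= y -> y < d -> f x <= f y.
Proof.
move=> Df df0 x y x0; rewrite le_eqVlt => /predU1P[-> //|xy] yd.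
have inI z : x <= z <= y -> 0 < z < d.
  by move=> /andP[xz zy]; rewrite (lt_le_trans x0 xz) (le_lt_trans zy yd).
have [r rI|z /andP[xz zy] E] := @MVT_der f df x y xy; first by apply: Df; exact: inI.
rewrite -subr_ge0 E mulr_ge0//; last by rewrite subr_ge0 ltW.
by apply: df0; apply: inI; rewrite !ltW.
Qed.

Lemma pow_derive e r : 0 < r -> is_derive r 1 (fun s : R => s `^ e) (e * r `^ (e - 1)).
Proof. by move=> r0; exact: is_derive1_powR. Qed.

Lemma powD r (x y : R) : 0 < r -> r `^ (x + y) = r `^ x * r `^ y.
Proof. by move=> r0; rewrite powRD// (gt_eqF r0) implybT. Qed.

Lemma pow_le r (x y : R) : 0 < r < 1 -> x <= y -> r `^ y <= r `^ x.
Proof. by move=> /andP[r0 r1] xy; apply: ger_powR => //; rewrite r0 ltW. Qed.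

Lemma small_pow e K : 0 < e -> exists2 d, 0 < d & forall r, 0 < r < d -> K <= r `^ (- e).
Proof.
move=> e0; pose k := `|K| + 1; have k0 : 0 < k by rewrite ltr_wpDl.
exists (k `^ (- e^-1)); first exact: powR_gt0.
move=> r /andP[r0 rd]; apply: (@le_trans _ _ k).
  by rewrite /k ler_wpDr// ler_norm.
rewrite powRN -[k]invrK lef_pV2 ?posrE ?invr_gt0 ?powR_gt0//.
have <- : (k `^ (- e^-1)) `^ e = k^-1.
  by rewrite -powRrM mulNr mulVf ?gt_eqF// powR_inv1// ltW.
by apply: ge0_ler_powR; rewrite ?nnegrE ?ltW// powR_gt0.
Qed.

(** The difference of f and the primitive (c / e) r^(-e) of the comparison function is
    monotone; half of that primitive absorbs the constant of integration near 0. *)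
Lemma blowup_lower f df d c e : 0 < d -> 0 < c -> 0 < e ->
  (forall r, 0 < r < d -> is_derive r 1 f (df r)) ->
  (forall r, 0 < r < d -> df r <= - c * r `^ (- e - 1)) ->
  exists d' c', [/\ 0 < d', d' <= d, 0 < c' & forall r, 0 < r < d' -> c' * r `^ (- e) <= f r].
Proof.
move=> d0 c0 e0 Df dfc.
pose h r := c / e * r `^ (- e) - f r.
have Dh r : 0 < r < d -> is_derive r 1 h (c / e * (- e * r `^ (- e - 1)) - df r).
  move=> rd; have /andP[r0 _] := rd.
  apply: is_deriveB; last exact: Df.
  by apply: (@is_deriveZ _ _ _ (fun s => s `^ (- e))); exact: pow_derive.
have h0 r : 0 < r < d -> 0 <= c / e * (- e * r `^ (- e - 1)) - df r.
  move=> /dfc; rewrite subr_ge0 => /le_trans; apply.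
  by rewrite mulrA mulrN divfK ?gt_eqF.
have mono := increasing_of_derive Dh h0.
have [d1 d10 hd1] := small_pow (2 * (e / c) * h (d / 2)) e0.
exists (Num.min d1 (d / 2)), (c / e / 2); split.
- by rewrite lt_min d10 divr_gt0.
- by rewrite ge_min ler_pdivrMr// ler_pMr ?orbT// ler1n orbT.
- by rewrite !divr_gt0.
move=> r /andP[r0]; rewrite lt_min => /andP[rd1 rd2].
have := mono r (d / 2) r0 (ltW rd2); rewrite ltr_pdivrMr// ltr_pMr// ltr1n => /(_ isT) h1.
have := hd1 r; rewrite r0 rd1 => /(_ isT) h2.
have ce : 0 < c / e by rewrite divr_gt0.
have h3 : h (d / 2) <= c / e / 2 * r `^ (- e).
  rewrite -(ler_pM2l (_ : 0 < c / e / 2)) ?divr_gt0// in h2.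
  apply: le_trans h2; rewrite le_eqVlt; apply/orP; left; apply/eqP.
  by field; rewrite !gt_eqF.
move: h1; rewrite {1}/h.
have -> : c / e * r `^ (- e) = c / e / 2 * r `^ (- e) + c / e / 2 * r `^ (- e) by field; rewrite gt_eqF.
by move: (c / e / 2 * r `^ (- e)) h3 => z; lra.
Qed.

(** The same comparison, applied to f and to - f. *)
Lemma blowup_upper f df d M e : 0 < d -> 0 < e -> 0 <= M ->
  (forall r, 0 < r < d -> is_derive r 1 f (df r)) ->
  (forall r, 0 < r < d -> `|df r| <= M * r `^ (- e - 1)) ->
  exists d' C, [/\ 0 < d', d' <= d & forall r, 0 < r < d' -> `|f r| <= C * r `^ (- e)].
Proof.
move=> d0 e0 M0 Df dfM.
have key s : `|s| = 1 -> forall r, 0 < r < d ->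
   is_derive r 1 (fun r => s * f r - M / e * r `^ (- e)) (s * df r + M * r `^ (- e - 1)).
  move=> s1 r rd; have /andP[r0 _] := rd.
  have -> : s * df r + M * r `^ (- e - 1) = s * df r - M / e * (- e * r `^ (- e - 1)).
    by rewrite mulrA mulrN divfK ?gt_eqF// mulNr opprK.
  apply: is_deriveB; first by apply: (@is_deriveZ _ _ _ f); exact: Df.
  by apply: (@is_deriveZ _ _ _ (fun s => s `^ (- e))); exact: pow_derive.
have key2 s : `|s| = 1 -> forall r, 0 < r < d -> 0 <= s * df r + M * r `^ (- e - 1).
  move=> s1 r /dfM; rewrite -[X in X <= _ -> _]mul1r -s1 -normrM ler_norml => /andP[+ _].
  by rewrite -subr_ge0 opprK.
have [d1 d10 hd1] := small_pow 1 e0.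
pose C0 := `|f (d / 2)|.
exists (Num.min d1 (d / 2)), (M / e + C0); split.
- by rewrite lt_min d10 divr_gt0.
- by rewrite ge_min ler_pdivrMr// ler_pMr ?orbT// ler1n orbT.
move=> r /andP[r0]; rewrite lt_min => /andP[rd1 rd2].
have d2 : d / 2 < d by rewrite ltr_pdivrMr// ltr_pMr// ltr1n.
have h2 : 1 <= r `^ (- e) by apply: hd1; rewrite r0 rd1.
have bnd s : `|s| = 1 -> s * f r <= (M / e + C0) * r `^ (- e).
  move=> s1; have := increasing_of_derive (key s s1) (key2 s s1) r0 (ltW rd2) d2.
  have m0 : 0 <= M / e * (d / 2) `^ (- e) by rewrite !mulr_ge0 ?powR_ge0// invr_ge0 ltW.
  have sf : s * f (d / 2) <= C0 by rewrite /C0 -[leRHS]mul1r -s1 -normrM ler_norm.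
  have C00 : C0 <= C0 * r `^ (- e) by rewrite ler_peMr// normr_ge0.
  by rewrite mulrDl; move: (M / e * r `^ (- e)) (C0 * r `^ (- e)) m0 sf C00 => A B; lra.
by rewrite ler_norml; have := bnd 1 (normr1 _); have := bnd (-1); rewrite normrN normr1 => /(_ erefl); lra.
Qed.

Lemma mono_cvg f d : 0 < d -> (forall x y, 0 < x -> x <= y -> y < d -> f x <= f y) ->
  (exists C, forall r, 0 < r < d -> C <= f r) -> cvg (f r @[r --> 0^'+]).
Proof.
move=> d0 fm [C fC]; apply/cvg_ex.
exists (inf (f @` [set` Interval (BRight 0) (BLeft d)])).
apply: nondecreasing_at_right_cvgr.
- by rewrite bnd_simp.
- move=> x y; rewrite !in_itv/= => /andP[x0 xd] /andP[y0 yd] xy.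
  exact: fm.
- exists C => _ [r + <-]; rewrite /= in_itv/=; exact: fC.
Qed.

(** Adding C r^2 / 2 to f makes it monotone, subtracting f from it gives a bound. *)
Lemma cvg_of_derive_bound f df d C : 0 < d ->
  (forall r, 0 < r < d -> is_derive r 1 f (df r)) ->
  (forall r, 0 < r < d -> `|df r| <= C * r) -> cvg (f r @[r --> 0^'+]).
Proof.
move=> d0 Df dfC.
have key s r : is_derive r 1 (fun t => s * t ^+ 2 : R) (s * (r *+ 2)).
  have D : is_derive r 1 (fun t : R => t ^+ 2) (r *+ 2).
    by apply: is_derive_eq; rewrite /GRing.scale/= mulr1 ?expr1 ?mulr_natl.
  exact: (@is_deriveZ _ _ _ (fun t : R => t ^+ 2) s r 1 _ D).
have D1 r : 0 < r < d -> is_derive r 1 (fun t => f t + C / 2 * t ^+ 2) (df r + C / 2 * (r *+ 2)).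
  by move=> rd; apply: is_deriveD; exact: Df.
have D2 r : 0 < r < d -> is_derive r 1 (fun t => C / 2 * t ^+ 2 - f t) (C / 2 * (r *+ 2) - df r).
  by move=> rd; apply: is_deriveB; exact: Df.
have E r : C / 2 * (r *+ 2) = C * r by rewrite -mulr_natr; field.
have P1 r : 0 < r < d -> 0 <= df r + C / 2 * (r *+ 2).
  by move=> /dfC; rewrite ler_norml E => /andP[+ _]; lra.
have P2 r : 0 < r < d -> 0 <= C / 2 * (r *+ 2) - df r.
  by move=> /dfC; rewrite ler_norml E => /andP[_ +]; lra.
have M1 := increasing_of_derive D1 P1; have M2 := increasing_of_derive D2 P2.
have d20 : 0 < d / 2 by rewrite divr_gt0.
have d2 : d / 2 < d by rewrite ltr_pdivrMr// ltr_pMr// ltr1n.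
have C0 : 0 <= C.
  have := dfC (d / 2); rewrite d20 d2 => /(_ isT) /(le_trans (normr_ge0 _)).
  by rewrite pmulr_lge0.
have c1 : cvg ((fun t => f t + C / 2 * t ^+ 2) r @[r --> 0^'+]).
  apply: (@mono_cvg _ (d / 2)) => //.
    by move=> x y x0 xy yd; apply: M1 => //; exact: lt_trans d2.
  exists (f (d / 2) - C / 2 * (d / 2) ^+ 2) => r /andP[r0 rd].
  have := M2 r (d / 2) r0 (ltW rd) d2.
  have : 0 <= C / 2 * r ^+ 2 by rewrite mulr_ge0 ?sqr_ge0// divr_ge0.
  by move: (C / 2 * r ^+ 2) (C / 2 * (d / 2) ^+ 2) => A B; lra.
have c2 : C / 2 * r ^+ 2 @[r --> (0:R)^'+] --> C / 2 * 0 ^+ 2.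
  apply: cvg_at_right_filter; apply: cvgM; first exact: cvg_cst.
  exact: exprn_continuous.
have -> : f = (fun t => (f t + C / 2 * t ^+ 2) - C / 2 * t ^+ 2).
  by apply/funext => t; rewrite addrK.
by apply: is_cvgB => //; apply/cvg_ex; eexists; exact: c2.
Qed.

Lemma near0_itv (P : R -> Prop) : (\forall r \near 0^'+, P r) ->
  exists2 d, 0 < d & forall r, 0 < r < d -> P r.
Proof.
move=> [d /= d0 dP]; exists d => // r /andP[r0 rd]; apply: dP => //.
by rewrite /= sub0r normrN gtr0_norm.
Qed.

Section flux_limits.
Variables (p : nat) (D : R) (U P : nat -> R -> R).
Hypothesis pD : 2 * p%:R < D.
Hypothesis DU : forall i r, (i < p)%N -> 0 < r < 1 ->
  is_derive r 1 (U i) (- (r `^ (1 - D) * P i r)).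
Hypothesis DP : forall i r, (i < p)%N -> 0 < r < 1 ->
  is_derive r 1 (P i) (r `^ (D - 1) * U i.+1 r).

Let D2 i : (i < p)%N -> 2 * i%:R + 2 < D.
Proof.
move=> ip; apply: le_lt_trans pD.
by rewrite -[X in _ + X](mulr1 2) -mulrDr ler_pM2l// natr1 ler_nat.
Qed.

(** P_(i+1) is bounded, hence U_(i+1) = O(r^(2-D)) by integration, and so P_i' = O(r). *)
Lemma flux_cvg_step i : (i.+1 < p)%N -> cvg (P i.+1 r @[r --> 0^'+]) ->
  cvg (P i r @[r --> 0^'+]).
Proof.
move=> ip /cvg_ex[l Pl].
have e0 : 0 < D - 2 by have := D2 ip; have : 0 <= i.+1%:R :> R by []; lra.
have [d d0 dP] : exists2 d, 0 < d & forall r, 0 < r < d -> `|P i.+1 r| <= `|l| + 1.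
  apply: near0_itv; have /cvgrPdist_le /(_ _ ltr01) := Pl.
  by apply: filterS => r h; rewrite -lerBlDl (le_trans _ h)// distrC lerB_dist.
pose d1 := Num.min d 1; have d10 : 0 < d1 by rewrite lt_min d0/=.
have d1P r : 0 < r < d1 -> 0 < r < d /\ 0 < r < 1.
  by move=> /andP[-> ]; rewrite lt_min => /andP[-> ->].
have lb r : 0 < r < d1 -> `|- (r `^ (1 - D) * P i.+1 r)| <= (`|l| + 1) * r `^ (- (D - 2) - 1).
  move=> /d1P[rd /andP[r0 _]]; rewrite normrN normrM gtr0_norm ?powR_gt0//.
  rewrite mulrC (_ : - (D - 2) - 1 = 1 - D); last by ring.
  by rewrite ler_wpM2r ?powR_ge0// dP.
have [d2 [C [d20 d21 dU]]] := @blowup_upper (U i.+1) _ d1 (`|l| + 1) (D - 2) d10 e0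
  (addr_ge0 (normr_ge0 _) ler01) (fun r rd => DU ip (d1P r rd).2) lb.
apply: (@cvg_of_derive_bound _ (fun r => r `^ (D - 1) * U i.+1 r) d2 C d20).
  move=> r /andP[r0 rd]; apply: DP; first exact: ltnW.
  by apply: (d1P r _).2; rewrite r0 (lt_le_trans rd).
move=> r rd; have /andP[r0 _] := rd.
rewrite normrM gtr0_norm ?powR_gt0//.
apply: le_trans (ler_wpM2l (powR_ge0 _ _) (dU r rd)) _.
rewrite mulrCA -powD// (_ : D - 1 - (D - 2) = 1); last by ring.
by rewrite powRr1// ltW.
Qed.

Hypothesis Pbnd : exists C, forall r, 0 < r < 1 -> C <= P p.-1 r.
Hypothesis Up0 : forall r, 0 < r < 1 -> 0 <= U p r.

(** Descending induction from the last flux, which is nondecreasing and bounded below. *)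
Lemma flux_cvg i : (i < p)%N -> cvg (P i r @[r --> 0^'+]).
Proof.
move=> ip; have p0 : (0 < p)%N by case: (p) ip.
suff H k : (k < p)%N -> cvg (P (p.-1 - k)%N r @[r --> 0^'+]).
  have := H (p.-1 - i)%N; rewrite subKn; first apply.
    by rewrite (leq_ltn_trans (leq_subr _ _))// prednK.
  by rewrite -ltnS prednK.
elim: k => [_|k IH kp].
  rewrite subn0; apply: (@mono_cvg _ 1 ltr01) => //.
  apply: (@increasing_of_derive _ (fun r => r `^ (D - 1) * U p r)) => r r1.
    by have := @DP p.-1 r; rewrite prednK//; apply.
  by rewrite mulr_ge0 ?powR_ge0// Up0.
have E : (p.-1 - k = (p.-1 - k.+1).+1)%N by rewrite subnSK// -ltnS prednK.
apply: flux_cvg_step; rewrite -E; last exact: IH (ltnW kp).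
by rewrite (leq_ltn_trans (leq_subr _ _))// prednK.
Qed.

(** A nonzero flux limit at level j, of sign s, makes s U_j at least a multiple of
    r^(2-D). Each step down to a level with vanishing flux limit integrates twice and
    gains two powers of r, keeping the sign. *)
Lemma flux_blowup (s l : R) j q : (j < p)%N -> (q <= j)%N -> `|s| = 1 ->
  P j r @[r --> 0^'+] --> l -> 0 < s * l ->
  (forall i, (i < j)%N -> P i r @[r --> 0^'+] --> 0) ->
  exists d c, [/\ 0 < d, d <= 1, 0 < c & forall r, 0 < r < d ->
     c * r `^ (- (D - (2 * q%:R + 2))) <= s * U (j - q)%N r].
Proof.
move=> jp + s1 Pl sl P0; elim: q => [_|q IH qj].
  rewrite subn0 mulr0 add0r.
  have e0 : 0 < D - 2 by have := D2 jp; have : 0 <= j%:R :> R by []; lra.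
  have [d d0 dP] : exists2 d, 0 < d & forall r, 0 < r < d -> s * l / 2 <= s * P j r.
    apply: near0_itv; have : s * P j r @[r --> 0^'+] --> s * l by apply: cvgM => //; exact: cvg_cst.
    move=> /cvgrPdist_le /(_ (s * l / 2)); rewrite divr_gt0// => /(_ isT).
    by apply: filterS => r; rewrite ler_norml => /andP[_]; lra.
  pose d1 := Num.min d 1; have d10 : 0 < d1 by rewrite lt_min d0/=.
  have d1P r : 0 < r < d1 -> 0 < r < d /\ 0 < r < 1.
    by move=> /andP[-> ]; rewrite lt_min => /andP[-> ->].
  have [||d' [c' [d'0 d'1 c'0 dU]]] := @blowup_lower (fun r => s * U j r)
    (fun r => s * - (r `^ (1 - D) * P j r)) d1 (s * l / 2) (D - 2) d10 (divr_gt0 sl (ltr0n R 2)) e0.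
  - by move=> r /d1P[_ r1]; apply: (@is_deriveZ _ _ _ (U j)); exact: DU.
  - move=> r /d1P[rd r1]; rewrite mulrN mulNr lerN2 mulrCA mulrC.
    rewrite (_ : - (D - 2) - 1 = 1 - D); last by ring.
    by rewrite mulrC [leLHS]mulrC ler_wpM2l ?powR_ge0// dP.
  exists d', c'; split => //.
  by rewrite (le_trans d'1)// ge_min lexx orbT.
have {IH} [d [c [d0 d1 c0 dU]]] := IH (ltnW qj).
have jq : (j - q = (j - q.+1).+1)%N by rewrite subnSK.
set k := (j - q.+1)%N in jq *.
have kj : (k < j)%N by rewrite /k ltn_subrL (leq_ltn_trans _ qj).
have kp := ltn_trans kj jp.
rewrite jq in dU.
pose m : R := 2 * q%:R + 2.
have m0 : 0 < m by have : 0 <= q%:R :> R by []; rewrite /m; lra.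
have rd1 r : 0 < r < d -> 0 < r < 1 by move=> /andP[-> rd]; exact: lt_le_trans d1.
pose h r := s * P k r - c / m * r `^ m.
have hm : forall x y, 0 < x -> x <= y -> y < d -> h x <= h y.
  apply: (@increasing_of_derive h (fun r => s * (r `^ (D - 1) * U k.+1 r) - c / m * (m * r `^ (m - 1)))).
    move=> r rd; have /andP[r0 _] := rd; apply: is_deriveB.
      by apply: (@is_deriveZ _ _ _ (P k)); apply: DP => //; exact: rd1.
    by apply: (@is_deriveZ _ _ _ (fun s => s `^ m)); exact: pow_derive.
  move=> r rd; have /andP[r0 _] := rd; rewrite subr_ge0 mulrA divfK ?gt_eqF//.
  have := ler_wpM2l (powR_ge0 r (D - 1)) (dU r rd).
  rewrite mulrCA -powD// (_ : D - 1 - (D - (2 * q%:R + 2)) = m - 1); last by rewrite /m; ring.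
  by rewrite (mulrCA s).
have h0 : h r @[r --> 0^'+] --> (0 : R).
  rewrite -[X in _ --> X](subr0 (0 : R)) -[X in _ --> X - _](mulr0 s) -[X in _ --> _ - X](mulr0 (c / m)).
  apply: cvgB; apply: cvgM; try exact: cvg_cst; first exact: P0.
  exact: powR_cvg0.
have hpos r : 0 < r < d -> 0 <= h r.
  move=> /andP[r0 rd]; apply: (@closed_cvg _ _ _ _ _ (fun x => x <= h r) (@closed_le R (h r)) _ _ h0).
  near=> t; have tr : t < r by near: t; exact: nbhs_right_lt.
  by apply: hm rd; [near: t; exact: nbhs_right_gt|exact: ltW].
have e0 : 0 < D - (2 * q.+1%:R + 2).
  have : (q.+1 < p)%N by rewrite (leq_ltn_trans qj).
  by move=> /D2; lra.
have [||d' [c' [d'0 d'1 c'0 dU']]] := @blowup_lower (fun r => s * U k r)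
    (fun r => s * - (r `^ (1 - D) * P k r)) d (c / m) (D - (2 * q.+1%:R + 2)) d0 (divr_gt0 c0 m0) e0.
- by move=> r rd; apply: (@is_deriveZ _ _ _ (U k)); apply: DU => //; exact: rd1.
- move=> r rd; have /andP[r0 _] := rd; have := hpos r rd; rewrite subr_ge0 => hr.
  rewrite mulrN mulNr lerN2 mulrCA.
  have := ler_wpM2l (powR_ge0 r (1 - D)) hr.
  rewrite (mulrCA _ (c / m)) -powD// (_ : 1 - D + m = - (D - (2 * q.+1%:R + 2)) - 1)//.
  by rewrite /m -natr1; ring.
by exists d', c'; split => //; exact: le_trans d1.
Unshelve. all: by end_near. Qed.

Variables (alpha tau W : R).
Hypothesis alpha1 : 1 < alpha.
Hypothesis tauE : tau = (D + 2 * p%:R) - alpha * (D - 2 * p%:R).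
Hypothesis W0 : 0 <= W.
Hypothesis U0 : forall r, 0 < r < 1 -> 0 <= U 0%N r.
(** K is the point of comparison in X^alpha >= K^(alpha-1) (X - K), integrated over a
    sphere against a weight of total mass W. *)
Hypothesis Uge : forall r K, 0 < r < 1 -> 0 < K ->
  r `^ (- tau) * (K `^ (alpha - 1) * (U 0%N r - K * W)) <= U p r.

(** At the first level j with a nonzero limit, U_0 is at least a multiple of
    r^(2j+2-D) up to sign, and U_0 >= 0 fixes the sign. The superlinear lower bound on
    U_p, with K a small multiple of the same power, and the value of tau then give
    r^(D-1) U_p >= c / r. So the last flux is at most c ln r up to a constant, against
    its lower bound. *)
Lemma flux_cvg0 i : (i < p)%N -> P i r @[r --> 0^'+] --> 0.
Proof.
elim/ltn_ind: i => j IH jp.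
have /cvg_ex[l Pl] := flux_cvg jp.
suff l0 : l = 0 by rewrite -[X in _ --> X]l0.
apply/eqP; apply: contraT => ln0.
pose s := Num.sg l; have s1 : `|s| = 1 by rewrite /s normr_sg ln0.
have sl : 0 < s * l by rewrite /s -normrEsg normr_gt0.
have P0 i : (i < j)%N -> P i r @[r --> 0^'+] --> 0 by move=> ij; apply: IH => //; exact: ltn_trans jp.
have [d [c [d0 d1 c0 dU]]] := flux_blowup jp (leqnn j) s1 Pl sl P0.
rewrite subnn in dU.
have rd1 r : 0 < r < d -> 0 < r < 1 by move=> /andP[-> rd]; exact: lt_le_trans d1.
set m := D - (2 * j%:R + 2) in dU.
have {s1 sl} sE : s = 1.
  have d2 : 0 < d / 2 < d by rewrite divr_gt0//= ltr_pdivrMr// ltr_pMr// ltr1n.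
  have := lt_le_trans (mulr_gt0 c0 (powR_gt0 (- m) (andP d2).1)) (dU _ d2).
  rewrite /s; case: (sgrP l) => //; first by rewrite mul0r ltxx.
  by move=> _; rewrite mulN1r oppr_gt0 ltNge (U0 (rd1 _ d2)).
rewrite sE in dU.
(* with this factor, K W absorbs at most half of the lower bound of U 0 *)
pose k := c / (2 * (W + 1)).
have W1 : 0 < W + 1 by rewrite ltr_wpDl.
have k0 : 0 < k by rewrite divr_gt0// mulr_gt0.
pose c1 := k `^ (alpha - 1) * (c / 2).
have c10 : 0 < c1 by rewrite mulr_gt0 ?powR_gt0// divr_gt0.
have Ulow r : 0 < r < d -> c1 * r^-1 <= r `^ (D - 1) * U p r.
  move=> rd; have /andP[r0 _] := rd; have r1 := rd1 r rd.
  have K0 : 0 < k * r `^ (- m) by rewrite mulr_gt0// powR_gt0.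
  have := Uge r1 K0 => /(ler_wpM2l (powR_ge0 r (D - 1))); apply: le_trans.
  have h1 : c / 2 * r `^ (- m) <= U 0%N r - k * r `^ (- m) * W.
    have := dU r rd; rewrite mul1r => h.
    have : k * W <= c / 2.
      rewrite /k mulrAC ler_pdivrMr ?mulr_gt0//.
      have -> : c / 2 * (2 * (W + 1)) = c * W + c by field.
      by rewrite lerDl ltW.
    move=> /(ler_wpM2r (powR_ge0 r (- m))); rewrite mulrAC.
    have E : c * r `^ (- m) = c / 2 * r `^ (- m) + c / 2 * r `^ (- m) by field.
    by rewrite E in h; move: (c / 2 * r `^ (- m)) (k * r `^ (- m) * W) h => A B; lra.
  rewrite (powRM _ (ltW k0) (powR_ge0 _ _)) -powRrM.
  have h2 : k `^ (alpha - 1) * r `^ (- m * (alpha - 1)) * (c / 2 * r `^ (- m)) <=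
    k `^ (alpha - 1) * r `^ (- m * (alpha - 1)) * (U 0%N r - k * r `^ (- m) * W).
    by rewrite ler_wpM2l// mulr_ge0// powR_ge0.
  rewrite [leRHS]mulrA -powD//.
  apply: le_trans (ler_wpM2l (powR_ge0 _ _) h2).
  rewrite (_ : r `^ (D - 1 - tau) * _ = c1 * (r `^ (D - 1 - tau) * (r `^ (- m * (alpha - 1)) * r `^ (- m)))); last first.
    by rewrite /c1; ring.
  rewrite ler_pM2l// -!powD// -(powR_inv1 (ltW r0)); apply: pow_le => //.
  rewrite tauE /m; have : 0 <= alpha * (2 * (p%:R - j%:R - 1)).
    apply: mulr_ge0; first exact: ltW (lt_trans ltr01 alpha1).
    apply: mulr_ge0 => //.
    by rewrite -addrA -opprD natr1 subr_ge0 ler_nat.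
  have : 0 <= p%:R :> R by [].
  by lra.
have [C CP] := Pbnd; have p0 : (0 < p)%N by case: (p) jp.
pose h r := P p.-1 r - c1 * ln r.
have hm : forall x y, 0 < x -> x <= y -> y < d -> h x <= h y.
  apply: (@increasing_of_derive h (fun r => r `^ (D - 1) * U p r - c1 * r^-1)).
    move=> r rd; have /andP[r0 _] := rd; apply: is_deriveB.
      by have := @DP p.-1 r; rewrite prednK//; apply => //; exact: rd1.
    by apply: (@is_deriveZ _ _ _ (@ln R)); exact: is_derive1_ln.
  by move=> r /Ulow; rewrite subr_ge0.
have d20 : 0 < d / 2 by rewrite divr_gt0.
have d2 : d / 2 < d by rewrite ltr_pdivrMr// ltr_pMr// ltr1n.
(* at r0 the comparison with c1 ln r pushes P p.-1 below its lower bound C *)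
pose r0 := Num.min (d / 2) (expR ((C - 1 - h (d / 2)) / c1)).
have r00 : 0 < r0 by rewrite lt_min d20 expR_gt0.
have r0d : r0 <= d / 2 by rewrite ge_min lexx.
have := hm r0 (d / 2) r00 r0d d2; rewrite {1}/h => h1.
have h2 : ln r0 <= (C - 1 - h (d / 2)) / c1.
  rewrite -[leRHS]expRK ler_ln ?posrE ?expR_gt0//.
  by rewrite ge_min lexx orbT.
have := CP r0; rewrite r00 (lt_le_trans (le_lt_trans r0d d2) d1) => /(_ isT) h3.
have : c1 * ln r0 <= C - 1 - h (d / 2) by rewrite mulrC -ler_pdivlMr.
move: h1 h3; move: (h (d / 2)) (c1 * ln r0) (P p.-1 r0) => A B E; lra.
Qed.

End flux_limits.

End radial_ode.

(** * Weighted integrals over spheres *)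

Section sphere_average.
Variables (R : realType) (n : nat) (b : R).
Hypothesis b0 : 0 < b.
Local Notation V := 'rV[R]_n.+1.
Local Notation lam := (@lebesgue_rV R n.+1).
Local Notation leb := (@lebesgue_measure R).
Local Notation sig := (@sphere_measure R n.+1).
Local Notation S := (esphere 1 : set V).
Local Notation BF x := (within (eball 1) (nbhs (x : V))).
Implicit Types (f g : V -> R) (x y : V).

Lemma measurable_esphere (s : R) : measurable (esphere s : set V).
Proof.
rewrite (_ : esphere s = [set: V] `&` (@enorm R n.+1) @^-1` [set s]).
  by apply: measurable_enorm => //; exact: measurable_set1.
by apply/seteqP; split => x /=; [|case].
Qed.

Lemma open_punct : open (eball 1 `\ 0 : set V).
Proof.
rewrite (_ : _ `\ _ = eball 1 `&` [set x : V | 0 < enorm x]).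
  by apply: openI; [exact: open_eball|exact: open_enorm_gt].
by apply/seteqP; split => x [x1 /=]; rewrite enorm_gt0 => /eqP.
Qed.

Definition weight x : R := `|xlast x| `^ b.

Lemma weight_ge0 x : 0 <= weight x.
Proof. exact: powR_ge0. Qed.

Lemma measurable_weight : measurable_fun [set: V] weight.
Proof.
apply: (measurableT_comp (measurable_powR b)).
by apply: measurableT_comp => //; exact: measurable_rV_coord.
Qed.

Lemma weight_le1 x : enorm x <= 1 -> weight x <= 1.
Proof.
move=> x1; rewrite /weight.
have h : 1 `^ b = 1 :> R by rewrite powR1.
rewrite -[leRHS]h.
apply: ge0_ler_powR; rewrite ?nnegrE ?(ltW b0)//.
exact: le_trans (coord_le_enorm _ _) x1.
Qed.

Lemma weightZ (r : R) x : 0 <= r -> weight (r *: x) = r `^ b * weight x.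
Proof. by move=> r0; rewrite /weight /xlast mxE normrM ger0_norm// powRM. Qed.

Lemma continuous_powR_norm : continuous (fun t : R => `|t| `^ b).
Proof.
move=> t; case: (eqVneq t 0) => [->|t0].
  rewrite /continuous_at normr0 powR0 ?gt_eqF//.
  apply/cvgrPdist_lt => e e0.
  have nd : \forall s \near (0 : R), `|s| < e `^ b^-1 by apply: nbhs0_lt; exact: powR_gt0.
  near=> s; rewrite sub0r normrN ger0_norm ?powR_ge0//.
  have : `|s| < e `^ b^-1 by near: s; exact: nd.
  move=> /(gt0_ltr_powR b0); rewrite !nnegrE normr_ge0 powR_ge0 => /(_ isT isT).
  by rewrite -powRrM mulVf ?gt_eqF// powRr1// ltW.
apply: (@continuous_comp _ _ _ (fun t : R => `|t|) (fun t => t `^ b)); first exact: norm_continuous.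
apply: differentiable_continuous; apply/derivable1_diffP.
by have [] := @is_derive1_powR R b `|t| _; rewrite ?normr_gt0.
Unshelve. all: by end_near. Qed.

Lemma continuous_weight : continuous weight.
Proof.
move=> x; apply: (@continuous_comp _ _ _ (@xlast R n) (fun t => `|t| `^ b)).
  exact: continuous_coord.
exact: continuous_powR_norm.
Qed.

Lemma ray_punct (r : R) x : 0 < r < 1 -> S x -> (eball 1 `\ 0) (r *: x).
Proof.
move=> /andP[r0 r1]; rewrite /esphere/= => x1; split.
  by rewrite /eball/= enormZ x1 mulr1 gtr0_norm.
by move=> /= /eqP; rewrite -enorm_eq0 enormZ x1 mulr1 normr_eq0 gt_eqF.
Qed.

Lemma sphere_ecball x : S x -> (ecball 1 `\ 0) x.
Proof.
rewrite /esphere/= => x1; split; first by rewrite /ecball/= x1.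
by move=> /= /eqP; rewrite -enorm_eq0 x1 oner_eq0.
Qed.

Lemma enorm_ray (r : R) x : 0 < r -> S x -> enorm (r *: x) = r.
Proof. by rewrite /esphere/= => r0 x1; rewrite enormZ x1 mulr1 gtr0_norm. Qed.

Lemma CK_measurable k f : CK setT k f -> measurable_fun (eball 1 `\ 0) f.
Proof.
move=> hf; apply: continuous_on_measurable_rV; first exact: open_punct.
by move=> x xB; exact: CK_continuous hf _ xB.
Qed.

Lemma measurable_ray_fun k f (r : R) : CK setT k f -> 0 < r < 1 ->
  measurable_fun S (fun x => f (r *: x)).
Proof.
move=> hf r01.
have mp : measurable (eball 1 `\ 0 : set V) by apply: open_measurable_rV; exact: open_punct.
have mz := (measurable_restrictT f mp).1 (CK_measurable hf).
have m1 : measurable_fun S ((f \_ (eball 1 `\ 0)) \o ( *:%R r)).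
  by apply: measurable_funTS; apply: (measurableT_comp mz); exact: measurable_scale_rV.
apply: eq_measurable_fun m1 => x; rewrite inE => Sx /=.
by rewrite patchE mem_set//; exact: ray_punct.
Qed.

Lemma sphere_lty : (sig S < +oo)%E.
Proof.
by rewrite -ge0_fin_numE//; apply: fin_num_measure; exact: measurable_esphere.
Qed.

Lemma integrable_sphere (h : V -> R) (M : R) : measurable_fun S h ->
  (forall x, S x -> `|h x| <= M) -> sig.-integrable S (EFin \o h).
Proof.
move=> mh hM; apply: measurable_bounded_integrable => //.
- exact: measurable_esphere.
- exact: sphere_lty.
- by exists M; split => [|K MK x Sx]; [exact: num_real|rewrite /= (le_trans (hM x Sx))// ltW].
Qed.

(** Over the sphere of radius r, but without the Jacobian r^n and the factor r^b of the
    weight; both reappear in integral_shell. *)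
Definition avg f (r : R) : R := \int[sig]_(x in S) (weight x * f (r *: x)).

Lemma measurable_avg k f (r : R) : CK setT k f -> 0 < r < 1 ->
  measurable_fun S (fun x => weight x * f (r *: x)).
Proof.
move=> hf r01; apply: measurable_funM; last exact: measurable_ray_fun hf r01.
by apply: measurable_funTS; exact: measurable_weight.
Qed.

Lemma avg_bound k f (s : R) : CK setT k f -> 0 < s ->
  exists2 M, 0 <= M & forall r x, s <= r < 1 -> S x -> `|weight x * f (r *: x)| <= M.
Proof.
move=> hf s0; have [M M0 fM] := bounded_annulus hf s0; exists M => // r x /andP[sr r1] Sx.
have r0 : 0 < r by exact: lt_le_trans sr.
rewrite normrM ger0_norm ?weight_ge0// -[M]mul1r ler_pM ?weight_ge0//.
  by apply: weight_le1; rewrite Sx.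
by apply: fM; rewrite enorm_ray.
Qed.

Lemma integrable_avg k f (r : R) : CK setT k f -> 0 < r < 1 ->
  sig.-integrable S (EFin \o (fun x => weight x * f (r *: x))).
Proof.
move=> hf r01; have /andP[r0 r1] := r01; have [M _ fM] := avg_bound hf r0.
apply: (@integrable_sphere _ M); first exact: measurable_avg hf r01.
by move=> x Sx; apply: fM => //; rewrite lexx.
Qed.

Lemma integrable_cst_sphere (M : R) : sig.-integrable S (EFin \o cst M).
Proof. by apply: (@integrable_sphere _ `|M|) => // x _. Qed.

Lemma half_itv_in (r : R) : 0 < r < 1 -> r \in `]r / 2, (1 + r) / 2[.
Proof. by rewrite in_itv/= => /andP[r0 r1]; apply/andP; split; lra. Qed.

Lemma half_itv_sub (r s : R) : 0 < r < 1 -> s \in `]r / 2, (1 + r) / 2[ -> 0 < s < 1 /\ r / 2 <= s < 1.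
Proof.
rewrite in_itv/= => /andP[r0 r1] /andP[s1 s2].
by split; apply/andP; split; lra.
Qed.

Lemma avg_continuous k f (r : R) : CK setT k f -> 0 < r < 1 -> {for r, continuous (avg f)}.
Proof.
move=> hf r01; have r20 : 0 < r / 2 by case/andP: r01 => r0 _; rewrite divr_gt0.
have [M M0 fM] := avg_bound hf r20.
have := @continuity_under_integral R _ _ sig (fun r x => weight x * f (r *: x)) S
  (measurable_esphere 1) (r / 2) ((1 + r) / 2) _ _ (cst M) (integrable_cst_sphere M) _.
apply.
- by move=> s /(half_itv_sub r01)[s01 _]; exact: integrable_avg hf s01.
- apply: aeW => x Sx s; rewrite inE/= => /(half_itv_sub r01)[s01 _].
  apply: cvgM; first exact: cvg_cst.
  apply: (@continuous_comp _ _ _ (fun s : R => s *: (x : V)) f).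
    by apply: cvgZr_tmp; exact: cvg_id.
  by apply: CK_continuous hf _ _ => //; exact: ray_punct.
- by move=> s /(half_itv_sub r01)[_ s2]; apply: aeW => x Sx; exact: fM.
- by rewrite inE; exact: half_itv_in.
Qed.

(** The radial derivative: the Euler field divided by |x|. *)
Definition radial f x : R := \sum_j edir x ord0 j * pderiv j f x.

Lemma edir_ray (r : R) x : 0 < r -> S x -> edir (r *: x) = x.
Proof. by move=> r0 Sx; rewrite edirZ// /edir Sx invr1 scale1r. Qed.

Lemma CK_edirM k (h : V -> R) j : CK setT k h -> CK setT 0 (fun x => edir x ord0 j * h x).
Proof.
move=> hh; split => // x _ xB.
have x0 : 0 < enorm x by rewrite enorm_gt0; apply/eqP; case: xB.
apply/cvg_ex; exists (edir x ord0 j * ext h x).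
apply: cvgM; last exact: (ext_cvg hh I xB).
apply: cvg_within_filter.
have -> : (fun y : V => edir y ord0 j) = (fun y => (enorm y)^-1 * y ord0 j).
  by apply/funext => y; rewrite mxE.
rewrite [edir x ord0 j]mxE; apply: cvgM; last exact: continuous_coord.
by apply: cvgV; [rewrite gt_eqF|exact: enorm_continuous].
Qed.

Lemma CK_radial k f : CK setT k.+1 f -> CK setT 0 (radial f).
Proof.
move=> hf; apply: CK_sum => [|j]; first exact: openT.
exact: CK_edirM (CK_pderiv hf j).
Qed.

Lemma is_derive_radial k f (r : R) x : CK setT k.+1 f -> 0 < r < 1 -> S x ->
  is_derive r 1 (fun r => f (r *: x)) (radial f (r *: x)).
Proof.
move=> hf r01 Sx; have r0 : 0 < r by case/andP: r01.
have -> : radial f (r *: x) = \sum_j x ord0 j * pderiv j f (r *: x).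
  by apply: eq_bigr => j _; rewrite edir_ray.
by apply: is_derive_ray hf _; exact: ray_punct.
Qed.

Lemma is_derive_avg k f (r : R) : CK setT k.+1 f -> 0 < r < 1 ->
  is_derive r 1 (avg f) (avg (radial f) r).
Proof.
move=> hf r01; have r20 : 0 < r / 2 by case/andP: r01 => r0 _; rewrite divr_gt0.
have hr := CK_radial hf.
have [M M0 fM] := avg_bound hr r20.
pose F r x := weight x * f (r *: x).
have dF s x : s \in `]r / 2, (1 + r) / 2[ -> S x ->
    is_derive s 1 (F ^~ x) (weight x * radial f (s *: x)).
  move=> /(half_itv_sub r01)[s01 _] Sx.
  rewrite (_ : F ^~ x = weight x *: (fun s => f (s *: x)))//.
  by apply: is_deriveZ; exact: is_derive_radial hf s01 Sx.
have dE s x : s \in `]r / 2, (1 + r) / 2[ -> S x ->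
    partial1of2 F s x = weight x * radial f (s *: x).
  by move=> sI Sx; rewrite partial1of2E; have /@derive_val := dF s x sI Sx.
have := @cvg_differentiation_under_integral R _ _ sig F S (measurable_esphere 1)
  r (r / 2) ((1 + r) / 2) (half_itv_in r01) _ _ (cst M) (fun=> M0) (integrable_cst_sphere M) _.
move=> H; have {}H : h^-1 *: (avg f (h + r) - avg f r) @[h --> 0^'] -->
    \int[sig]_(x in S) partial1of2 F r x.
  apply: H.
  - by move=> s /(half_itv_sub r01)[s01 _]; exact: integrable_avg hf s01.
  - by move=> s x sI Sx; have [] := dF s x sI Sx.
  - by move=> s x sI Sx; rewrite dE//; apply: fM => //; exact: (half_itv_sub r01 sI).2.
have E : \int[sig]_(x in S) partial1of2 F r x = avg (radial f) r.
  by apply: eq_Rintegral => x; rewrite inE => Sx; rewrite dE//; exact: half_itv_in.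
rewrite E in H.
have H' : h^-1 *: ((avg f \o shift r) (h *: (1:R)) - avg f r) @[h --> (0 : R)^'] --> avg (radial f) r.
  by under eq_fun do rewrite scaler1.
split; first by apply/cvg_ex; eexists; exact: H'.
exact: cvg_lim H'.
Qed.

Lemma ext_ray k g x : CK setT k g -> S x -> g (r *: x) @[r --> 1^'-] --> ext g x.
Proof.
move=> hg Sx; have xB := sphere_ecball Sx.
have c : r *: x @[r --> (1 : R)] --> x.
  by rewrite -[X in _ --> X]scale1r; apply: cvgZr_tmp; exact: cvg_id.
apply: (cvg_comp (fun r : R => r *: x) g _ (ext_cvg hg I xB)).
move=> A nA; have n2 := cvg_at_left_filter c nA.
have n1 : \forall r \near (1 : R)^'-, r < 1 by exact: nbhs_left_lt.
have n0 : \forall r \near (1 : R)^'-, 0 < r by exact: nbhs_left_gt.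
have {}n2 : \forall r \near (1 : R)^'-, eball 1 (r *: x) -> A (r *: x) by exact: n2.
suff : \forall r \near (1 : R)^'-, A (r *: x) by [].
near=> r.
have r1 : r < 1 by near: r.
have r0 : 0 < r by near: r.
have : eball 1 (r *: x) -> A (r *: x) by near: r; exact: n2.
by apply; rewrite /eball/= enorm_ray.
Unshelve. all: by end_near. Qed.

(** A pointwise limit of the same functions on slightly smaller spheres. *)
Lemma measurable_ext k g : CK setT k g -> measurable_fun S (fun x => weight x * ext g x).
Proof.
move=> hg; pose u (m : nat) : R := 1 - m.+2%:R^-1.
have u01 m : 0 < u m < 1.
  rewrite /u subr_gt0 invf_lt1// ltr1n/= ltrBlDr ltrDl invr_gt0.
  by rewrite ltr0n.
have u1 : u m @[m --> \oo] --> (1 : R).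
  rewrite -[X in _ --> X](subr0 (1 : R)); apply: cvgB; first exact: cvg_cst.
  by have := @cvg_harmonic R; rewrite -(cvg_shiftS (@harmonic R)).
apply: (@measurable_fun_cvg _ _ _ _ (fun m x => weight x * g (u m *: x))).
  by move=> m; exact: measurable_avg hg (u01 m).
move=> x Sx; apply: cvgM; first exact: cvg_cst.
have /cvg_at_leftP := ext_ray hg Sx; apply; split => // m.
by have /andP[] := u01 m.
Qed.

(** The value at r = 1 that avg g takes by continuity (avg_left_limit). *)
Definition sphere_mean g : R := \int[sig]_(x in S) (weight x * ext g x).

Lemma ext_bound k g : CK setT k g -> exists M, forall x, S x -> `|weight x * ext g x| <= M.
Proof.
move=> hg; have [M M0 gM] := avg_bound hg (divr_gt0 ltr01 (ltr0n R 2)).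
exists M => x Sx.
have c : `|weight x * g (r *: x)| @[r --> 1^'-] --> `|weight x * ext g x|.
  by apply: cvg_norm; apply: cvgM; [exact: cvg_cst|exact: ext_ray hg Sx].
have nM : \forall r \near (1 : R)^'-, `|weight x * g (r *: x)| <= M; last first.
  exact: (cvgr_to_le c nM).
near=> r; apply: gM => //; apply/andP; split.
  by apply/ltW; near: r; apply: nbhs_left_gt; lra.
by near: r; exact: nbhs_left_lt.
Unshelve. all: by end_near. Qed.

Lemma integrable_ext k g : CK setT k g ->
  sig.-integrable S (EFin \o (fun x => weight x * ext g x)).
Proof.
move=> hg; have [M gM] := ext_bound hg.
by apply: (integrable_sphere (measurable_ext hg) gM).
Qed.

Lemma avg_left_limit k g : CK setT k g -> avg g r @[r --> 1^'-] --> sphere_mean g.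
Proof.
move=> hg.
(* frozen at the boundary values beyond r = 1, the integrand is continuous in r *)
pose F (r : R) x := weight x * (if r < 1 then g (r *: x) else ext g x).
have h20 : 0 < 1 / 2 :> R by rewrite divr_gt0.
have [M M0 gM] := avg_bound hg h20; have [M' gM'] := ext_bound hg.
have cF : {in (`]1 / 2, 2[%classic : set R), continuous (fun r => \int[sig]_(x in S) F r x)}.
  apply: (@continuity_under_integral R _ _ sig F S (measurable_esphere 1) (1 / 2) 2 _ _
     (cst (Num.max M M')) (integrable_cst_sphere _) _).
  - move=> r; rewrite /= in_itv/= => /andP[r1 r2]; rewrite /F; case: (ltP r 1) => r3.
      by apply: integrable_avg hg _; rewrite r3 andbT; lra.
    exact: integrable_ext hg.
  - apply: aeW => x Sx r; rewrite inE/= in_itv/= => /andP[r1 r2].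
    apply: cvgM; first exact: cvg_cst.
    have [r3|r3|r3] := ltgtP r 1.
    + have cr : {for r, continuous (fun r : R => g (r *: x))}.
        apply: (@continuous_comp _ _ _ (fun s : R => s *: (x : V)) g).
          by apply: cvgZr_tmp; exact: cvg_id.
        apply: CK_continuous hg _ _ => //; apply: ray_punct => //.
        by rewrite r3 andbT; lra.
      apply: cvg_trans cr; apply: near_eq_cvg; near=> s; have -> // : s < 1.
      by near: s; exact: lt_nbhsl.
    + apply: cvg_near_cst; near=> s; rewrite ltNge ltW//=.
      by near: s; exact: lt_nbhsr.
    + rewrite r3; have := (@left_right_continuousP R R
        (fun s : R => if s < 1 then g (s *: x) else ext g x) 1).1.
      rewrite /= ltxx; apply; split.
        apply: cvg_trans (ext_ray hg Sx); apply: near_eq_cvg; near=> s.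
        by have -> // : s < 1; near: s; exact: nbhs_left_lt.
      apply: cvg_near_cst; near=> s.
      have s1 : 1 < s by near: s; exact: nbhs_right_gt.
      by rewrite ltNge ltW.
  - move=> r; rewrite /= in_itv/= => /andP[r1 r2]; apply: aeW => x Sx.
    rewrite le_max /F; case: (ltP r 1) => r3; last by rewrite gM' ?orbT.
    by rewrite gM// r3 andbT ltW.
have i1 : (1 : R) \in (`]1 / 2, 2[%classic : set R) by rewrite inE/= in_itv/=; apply/andP; split; lra.
have := cvg_at_left_filter (cF 1 i1).
have -> : \int[sig]_(x in S) F 1 x = sphere_mean g.
  by apply: eq_Rintegral => x _; rewrite /F ltxx.
apply: cvg_trans; apply: near_eq_cvg; near=> r.
apply: eq_Rintegral => x _; rewrite /F.
by have -> // : r < 1; near: r; exact: nbhs_left_lt.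
Unshelve. all: by end_near. Qed.

End sphere_average.

(** * Radial derivatives at the unit sphere *)

Section boundary_derivative.
Variable R : realType.

(** The increments over [1 + h, s] with s < 1 are values of dy by the mean value theorem;
    then s tends to 1. *)
Lemma left_derivative (y dy : R -> R) (y1 l : R) :
  (forall r : R, 0 < r < 1 -> is_derive r 1 y (dy r)) ->
  y r @[r --> 1^'-] --> y1 -> dy r @[r --> 1^'-] --> l ->
  (y (1 + h) - y1) / h @[h --> 0^'-] --> l.
Proof.
move=> Dy cy cdy.
have mvt (r s : R) : 0 < r -> r < s -> s < 1 ->
    exists2 c, r < c < s & y s - y r = dy c * (s - r).
  move=> r0 rs s1; apply: MVT_der rs _ => z /andP[rz zs]; apply: Dy.
  by rewrite (lt_le_trans r0 rz) (le_lt_trans zs s1).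
apply/cvgrPdist_le => e e0.
have /cvgrPdist_le/(_ e e0) nl := cdy.
have [d d0 dl] : exists2 d, 0 < d & forall c, 0 < c -> 1 - d < c < 1 -> `|l - dy c| <= e.
  move: nl => [d /= d0 dl]; exists d => // c c0 /andP[dc c1]; apply: dl => //=.
  by rewrite ger0_norm ?subr_ge0 ?ltW// ltrBlDl -ltrBlDr.
have key (h : R) : h < 0 -> - d < h -> - 1 < h -> `|y1 - y (1 + h) + l * h| <= e * - h.
  move=> h0 dh h1.
  have c : `|(y s - y (1 + h)) - l * (s - (1 + h))| - e * (s - (1 + h)) @[s --> 1^'-]
      --> `|(y1 - y (1 + h)) - l * (1 - (1 + h))| - e * (1 - (1 + h)).
    have cs : s - (1 + h) @[s --> (1 : R)^'-] --> 1 - (1 + h).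
      by apply: cvgB; [apply: cvg_at_left_filter; exact: cvg_id|exact: cvg_cst].
    apply: cvgB; last by apply: cvgM; [exact: cvg_cst|exact: cs].
    apply: cvg_norm; apply: cvgB; last by apply: cvgM; [exact: cvg_cst|exact: cs].
    by apply: cvgB => //; exact: cvg_cst.
  have -> : y1 - y (1 + h) + l * h = y1 - y (1 + h) - l * (1 - (1 + h)) by ring.
  have -> : e * - h = e * (1 - (1 + h)) by ring.
  rewrite -subr_le0; apply: (cvgr_to_le c); near=> s.
  have s1 : s < 1 by near: s; exact: nbhs_left_lt.
  have hs : 1 + h < s by near: s; apply: nbhs_left_gt; lra.
  have h10 : 0 < 1 + h by lra.
  have [z /andP[hz zs] ->] := mvt _ _ h10 hs s1.
  rewrite -mulrBl normrM (ger0_norm (_ : 0 <= s - (1 + h))); last by lra.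
  rewrite -mulrBl mulr_le0_ge0//; last by lra.
  by rewrite subr_le0 distrC dl//; [lra|apply/andP; split; lra].
near=> h.
have h0 : h < 0 by near: h; exact: nbhs_left_lt.
have dh : - d < h by near: h; apply: nbhs_left_gt; lra.
have h1 : - 1 < h by near: h; apply: nbhs_left_gt; lra.
have := key h h0 dh h1.
have -> : l - (y (1 + h) - y1) / h = (y1 - y (1 + h) + l * h) / h by field; rewrite lt_eqF.
by rewrite normrM normfV (ltr0_norm h0) ler_pdivrMr// oppr_gt0.
Unshelve. all: by end_near. Qed.

End boundary_derivative.

Section shells.
Variables (R : realType) (n : nat) (b : R).
Hypothesis b0 : 0 < b.
Local Notation V := 'rV[R]_n.+1.
Local Notation lam := (@lebesgue_rV R n.+1).
Local Notation leb := (@lebesgue_measure R).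
Local Notation sig := (@sphere_measure R n.+1).
Local Notation S := (esphere 1 : set V).
Local Notation N := (n.+1%:R : R).
Implicit Types (f g : V -> R) (x y : V).

(** The weight is homogeneous of degree b: on the unit sphere its radial derivative is b
    times itself, which the left side subtracts. *)
Lemma radial_deriv_weight k f x : CK setT k.+1 f -> S x ->
  radial_deriv (fun y => weight b y * ball_ext f y) x - b * (weight b x * ball_ext f x) =
  weight b x * ext (radial f) x.
Proof.
move=> hf Sx; have xe : enorm x = 1 by exact: Sx.
have bx : ball_ext f x = ext f x by rewrite /ball_ext xe ltxx.
pose y (r : R) : R := r `^ b * (weight b x * f (r *: x)).
pose dy (r : R) : R := b * r `^ (b - 1) * (weight b x * f (r *: x)) +
  r `^ b * (weight b x * radial f (r *: x)).
have Dy (r : R) : 0 < r < 1 -> is_derive r 1 y (dy r).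
  move=> r01; have r0 : 0 < r by case/andP: r01.
  have H1 := @is_derive1_powR R b r r0.
  have H2 := is_derive_radial hf r01 Sx.
  have H3 := is_deriveZ (weight b x) H2.
  have := is_deriveM H1 H3; 
  rewrite (_ : (fun r : R => r `^ b) * _ = y); last by apply/funext.
  move=> H; apply: is_derive_eq H _; rewrite /dy.
  by rewrite addrC; congr (_ + _); exact: mulrC.
have c1 (e : R) : r `^ e @[r --> (1 : R)^'-] --> (1 : R).
  have : {for (1 : R), continuous (fun r : R => r `^ e)}.
    apply: differentiable_continuous; apply/derivable1_diffP.
    by have [] := @is_derive1_powR R e 1 ltr01.
  by rewrite /prop_for /continuous_at powR1 => /cvg_at_left_filter.
have cf := ext_ray hf Sx; have crf := ext_ray (CK_radial hf) Sx.
have cy : y r @[r --> 1^'-] --> weight b x * ext f x.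
  rewrite -[X in _ --> X]mul1r; apply: cvgM; first exact: c1.
  by apply: cvgM; [exact: cvg_cst|exact: cf].
have cdy : dy r @[r --> 1^'-] --> b * (weight b x * ext f x) + weight b x * ext (radial f) x.
  apply: cvgD.
    rewrite -[X in X * (weight b x * ext f x)]mulr1.
    apply: cvgM; first by apply: cvgM; [exact: cvg_cst|exact: c1].
    by apply: cvgM; [exact: cvg_cst|exact: cf].
  rewrite -[X in _ --> X]mul1r; apply: cvgM; first exact: c1.
  by apply: cvgM; [exact: cvg_cst|exact: crf].
have H := left_derivative Dy cy cdy.
have -> : radial_deriv (fun y => weight b y * ball_ext f y) x =
    b * (weight b x * ext f x) + weight b x * ext (radial f) x.
  apply: cvg_lim => //; apply: cvg_trans H; apply: near_eq_cvg; near=> h.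
  have h0 : h < 0 by near: h; exact: nbhs_left_lt.
  have h1 : - 1 < h by near: h; apply: nbhs_left_gt; lra.
  have h2 : 0 < 1 + h by lra.
  have -> : x + h *: edir x = (1 + h) *: x.
    by rewrite /edir xe invr1 scale1r scalerDl scale1r.
  rewrite weightZ ?ltW// /ball_ext (enorm_ray h2 Sx) xe ltxx.
  have -> : 1 + h < 1 by lra.
  by rewrite /y mulrA.
by rewrite bx; ring.
Unshelve. all: by end_near. Qed.

(** The only point off the sphere that projects off the sphere is the origin. *)
Lemma sphere_measureC : sig (~` S) = 0%E.
Proof.
rewrite /sphere_measure (_ : _ `&` _ = [set 0]).
  suff -> : lam [set (0 : V)] = 0%E by rewrite mule0.
  have m0 : measurable [set (0 : V)].
    rewrite (_ : [set 0] = esphere 0); first exact: measurable_esphere.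
    apply/seteqP; split => x; rewrite /esphere/=; first by move=> ->; exact: enorm0.
    by move=> /eqP; rewrite enorm_eq0 => /eqP.
  have fin : lam [set (0 : V)] \is a fin_num.
    rewrite ge0_fin_numE//; apply: le_lt_trans (@lebesgue_rV_eball R n).
    apply: le_measure; rewrite ?inE//; first exact: measurable_eball.
    by move=> x ->; rewrite /eball/= enorm0.
  have := @lebesgue_rV_scale R n.+1 [set 0] (2 : R) (ltr0Sn _ 1) m0.
  rewrite (_ : _ @^-1` _ = [set 0]); last first.
    apply/seteqP; split => x /=; last by move=> ->; rewrite scaler0.
    by move/eqP; rewrite scaler_eq0 pnatr_eq0/= => /eqP.
  rewrite -(fineK fin) -EFinM => -[] /eqP; rewrite -subr_eq0 -[X in X - _]mul1r -mulrBl.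
  rewrite mulf_eq0 => /orP[|/eqP -> //]; by rewrite gt_eqF// subr_gt0 exprn_ilt1// invf_lt1// ltr1n.
apply/seteqP; split => x /=.
  move=> [+ _]; apply: contra_notP => x0; rewrite /esphere/= /edir enormZ.
  rewrite ger0_norm ?invr_ge0 ?enorm_ge0// mulVf// enorm_eq0.
  exact/eqP.
move=> ->; split; rewrite /edir ?scaler0 /esphere /eball/= enorm0//.
by move/esym/eqP; rewrite oner_eq0.
Qed.

Lemma integral_sphere_restrict (h : V -> R) (M : R) : measurable_fun S h ->
  (forall x, S x -> `|h x| <= M) ->
  (\int[sig]_(x in S) (h x)%:E)%E = (\int[sig]_(x in S) h x)%:E.
Proof.
move=> mh hM; rewrite fineK//; apply: integrable_fin_num; first exact: measurable_esphere.
exact: integrable_sphere mh hM.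
Qed.

Definition shell (s t : R) : set V := eball t `\` eball s.

Lemma measurable_shell s t : measurable (shell s t).
Proof. by apply: measurableD; exact: measurable_eball. Qed.

Lemma shellP s t x : shell s t x <-> s <= enorm x < t.
Proof.
rewrite /shell /eball/=; split => [[xt /negP]|/andP[sx xt]]; first by rewrite -leNgt => ->.
by split => //; apply/negP; rewrite -leNgt.
Qed.

Lemma avg_nroot_continuous k f s t : CK setT k f -> 0 < s -> s < t -> t < 1 ->
  {in `[(s ^+ n.+1)%R, (t ^+ n.+1)%R]%classic,
    continuous (fun q : R => nroot n q `^ b * avg b f (nroot n q))}.
Proof.
move=> hf s0 st t1 q; rewrite inE/= in_itv/= => /andP[sq qt].
have q0 : 0 < q by apply: lt_le_trans sq; rewrite exprn_gt0.
have r0 := nroot_gt0 n q0.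
have r1 : nroot n q < 1.
  apply: le_lt_trans t1; rewrite leNgt; apply/negP => tr.
  have t0 : 0 <= t by rewrite ltW// (lt_trans s0).
  move: qt; rewrite -(exp_nroot n (ltW q0)) leNgt => /negP; apply.
  by rewrite (ltr_pXn2r (ltn0Sn n)) ?nnegrE// ltW.
have cr : {for q, continuous (nroot n : R -> R)}.
  apply: differentiable_continuous; apply/derivable1_diffP.
  by have [] := pow_derive (N^-1) q0.
apply: cvgM.
  apply: (@continuous_comp _ _ _ (nroot n) (fun r : R => r `^ b)) => //.
  apply: differentiable_continuous; apply/derivable1_diffP.
  by have [] := pow_derive b r0.
apply: (@continuous_comp _ _ _ (nroot n) (avg b f)) => //.
by apply: avg_continuous hf _ => //; rewrite r0.
Qed.

Lemma integral_shell_polar k f s t : CK setT k f -> 0 < s -> s < t -> t < 1 ->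
  (N%:E * \int[lam]_(x in shell s t) (weight b x * f x)%:E =
   \int[leb]_(q in `[(s ^+ n.+1)%R, (t ^+ n.+1)%R])
     (nroot n q `^ b * avg b f (nroot n q))%:E)%E.
Proof.
move=> hf s0 st t1.
have t0 : 0 < t by exact: lt_trans st.
have [M M0 fM] := bounded_annulus hf s0.
pose H x : R := (fun x => weight b x * f x) \_ (shell s t) x.
have subp : shell s t `<=` eball 1 `\ 0.
  move=> x /shellP/andP[sx xt]; split; first exact: lt_trans xt t1.
  by move=> /= x0; move: sx; rewrite x0 enorm0 leNgt s0.
have mH : measurable_fun setT H.
  apply/(measurable_restrictT _ (measurable_shell s t)).
  apply: measurable_funM; first by apply: measurable_funTS; exact: measurable_weight.
  apply: (@measurable_funS _ _ _ _ (eball 1 `\ 0)) => //.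
    by apply: open_measurable_rV; exact: open_punct.
  exact: CK_measurable hf.
have HM x : `|H x| <= M.
  rewrite /H patchE; case: ifPn => [|_]; last by rewrite normr0.
  rewrite inE => /shellP/andP[sx xt]; have x1 := lt_trans xt t1.
  rewrite normrM ger0_norm ?weight_ge0// -[M]mul1r ler_pM ?weight_ge0//.
    by apply: weight_le1 => //; exact: ltW.
  exact: fM.
have := integral_polar mH HM.
have -> : (\int[lam]_(x in eball 1) (H x)%:E =
    \int[lam]_(x in shell s t) (weight b x * f x)%:E)%E.
  rewrite (eq_integral ((fun x => (weight b x * f x)%:E) \_ (shell s t))); last first.
    by move=> x _; rewrite /H !patchE; case: ifP.
  rewrite -integral_mkcondr; congr (integral _ _ _); apply: setIidr => x xs.
  by have [] := subp _ xs.
move=> ->.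
have ntE q : 0 <= q -> (s <= nroot n q < t) = (s ^+ n.+1 <= q < t ^+ n.+1).
  move=> q0; rewrite -{3 4}(exp_nroot n q0).
  by rewrite (ler_pXn2r (ltn0Sn n)) ?(ltr_pXn2r (ltn0Sn n)) ?nnegrE ?powR_ge0// ltW.
pose G (q : R) : R := nroot n q `^ b * avg b f (nroot n q).
have inner q : 0 <= q -> (\int[sig]_x (H (nroot n q *: x))%:E)%E =
    if s <= nroot n q < t then (G q)%:E else 0%E.
  move=> q0; have r0 : 0 <= nroot n q by exact: powR_ge0.
  have mHq : measurable_fun setT (fun x => H (nroot n q *: x)).
    by apply: (measurableT_comp mH); exact: measurable_scale_rV.
  have iH : sig.-integrable setT (fun x => (H (nroot n q *: x))%:E).
    apply: measurable_bounded_integrable => //.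
      by rewrite -ge0_fin_numE//; exact: fin_num_measure.
    by exists M; split => [|L ML x _]; [exact: num_real|rewrite /= (le_trans (HM _))// ltW].
  rewrite (negligible_integral _ _ iH sphere_measureC)//; last first.
    by apply: measurableC; exact: measurable_esphere.
  rewrite setTD setCK.
  have shE x : S x -> (nroot n q *: x \in shell s t) = (s <= nroot n q < t).
    move=> Sx; rewrite -[in RHS](ger0_norm r0) -[`|_|]mulr1 -[X in _ * X]Sx -enormZ.
    by apply/idP/idP; rewrite inE => /shellP.
  case: ifP => qst; last first.
    apply: integral0_eq => x Sx; rewrite /H patchE shE// qst//.
  have r01 : 0 < nroot n q < 1.
    by case/andP: qst => q1 q2; rewrite (lt_le_trans s0 q1) (lt_trans q2 t1).
  rewrite (eq_integral (fun x => (nroot n q `^ b)%:E * (weight b x * f (nroot n q *: x))%:E)%E).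
    rewrite integralZl//; first last.
      exact: integrable_avg hf r01.
      exact: measurable_esphere.
    rewrite /G EFinM; congr (_ * _)%E.
    have [M' _ gM'] := avg_bound b0 hf (proj1 (andP r01)).
    apply: (@integral_sphere_restrict _ M'); first exact: measurable_avg hf r01.
    by move=> x Sx; apply: gM' => //; rewrite lexx; case/andP: r01.
  by move=> x; rewrite inE => Sx; rewrite /H patchE shE// qst weightZ// -EFinM mulrA.
transitivity (\int[leb]_(q in `[0%R, 1%R[) ((EFin \o G) \_ `[(s ^+ n.+1)%R, (t ^+ n.+1)%R[) q)%E.
  apply: eq_integral => q; rewrite inE/= in_itv/= => /andP[q0 q1].
  by rewrite inner// ntE// patchE mem_setE in_itv/=.
rewrite -integral_mkcondr (_ : _ `&` _ = `[(s ^+ n.+1)%R, (t ^+ n.+1)%R[%classic); last first.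
  apply/setIidr => q; rewrite /= !in_itv/= => /andP[q1 q2]; apply/andP; split.
    by apply: le_trans q1; rewrite exprn_ge0// ltW.
  by apply: lt_le_trans q2 _; rewrite exprn_ile1// ltW.
rewrite integral_itv_bndo_bndc//.
apply/measurable_EFinP.
apply: (@measurable_funS _ _ _ _ `[(s ^+ n.+1)%R, (t ^+ n.+1)%R]%classic) => //.
  by apply: subset_itvl; rewrite bnd_simp.
apply: subspace_continuous_measurable_fun => //.
exact: continuous_in_subspaceT (avg_nroot_continuous hf s0 st t1).
Qed.

(** The Jacobian r^n and the homogeneity of the weight combine to r^(n+b). *)
Lemma integral_shell k f s t : CK setT k f -> 0 < s -> s < t -> t < 1 ->
  (\int[lam]_(x in shell s t) (weight b x * f x)%:E =
   \int[leb]_(r in `[s, t]) (r `^ (n%:R + b) * avg b f r)%:E)%E.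
Proof.
move=> hf s0 st t1.
have N0 : N != 0 by rewrite pnatr_eq0.
have E : (N%:E * \int[lam]_(x in shell s t) (weight b x * f x)%:E =
   N%:E * \int[leb]_(r in `[s, t]) (r `^ (n%:R + b) * avg b f r)%:E)%E.
  rewrite (integral_shell_polar hf s0 st t1).
  have dF : derive1 (@GRing.exp R ^~ n.+1) = (fun r => N * r ^+ n).
    by apply/funext => r; rewrite exp_derive1.
  have cdF : continuous (fun r : R => N * r ^+ n).
    by move=> r; apply: cvgM; [exact: cvg_cst|exact: exprn_continuous].
  rewrite (@integration_by_substitution_increasing R (@GRing.exp R ^~ n.+1)
    (fun q => nroot n q `^ b * avg b f (nroot n q)) s t (ltW st)); last first.
  - exact: continuous_in_subspaceT (avg_nroot_continuous hf s0 st t1).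
  - split; first by move=> r _; exact: exprn_derivable.
      exact/cvg_at_right_filter/exprn_continuous.
    exact/cvg_at_left_filter/exprn_continuous.
  - by rewrite dF; apply/cvg_ex; eexists; exact/cvg_at_left_filter/cdF.
  - by rewrite dF; apply/cvg_ex; eexists; exact/cvg_at_right_filter/cdF.
  - by rewrite dF => r _; exact: cdF.
  - move=> x y; rewrite !in_itv/= => /andP[sx _] /andP[sy _].
    by rewrite (ltr_pXn2r (ltn0Sn n)) ?nnegrE ?(le_trans (ltW s0)).
  rewrite -integralZl//; last first.
    apply: continuous_compact_integrable; first exact: segment_compact.
    apply: continuous_in_subspaceT => r; rewrite inE/= in_itv/= => /andP[sr rt].
    have r0 : 0 < r by exact: lt_le_trans sr.
    have r1 : r < 1 by exact: le_lt_trans rt t1.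
    have cp : {for r, continuous (fun r : R => r `^ (n%:R + b))}.
      apply: differentiable_continuous; apply/derivable1_diffP.
      by have [] := pow_derive (n%:R + b) r0.
    by apply: cvgM; [exact: cp|apply: avg_continuous hf _ => //; rewrite r0].
  apply: eq_integral => r; rewrite inE/= in_itv/= => /andP[sr rt].
  have r0 : 0 < r by exact: lt_le_trans sr.
  rewrite dF -EFinM; congr (_%:E).
  transitivity (nroot n (r ^+ n.+1) `^ b * avg b f (nroot n (r ^+ n.+1)) * (N * r ^+ n)) => //.
  by rewrite nroot_exp ?ltW// powD// powR_mulrn ?ltW//; ring.
have := E; set X := integral _ _ _; set Y := integral _ _ _.
have NN : (N^-1%:E * N%:E = 1 :> \bar R)%E by rewrite -EFinM mulVf.
by move=> /(congr1 (fun z => N^-1%:E * z)%E); rewrite !muleA NN !mul1e.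
Qed.

End shells.

(** * The weak form of the radial equation *)

Section norm_power.
Variables (R : realType) (b : R).
Hypothesis b0 : 0 < b.

Lemma is_derive_normpow (t : R) : t != 0 ->
  is_derive t 1 (fun s : R => `|s| `^ b) (b * `|t| `^ b / t).
Proof.
move=> t0.
have pos (s : R) : 0 < s -> b * s `^ (b - 1) = b * s `^ b / s.
  by move=> s0; rewrite powRB ?powRr1 ?ltW ?mulrA// (gt_eqF s0) implybT.
have [t1|t1|t1] := ltgtP t 0; last by rewrite t1 eqxx in t0.
- have nt : 0 < - t by rewrite oppr_gt0.
  have H := @is_derive1_comp R (fun s => s `^ b) -%R t _ _ (is_derive1_powR b nt) _.
  have {}H := H _ (is_deriveN (is_derive_id t (1:R))).
  apply: (@near_eq_is_derive _ _ _ ((fun s => s `^ b) \o -%R)).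
    near=> s; rewrite /= ltr0_norm//; near: s; exact: lt_nbhsl.
  by apply: is_derive_eq H _; rewrite pos// ltr0_norm// mulrN1 invrN mulrN opprK.
- apply: (@near_eq_is_derive _ _ _ (fun s => s `^ b)).
    near=> s; rewrite /= gtr0_norm//; near: s; exact: lt_nbhsr.
  apply: is_derive_eq (is_derive1_powR b t1) _.
  by rewrite pos// gtr0_norm.
Unshelve. all: by end_near. Qed.

(** At t = 0 the product is o(t): the factor G(t) is O(t) and the other one tends
    to 0. *)
Lemma is_derive_normpowM (G : R -> R) (t dG : R) : is_derive t 1 G dG -> (t = 0 -> G t = 0) ->
  is_derive t 1 (fun s => `|s| `^ b * G s) (`|t| `^ b * (dG + b * (G t / t))).
Proof.
move=> DG G0; have [t0|t0] := eqVneq t 0; last first.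
  have H := is_deriveM (is_derive_normpow t0) DG.
  apply: is_derive_eq H _; rewrite mulrDr; congr (_ + _).
  by rewrite /GRing.scale/=; ring.
rewrite t0 in DG G0 *; have G00 := G0 erefl.
rewrite normr0 powR0 ?gt_eqF// mul0r.
have H : h^-1 *: (G (h *: 1 + 0) - G 0) @[h --> 0^'] --> dG.
  by case: DG => dG1 <-; exact: dG1.
have c : `|h| `^ b * (h^-1 *: (G (h *: 1 + 0) - G 0)) @[h --> 0^'] --> 0 * dG.
  apply: cvgM; last exact: H.
  apply: cvg_within_filter; have := @continuous_powR_norm R b b0 0.
  by rewrite /continuous_at normr0 powR0 ?gt_eqF.
rewrite mul0r in c.
pose Q (s : R) := `|s| `^ b * G s.
have c' : h^-1 *: (Q (h *: (1 : R) + 0) - Q 0) @[h --> 0^'] --> (0 : R).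
  apply: cvg_trans c; apply: near_eq_cvg; near=> h.
  by rewrite /Q /GRing.scale/= mulr1 addr0 G00 mulr0 !subr0 mulrCA.
split; first by apply/cvg_ex; exists 0; exact: c'.
exact: cvg_lim c'.
Unshelve. all: by end_near. Qed.

End norm_power.

Section weak_form.
Variables (R : realType) (n : nat) (b : R).
Hypothesis b0 : 0 < b.
Local Notation V := 'rV[R]_n.+1.
Local Notation lam := (@lebesgue_rV R n.+1).
Local Notation leb := (@lebesgue_measure R).
Local Notation sig := (@sphere_measure R n.+1).
Local Notation e_ i := (delta_mx (ord0 : 'I_1) i : V).
Implicit Types (f g h : V -> R) (x y : V).

Lemma setcoord_line x j t : setcoord x j t = setcoord x j 0 + (t * 1) *: e_ j.
Proof.
apply: eq_row => i; rewrite !mxE eqxx/= mulr1; case: ifP => ij.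
  by rewrite mulr1 add0r.
by rewrite mulr0 addr0.
Qed.

Lemma setcoord_continuous x j : continuous (setcoord x j : R -> V).
Proof.
move=> t; rewrite (_ : setcoord x j = fun t => setcoord x j 0 + (t * 1) *: e_ j).
  by apply: cvgD; [exact: cvg_cst|apply: cvgZr_tmp; apply: cvgM; [exact: cvg_id|exact: cvg_cst]].
by apply/funext => s; exact: setcoord_line.
Qed.

Lemma is_derive_setcoord h x j t : derivable h (setcoord x j t) (e_ j) ->
  is_derive t 1 (fun t => h (setcoord x j t)) (pderiv j h (setcoord x j t)).
Proof.
move=> dh; rewrite setcoord_line in dh.
have H := @is_derive_line R n h (setcoord x j 0) (e_ j) 1 t dh.
rewrite (_ : (fun t => _) = fun s => h (setcoord x j 0 + (s * 1) *: e_ j)); last first.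
  by apply/funext => s; rewrite setcoord_line.
by apply: is_derive_eq H _; rewrite mul1r -setcoord_line.
Qed.

Lemma is_derive_enorm x j t : setcoord x j t != 0 ->
  is_derive t 1 (fun t => enorm (setcoord x j t)) (edir (setcoord x j t) ord0 j).
Proof.
rewrite -enorm_gt0 => z0; pose C := \sum_(i | i != j) x ord0 i ^+ 2.
have E s : \sum_i setcoord x j s ord0 i ^+ 2 = s ^+ 2 + C.
  rewrite (bigD1 j)//= setcoordE eqxx; congr (_ + _).
  by apply: eq_bigr => i ij; rewrite setcoordE (negbTE ij).
have Ct : 0 < t ^+ 2 + C by rewrite -E -sqr_enorm exprn_gt0.
have H1 : is_derive t 1 (fun s : R => s ^+ 2 + C) (2 * t).
  have H := is_deriveD (is_deriveX 2 (is_derive_id t (1:R))) (is_derive_cst C t (1:R)).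
  by apply: is_derive_eq H _; rewrite /GRing.scale/= addr0 mulr1 expr1.
have H2 := @is_derive1_comp R Num.sqrt (fun s : R => s ^+ 2 + C) t _ _ (is_derive1_sqrt Ct) H1.
rewrite (_ : (fun t => _) = Num.sqrt \o (fun s : R => s ^+ 2 + C)); last first.
  by apply/funext => s; rewrite /enorm E.
apply: is_derive_eq H2 _; rewrite mxE setcoordE eqxx /enorm E; field.
by rewrite gt_eqF// sqrtr_gt0.
Qed.

Lemma CK_radius (psi : R -> R) : continuous psi -> CK setT 0 (fun x : V => psi (enorm x)).
Proof.
move=> cp; split => // x _ xB; apply/cvg_ex; exists (psi (enorm x)).
apply: cvg_within_filter.
by apply: (@continuous_comp _ _ _ (@enorm R n.+1) psi); [exact: enorm_continuous|exact: cp].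
Qed.

Section cutoff.
Variables (s e : R).
Hypotheses (s0 : 0 < s) (se : s < e) (e1 : e < 1).

Lemma cutoff_cases x : enorm x < s \/ (s <= enorm x <= e /\ (eball 1 `\ 0) x) \/ e < enorm x.
Proof.
have [xs|xs] := ltP (enorm x) s; first by left.
have [xe|xe] := leP (enorm x) e; last by right; right.
right; left; split => //; split; first exact: le_lt_trans xe e1.
by move=> /= x0; move: xs; rewrite x0 enorm0 leNgt s0.
Qed.

Lemma near_cutoff x : enorm x < s \/ e < enorm x ->
  \forall y \near x, enorm y <= s \/ e <= enorm y.
Proof.
move=> [xs|xe].
  have nx : \forall y \near x, enorm y < s by exact: (@enorm_continuous R n.+1 x _ (lt_nbhsl xs)).
  by near=> y; left; apply/ltW; near: y.
have nx : \forall y \near x, e < enorm y by exact: (@enorm_continuous R n.+1 x _ (lt_nbhsr xe)).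
by near=> y; right; apply/ltW; near: y.
Unshelve. all: by end_near. Qed.

Definition supported (psi : R -> R) := forall r, r <= s \/ e <= r -> psi r = 0.

Lemma cutoff_continuous k h psi : CK setT k h -> continuous psi -> supported psi ->
  continuous (fun x => h x * psi (enorm x)).
Proof.
move=> hh cp p0 x.
have far : enorm x < s \/ e < enorm x ->
    h y * psi (enorm y) @[y --> x] --> h x * psi (enorm x).
  move=> xo; rewrite [psi (enorm x)]p0; last by case: xo => /ltW; [left|right].
  rewrite mulr0; apply: (@cvg_near_cst _ _ 0 _ (nbhs x) (nbhs_filter x)).
  have nc := near_cutoff xo; near=> y; rewrite p0 ?mulr0//.
  by near: y; exact: nc.
have [xs|[[_ xp]|xe]] := cutoff_cases x; [by apply: far; left| |by apply: far; right].
have c1 : h @ x --> h x := CK_continuous hh I xp.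
apply: (cvgM c1).
by apply: (@continuous_comp _ _ _ (@enorm R n.+1) psi); [exact: enorm_continuous|exact: cp].
Unshelve. all: by end_near. Qed.

Lemma cutoff_bounded k h psi : CK setT k h -> continuous psi -> supported psi ->
  exists2 M, 0 <= M & forall x, `|h x * psi (enorm x)| <= M.
Proof.
move=> hh cp p0.
have hp : CK setT 0 (fun x => h x * psi (enorm x)).
  by apply: CKM; [exact: openT|exact: CK0 hh|exact: CK_radius].
have [M M0 bM] := bounded_annulus hp s0; exists M => // x.
have [xs|[[/andP[sx xe] _]|xe]] := cutoff_cases x.
- by rewrite p0 ?mulr0 ?normr0//; left; exact: ltW.
- by apply: bM => //; exact: le_lt_trans xe e1.
- by rewrite p0 ?mulr0 ?normr0//; right; exact: ltW.
Qed.

Section divergence.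
Variables (f : V -> R) (phi dphi : R -> R).
Hypothesis hf : CK setT 2 f.
Hypothesis pf : parity 1 f.
Hypotheses (phi_off : supported phi) (dphi_off : supported dphi).
Hypotheses (dphi_cont : continuous dphi) (Dphi : forall r : R, is_derive r 1 phi (dphi r)).

Let phi_cont : continuous phi.
Proof.
by move=> r; apply: differentiable_continuous; apply/derivable1_diffP; have [] := Dphi r.
Qed.

(** The components of the field |x_N|^b phi(|x|) grad f. *)
Definition flux j x : R := weight b x * (pderiv j f x * phi (enorm x)).

(** The derivative of the j-th component in x_j. For the last coordinate the derivative
    of the weight contributes b f_N / x_N, the singular term of the operator. *)
Definition flux_div j x : R := weight b x *
  (pderiv j (pderiv j f) x * phi (enorm x) + edir x ord0 j * pderiv j f x * dphi (enorm x)
   + (b *+ (j == ord_max)) * (dquot f x * phi (enorm x))).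

Lemma flux_div_off j x : enorm x <= s \/ e <= enorm x -> flux_div j x = 0.
Proof. by move=> xo; rewrite /flux_div phi_off// dphi_off// !mulr0 !addr0 mulr0. Qed.

Lemma flux_off j x : enorm x <= s \/ e <= enorm x -> flux j x = 0.
Proof. by move=> xo; rewrite /flux phi_off// !mulr0. Qed.

Lemma odd_axis x : (eball 1 `\ 0) x -> xlast x = 0 -> pderiv ord_max f x = 0.
Proof.
move=> xp x0; have := parity_pderiv ord_max (CK_pred hf) pf xp.
have -> : xreflect x = x.
  by apply: eq_row => i; rewrite mxE; case: eqP => // ->; rewrite -/(xlast x) x0 oppr0.
by rewrite eqxx expr1 mul1r mulN1r => /eqP; rewrite -addr_eq0 -mulr2n mulrn_eq0/= => /eqP.
Qed.

(** Beyond the cut-offs everything vanishes nearby. On the plane x_N = 0 the weight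
    need not be differentiable, but it multiplies f_N, which vanishes there because it is
    odd. *)
Lemma is_derive_flux x j (t : R) :
  is_derive t 1 (fun t => flux j (setcoord x j t)) (flux_div j (setcoord x j t)).
Proof.
set z := setcoord x j t.
have far : enorm z < s \/ e < enorm z ->
    is_derive t 1 (fun t => flux j (setcoord x j t)) (flux_div j z).
  move=> zo; rewrite flux_div_off; last by case: zo => /ltW; [left|right].
  apply: (@near_eq_is_derive _ _ _ (cst (0 : R))).
  have nc : \forall r \near t, enorm (setcoord x j r) <= s \/ e <= enorm (setcoord x j r).
    exact: (@setcoord_continuous x j t _ (near_cutoff zo)).
  near=> r; rewrite flux_off//=; near: r; exact: nc.
have [zs|[[_ zp]|ze]] := cutoff_cases z; [by apply: far; left| |by apply: far; right].
have z0 : z != 0 by apply/eqP => z0; case: zp.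
have D1 := is_derive_setcoord (j := j) (CK_derivable (CK_pderiv hf j) I zp).
have D2 := @is_derive1_comp R phi (fun t : R => enorm (setcoord x j t)) t _ _ (Dphi (enorm z)) (is_derive_enorm z0).
have DG := is_deriveM D1 D2.
pose G r := pderiv j f (setcoord x j r) * phi (enorm (setcoord x j r)).
pose dG := pderiv j (pderiv j f) z * phi (enorm z) + edir z ord0 j * pderiv j f z * dphi (enorm z).
have {}DG : is_derive t 1 G dG.
  rewrite (_ : G = (fun t => pderiv j f (setcoord x j t)) * (phi \o (fun t => enorm (setcoord x j t))))//.
  by apply: is_derive_eq DG _; rewrite /dG /GRing.scale/= -/z addrC; congr (_ + _); ring.
have [jN|jN] := eqVneq j ord_max.
  have xl r : xlast (setcoord x j r) = r by rewrite /xlast jN setcoordE eqxx.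
  rewrite (_ : (fun t => _) = fun r => `|r| `^ b * G r); last first.
    by apply/funext => r; rewrite /flux /weight xl.
  have G0 : t = 0 -> G t = 0.
    by move=> t0; rewrite /G -/z jN odd_axis ?mul0r// /z xl.
  apply: is_derive_eq (is_derive_normpowM b0 DG G0) _.
  rewrite /flux_div jN eqxx mulr1n -jN /weight xl -/dG.
  have [t0|t0] := eqVneq t 0; first by rewrite t0 normr0 powR0 ?gt_eqF// !mul0r.
  congr (_ * _); congr (_ + _ * _); rewrite /G -/z /dquot xl (negbTE t0) jN; ring.
rewrite (_ : (fun t => _) = weight b x *: G); last first.
  apply/funext => r; rewrite /flux; congr (_ * _).
  by rewrite /weight /xlast setcoordE eq_sym (negbTE jN).
apply: is_derive_eq (is_deriveZ _ DG) _.
rewrite /flux_div (negbTE jN) mulr0n mul0r addr0; congr (_ * _).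
by rewrite /weight /xlast setcoordE eq_sym (negbTE jN).
Unshelve. all: by end_near. Qed.

Lemma flux_div_continuous j : continuous (flux_div j).
Proof.
move=> x; have c1 : weight b y @[y --> x] --> weight b x := @continuous_weight R n b b0 x.
apply: (cvgM c1).
apply: cvgD; first apply: cvgD.
- exact: cutoff_continuous (CK_pderiv (CK_pderiv hf j) j) phi_cont phi_off x.
- exact: cutoff_continuous (CK_edirM j (CK_pderiv hf j)) dphi_cont dphi_off x.
- apply: cvgM; first exact: cvg_cst.
  exact: cutoff_continuous (CK_dquot hf pf) phi_cont phi_off x.
Qed.

Lemma flux_div_box j x : ~ box 1 x -> flux_div j x = 0.
Proof.
move=> xb; apply: flux_div_off; right.
rewrite leNgt; apply/negP => xe; apply: xb => i.
by rewrite (le_trans (coord_le_enorm _ _))// ltW// (lt_trans xe).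
Qed.

Lemma flux_div_bounded j : exists M, forall x, `|flux_div j x| <= M.
Proof.
have [M1 M10 H1] := cutoff_bounded (CK_pderiv (CK_pderiv hf j) j) phi_cont phi_off.
have [M2 M20 H2] := cutoff_bounded (CK_edirM j (CK_pderiv hf j)) dphi_cont dphi_off.
have [M3 M30 H3] := cutoff_bounded (CK_dquot hf pf) phi_cont phi_off.
exists (M1 + M2 + `|b *+ (j == ord_max)| * M3) => x.
have [xe|xe] := leP e (enorm x).
  rewrite flux_div_off; last by right.
  by rewrite normr0 !addr_ge0// mulr_ge0.
rewrite /flux_div normrM ger0_norm ?weight_ge0//.
rewrite -[leRHS]mul1r ler_pM ?weight_ge0//.
  by apply: weight_le1 => //; rewrite ltW// (lt_trans xe).
rewrite (le_trans (ler_normD _ _))// lerD//.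
  by rewrite (le_trans (ler_normD _ _))// lerD.
by rewrite normrM ler_wpM2l.
Qed.

Lemma flux_div_line x j : (\int[leb]_t (flux_div j (setcoord x j t))%:E = 0)%E.
Proof.
have out (t : R) : 1 <= `|t| -> flux_div j (setcoord x j t) = 0.
  move=> t1; apply: flux_div_off; right; apply: (le_trans (ltW e1)); apply: (le_trans t1).
  by have := coord_le_enorm (setcoord x j t) j; rewrite setcoordE eqxx.
transitivity (\int[leb]_t ((fun t : R => (flux_div j (setcoord x j t))%:E) \_ `[(-2)%R, 2%R]) t)%E.
  apply: eq_integral => t _; rewrite patchE; case: ifPn => //; rewrite notin_setE /= in_itv/= => /negP.
  rewrite -ler_norml -ltNge => t2; rewrite out//.
  by rewrite (le_trans _ (ltW t2))// ler1n.
rewrite -integral_mkcond.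
have c : continuous (fun t => flux_div j (setcoord x j t)).
  move=> t; apply: (@continuous_comp _ _ _ (setcoord x j) (flux_div j)).
    exact: setcoord_continuous.
  exact: flux_div_continuous.
have d t := @is_derive_flux x j t.
have cF : continuous (fun t => flux j (setcoord x j t)).
  by move=> t; apply: differentiable_continuous; apply/derivable1_diffP; have [] := d t.
rewrite (@continuous_FTC2 R _ (fun t => flux j (setcoord x j t)) (-2) 2).
- have far (t : R) : 1 <= `|t| -> flux j (setcoord x j t) = 0.
    move=> t1; apply: flux_off; right; apply: (le_trans (ltW e1)); apply: (le_trans t1).
    by have := coord_le_enorm (setcoord x j t) j; rewrite setcoordE eqxx.
  by rewrite !far ?normrN ?normr_nat ?ler1n// subee.
- by lra.
- exact: continuous_subspaceT.
- split; first by move=> t _; have [] := d t.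
    exact/cvg_at_right_filter/cF.
  exact/cvg_at_left_filter/cF.
- by move=> t _; rewrite derive1E; have [_] := d t.
Qed.

Lemma integral_flux_div j : (\int[lam]_x (flux_div j x)%:E = 0)%E.
Proof.
have [M bM] := flux_div_bounded j.
apply: (@integral_lines_eq0 R n.+1 j _ M 1) => //.
- exact: continuous_measurable_rV (@flux_div_continuous j).
- exact: flux_div_box.
- by move=> x; exact: flux_div_line.
Qed.

Lemma sum_flux_div a x : b = 2 * a - 1 ->
  \sum_j flux_div j x =
  weight b x * (lapA a f x * phi (enorm x) + radial f x * dphi (enorm x)).
Proof.
move=> bE; rewrite /flux_div -mulr_sumr; congr (_ * _).
rewrite !big_split/= -!mulr_suml -addrA [X in _ + X]addrC addrA; congr (_ + _).
have -> : \sum_(j < n.+1) b *+ (j == ord_max) = b.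
  by rewrite (bigD1 ord_max)//= eqxx mulr1n big1 ?addr0// => j /negbTE ->.
by rewrite mulrA -mulrDl /lapA -bE.
Qed.

(** The divergence theorem for the field |x_N|^b phi(|x|) grad f: its boundary terms
    vanish, both at the cut-offs and on the plane x_N = 0. *)
Lemma weak_form_integral a : b = 2 * a - 1 ->
  (\int[lam]_x (weight b x * (lapA a f x * phi (enorm x) + radial f x * dphi (enorm x)))%:E = 0)%E.
Proof.
move=> bE; rewrite (eq_integral (fun x => \sum_j (flux_div j x)%:E)%E); last first.
  by move=> x _; rewrite -sum_flux_div// sumEFin.
rewrite integral_sum//=; last first.
  move=> j; have [M bM] := flux_div_bounded j.
  apply: (@integrable_box R n.+1 _ M 1) => //; last exact: flux_div_box.
  exact: continuous_measurable_rV (@flux_div_continuous j).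
by apply: big1 => j _; exact: integral_flux_div.
Qed.

(** The same identity in polar coordinates. *)
Lemma weak_form a : b = 2 * a - 1 ->
  (\int[leb]_(r in `[s, e]) (r `^ (n%:R + b) *
     (avg b (lapA a f) r * phi r + avg b (radial f) r * dphi r))%:E = 0)%E.
Proof.
move=> bE; have W := weak_form_integral bE.
pose Q x := lapA a f x * phi (enorm x) + radial f x * dphi (enorm x).
have hl : CK setT 0 (lapA a f) by exact: CK_lapA.
have hr : CK setT 0 (radial f) by exact: CK_radial hf.
have hQ : CK setT 0 Q.
  by apply: CKD; [exact: openT| |]; apply: CKM; by [exact: openT|exact: CK_radius|].
have := integral_shell b0 hQ s0 se e1.
rewrite integral_mkcond (eq_integral (fun x => (weight b x * Q x)%:E)); last first.
  move=> x _; rewrite patchE; case: ifPn => //; rewrite notin_setE => xs.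
  suff -> : Q x = 0 by rewrite mulr0.
  have xo : enorm x <= s \/ e <= enorm x.
    have [xs'|xs'] := ltP (enorm x) s; first by left; exact: ltW.
    by right; rewrite leNgt; apply/negP => xe; apply: xs; apply/shellP; rewrite xs'.
  by rewrite /Q phi_off// dphi_off// !mulr0 addr0.
rewrite W => E; rewrite [RHS]E; apply: eq_integral => r; rewrite inE/= in_itv/= => /andP[sr re]; congr (_ * _)%:E.
have r0 : 0 < r by exact: lt_le_trans sr.
have r01 : 0 < r < 1 by rewrite r0 (le_lt_trans re).
have m1 := measurable_esphere 1 : measurable (esphere 1 : set V).
rewrite -!RintegralZr//; [|exact: integrable_avg hr r01|exact: integrable_avg hl r01].
rewrite -RintegralD//.
- by apply: eq_Rintegral => x; rewrite inE => Sx; rewrite /Q (enorm_ray r0 Sx); ring.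
- exact: integrableZr (integrable_avg b0 hl r01).
- exact: integrableZr (integrable_avg b0 hr r01).
Qed.

End divergence.
End cutoff.
End weak_form.

(** * From the weak to the pointwise radial equation *)

Section du_bois_reymond.
Variable R : realType.
Local Notation leb := (@lebesgue_measure R).
Implicit Types (D A B phi : R -> R) (r x y : R).

Definition primitive D x : R := \int[leb]_(t in `[0, x]) D t.

Lemma is_derive_primitive D x : continuous D -> 0 < x -> is_derive x 1 (primitive D) (D x).
Proof.
move=> cD x0; have x1 : x < x + 1 by rewrite ltrDl.
have iD : leb.-integrable `[0, x + 1] (EFin \o D).
  apply: continuous_compact_integrable; first exact: segment_compact.
  exact: continuous_subspaceT.
have [d1 d2] := @continuous_FTC1_closed R D 0 x (x + 1) x1 iD x0 (cD x).
rewrite derive1E in d2.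
exact: DeriveDef d1 d2.
Qed.

Lemma primitive_left D s x : (forall r, r <= s -> D r = 0) -> x <= s -> primitive D x = 0.
Proof.
move=> D0 xs; rewrite /primitive (@eq_Rintegral _ _ _ _ _ (cst 0)) ?Rintegral0//; first by rewrite /Rintegral integral0.
move=> r; rewrite inE/= in_itv/= => /andP[_ rx].
by apply: D0; exact: le_trans xs.
Qed.

Lemma primitive_right D e x : continuous D -> 0 < e -> (forall r, e <= r -> D r = 0) ->
  e <= x -> primitive D x = primitive D e.
Proof.
move=> cD e0 D0; rewrite le_eqVlt => /predU1P[<-//|ex].
have [r /andP[er rx]|c /andP[ec _] E] := @MVT_der R (primitive D) D e x ex.
  by apply: is_derive_primitive => //; exact: lt_le_trans er.
by apply/eqP; rewrite -subr_eq0 E D0 ?mul0r// ltW.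
Qed.

(** Let Q be a primitive of A, G = B - Q, w > 0 a bump function on ]s, e[, and c the mean
    of G for the density w. The test function with derivative (G - c) w turns the
    hypothesis into the vanishing of the integral of (G - c)^2 w. Hence B = Q + c. *)
Lemma du_bois_reymond A B s e : 0 < s -> s < e -> e < 1 ->
  (forall r, 0 < r < 1 -> {for r, continuous A}) ->
  (forall r, 0 < r < 1 -> {for r, continuous B}) ->
  (forall phi dphi : R -> R, supported s e phi -> supported s e dphi -> continuous dphi ->
    (forall r, is_derive r 1 phi (dphi r)) ->
    (\int[leb]_(r in `[s, e]) (A r * phi r + B r * dphi r)%:E = 0)%E) ->
  forall r, s < r < e -> is_derive r 1 B (A r).
Proof.
move=> s0 se e1 cA cB weak.
pose clamp r := Num.max s (Num.min e r).
have clampI r : 0 < clamp r < 1.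
  rewrite /clamp lt_max s0/= gt_max (lt_trans se)//=.
  by rewrite gt_min e1.
have cclamp : continuous clamp.
  move=> r; apply: (@continuous_max _ _ (cst s) (fun r => Num.min e r)); first exact: cvg_cst.
  by apply: (@continuous_min _ _ (cst e) id); [exact: cvg_cst|exact: cvg_id].
have clampE r : s <= r <= e -> clamp r = r.
  by move=> /andP[sr re]; rewrite /clamp min_r// max_r.
pose At r := A (clamp r); pose Bt r := B (clamp r).
have cAt : continuous At.
  by move=> r; apply: (@continuous_comp _ _ _ clamp A); [exact: cclamp|exact: cA].
have cBt : continuous Bt.
  by move=> r; apply: (@continuous_comp _ _ _ clamp B); [exact: cclamp|exact: cB].
pose Q := primitive At.
have DQ r : 0 < r -> is_derive r 1 Q (At r) by exact: is_derive_primitive.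
pose w r := Num.max 0 ((r - s) * (e - r)).
have cw : continuous w.
  move=> r; apply: (@continuous_max _ _ (cst 0) (fun r => (r - s) * (e - r))).
    exact: cvg_cst.
  by apply: cvgM; apply: cvgB; (exact: cvg_id || exact: cvg_cst).
have w_off : supported s e w.
  move=> r [rs|er]; rewrite /w; apply: max_l.
    by rewrite mulr_le0_ge0 ?subr_le0// subr_ge0 (le_trans rs)// ltW.
  by rewrite mulr_ge0_le0 ?subr_le0// subr_ge0 (le_trans _ er)// ltW.
have w_gt0 r : s < r < e -> 0 < w r.
  by move=> /andP[sr re]; rewrite lt_max mulr_gt0 ?subr_gt0 ?orbT.
(* the primitive Q is only known to be continuous at positive arguments *)
pose G r := Bt r - Q (clamp r).
have cG : continuous G.
  move=> r; apply: cvgB; first exact: cBt.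
  apply: (@continuous_comp _ _ _ clamp Q); first exact: cclamp.
  apply: differentiable_continuous; apply/derivable1_diffP.
  by have [] := DQ (clamp r) (proj1 (andP (clampI r))).
pose Gw r := G r * w r.
have cGw : continuous Gw by move=> r; apply: cvgM; [exact: cG|exact: cw].
pose c := primitive Gw e / primitive w e.
have e0 : 0 < e := lt_trans s0 se.
have W0 : 0 < primitive w e.
  have [r /andP[sr re]|z zI E] := @MVT_der R (primitive w) w s e se.
    by apply: is_derive_primitive => //; exact: lt_le_trans sr.
  have := E; rewrite (@primitive_left w s s)// ?subr0; last by move=> r rs; apply: w_off; left.
  by move=> ->; rewrite mulr_gt0 ?w_gt0 ?subr_gt0.
pose phi r := primitive Gw r - c * primitive w r.
pose dphi r := (G r - c) * w r.
have Gw_off : supported s e Gw by move=> r ro; rewrite /Gw w_off// mulr0.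
have phi_left r : r <= s -> phi r = 0.
  move=> rs; rewrite /phi !(@primitive_left _ s) ?mulr0 ?subrr//.
    by move=> t ts; apply: w_off; left.
  by move=> t ts; apply: Gw_off; left.
have phi_off : supported s e phi.
  move=> r [rs|er]; first exact: phi_left.
  rewrite /phi (@primitive_right Gw e)//; last by move=> t et; apply: Gw_off; right.
  rewrite (@primitive_right w e)//; last by move=> t et; apply: w_off; right.
  by rewrite /c mulfVK ?gt_eqF// subrr.
have dphi_off : supported s e dphi by move=> r ro; rewrite /dphi w_off// mulr0.
have cdphi : continuous dphi.
  move=> r; apply: cvgM; last exact: cw.
  by apply: cvgB; [exact: cG|exact: cvg_cst].
have Dphi r : is_derive r 1 phi (dphi r).
  have [r0|r0] := ltP 0 r.
    have H1 := is_derive_primitive cGw r0; have H2 := is_deriveZ c (is_derive_primitive cw r0).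
    by apply: is_derive_eq (is_deriveB H1 H2) _; rewrite /dphi [RHS]mulrBl.
  rewrite dphi_off; last by left; rewrite (le_trans r0)// ltW.
  apply: (@near_eq_is_derive _ _ _ (cst (0 : R))).
  have rs : r < s by exact: le_lt_trans s0.
  near=> x; rewrite phi_left// ltW//; near: x; exact: lt_nbhsl.
pose H r := (G r - c) ^+ 2 * w r.
have cH : continuous H.
  move=> r; apply: cvgM; last exact: cw.
  by rewrite expr2; apply: cvgM; apply: cvgB; (exact: cG || exact: cvg_cst).
(* F' = A phi + (Q + G) dphi on [s, e], where Q + G = B *)
pose F r := Q r * phi r + c * phi r + primitive H r.
have DF r : s <= r <= e -> is_derive r 1 F (A r * phi r + B r * dphi r).
  move=> rI; have r0 : 0 < r by case/andP: rI => sr _; exact: lt_le_trans sr.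
  have H1 := is_deriveM (DQ r r0) (Dphi r).
  have H2 := is_deriveZ c (Dphi r).
  have H3 := is_derive_primitive cH r0.
  apply: is_derive_eq (is_deriveD (is_deriveD H1 H2) H3) _.
  rewrite /GRing.scale/= /H /dphi /At /G /Bt clampE//; ring.
have HE : primitive H e = primitive H s.
  have := weak phi dphi phi_off dphi_off cdphi Dphi.
  rewrite (@continuous_FTC2 R _ F s e se).
  - move/eqP; rewrite -EFinB eqe subr_eq0 => /eqP.
    rewrite /F phi_off; last by right.
    by rewrite phi_off; [rewrite !mulr0 !add0r|left].
  - apply: continuous_in_subspaceT => r; rewrite inE/= in_itv/= => rI.
    have r01 : 0 < r < 1.
      by case/andP: rI => sr re; rewrite (lt_le_trans s0 sr) (le_lt_trans re e1).
    have cphi : {for r, continuous phi}.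
      by apply: differentiable_continuous; apply/derivable1_diffP; have [] := Dphi r.
    have cA' := cA r r01; have cB' := cB r r01.
    by apply: cvgD; apply: cvgM => //; exact: cdphi.
  - have cF r : s <= r <= e -> {for r, continuous F}.
      by move=> /DF[d _]; apply: differentiable_continuous; apply/derivable1_diffP.
    split; first by move=> r; rewrite in_itv/= => /andP[sr re]; have [] := DF r; rewrite ?ltW.
      by apply/cvg_at_right_filter/cF; rewrite lexx ltW.
    by apply/cvg_at_left_filter/cF; rewrite lexx ltW.
  - move=> r; rewrite in_itv/= => /andP[sr re]; rewrite derive1E.
    have rI : s <= r <= e by rewrite !ltW.
    by have [_] := DF r rI.
have H0 r : 0 <= H r by rewrite mulr_ge0 ?sqr_ge0// le_max lexx.
have DH r : 0 < r -> is_derive r 1 (primitive H) (H r) by exact: is_derive_primitive.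
have mono x y : s <= x -> x <= y -> primitive H x <= primitive H y.
  move=> sx; rewrite le_eqVlt => /predU1P[->//|xy].
  have [r /andP[xr _]|z _ E] := @MVT_der R (primitive H) H x y xy.
    by apply: DH; rewrite (lt_le_trans s0)// (le_trans sx).
  by rewrite -subr_ge0 E mulr_ge0// subr_ge0 ltW.
have HI r : s < r < e -> G r = c.
  move=> /andP[sr re].
  have : is_derive r 1 (primitive H) 0.
    apply: (@near_eq_is_derive _ _ _ (cst (primitive H s))).
    near=> x.
    have sx : s < x by near: x; exact: lt_nbhsr.
    have xe : x < e by near: x; exact: lt_nbhsl.
    have h1 : primitive H s <= primitive H x by apply: mono => //; exact: ltW.
    have h2 : primitive H x <= primitive H s by rewrite -HE; apply: mono; exact: ltW.
    by apply/eqP; rewrite eq_le h1 h2.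
  move=> /(@derive_val _ _ _ _ _ _ _); rewrite (@derive_val _ _ _ _ _ _ _ (DH r (lt_trans s0 sr))).
  move/eqP; rewrite mulf_eq0 (gt_eqF (w_gt0 r _)) ?sr// orbF sqrf_eq0 subr_eq0.
  by move/eqP.
move=> r /andP[sr re]; have r0 := lt_trans s0 sr.
apply: (@near_eq_is_derive _ _ _ (fun x => Q x + c)).
  near=> x.
  have sx : s < x by near: x; exact: lt_nbhsr.
  have xe : x < e by near: x; exact: lt_nbhsl.
  have := HI x; rewrite sx xe => /(_ isT) <-.
  by rewrite /G /Bt clampE ?ltW// addrCA subrr addr0.
apply: is_derive_eq (is_deriveD (DQ r r0) (is_derive_cst c r (1 : R))) _.
by rewrite addr0 /At clampE// !ltW.
Unshelve. all: by end_near. Qed.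

End du_bois_reymond.

Section radial_identity.
Variables (R : realType) (n : nat) (b : R).
Hypothesis b0 : 0 < b.
Implicit Types (f : 'rV[R]_n.+1 -> R).

Lemma avg_weighted_continuous k f (r : R) : CK setT k f -> 0 < r < 1 ->
  {for r, continuous (fun r : R => r `^ (n%:R + b) * avg b f r)}.
Proof.
move=> hf r01; have r0 : 0 < r by case/andP: r01.
have cp : {for r, continuous (fun r : R => r `^ (n%:R + b))}.
  apply: differentiable_continuous; apply/derivable1_diffP.
  by have [] := pow_derive (n%:R + b) r0.
by apply: cvgM; [exact: cp|exact: avg_continuous hf r01].
Qed.

(** The divergence form of the operator, after integration over spheres. *)
Lemma radial_equation a f (r : R) : b = 2 * a - 1 -> CK setT 2 f -> parity 1 f ->
  0 < r < 1 ->
  is_derive r 1 (fun r : R => r `^ (n%:R + b) * avg b (radial f) r)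
    (r `^ (n%:R + b) * avg b (lapA a f) r).
Proof.
move=> bE hf pf /andP[r0 r1].
have hl : CK setT 0 (lapA a f) by exact: CK_lapA.
have hr : CK setT 0 (radial f) by exact: CK_radial hf.
apply: (@du_bois_reymond R (fun r : R => r `^ (n%:R + b) * avg b (lapA a f) r) _ (r / 2) ((1 + r) / 2));
  try lra.
- by move=> t t01; exact: avg_weighted_continuous hl t01.
- by move=> t t01; exact: avg_weighted_continuous hr t01.
- move=> phi dphi p1 p2 p3 p4.
  have s0 : 0 < r / 2 by lra.
  have se : r / 2 < (1 + r) / 2 by lra.
  have e1 : (1 + r) / 2 < 1 by lra.
  rewrite -[RHS](weak_form b0 s0 se e1 hf pf p1 p2 p3 p4 bE).
  by apply: eq_integral => t _; congr (_%:E); ring.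
Qed.

End radial_identity.

(** * Flux balance on shells *)

Section flux_balance.
Variables (R : realType) (n : nat) (b : R).
Hypothesis b0 : 0 < b.
Local Notation V := 'rV[R]_n.+1.
Local Notation lam := (@lebesgue_rV R n.+1).
Local Notation leb := (@lebesgue_measure R).
Local Notation sig := (@sphere_measure R n.+1).
Local Notation S := (esphere 1 : set V).
Implicit Types (f g : V -> R) (x y : V).

Lemma avgN k f (r : R) : CK setT k f -> 0 < r < 1 -> avg b (fun x => - f x) r = - avg b f r.
Proof.
move=> hf r01; rewrite /avg -mulN1r -RintegralZl//.
- by apply: eq_Rintegral => x _; rewrite mulN1r mulrN.
- exact: measurable_esphere.
- exact: integrable_avg hf r01.
Qed.

(** The flux of |x_N|^b grad f through the sphere of radius r, counted inwards. *)
Definition inflow f (r : R) : R := - (r `^ (n%:R + b) * avg b (radial f) r).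

Lemma is_derive_inflow a f (r : R) : b = 2 * a - 1 -> CK setT 2 f -> parity 1 f -> 0 < r < 1 ->
  is_derive r 1 (inflow f) (r `^ (n%:R + b) * avg b (fun x => - lapA a f x) r).
Proof.
move=> bE hf pf r01; rewrite (avgN (CK_lapA a hf pf) r01).
have H := is_deriveN (radial_equation b0 bE hf pf r01).
by apply: is_derive_eq H _; rewrite mulrN.
Qed.

Lemma shell_inflow a f (s t : R) : b = 2 * a - 1 -> CK setT 2 f -> parity 1 f ->
  0 < s -> s < t -> t < 1 ->
  (\int[lam]_(x in shell s t) (weight b x * - lapA a f x)%:E = (inflow f t - inflow f s)%:E)%E.
Proof.
move=> bE hf pf s0 st t1.
have hl : CK setT 0 (fun x => - lapA a f x).
  have := CKZ (-1) openT (CK_lapA a hf pf).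
  by apply: CK_eq; [exact: openT|move=> x _ _; rewrite mulN1r].
rewrite (integral_shell b0 hl s0 st t1).
have inI r : s <= r <= t -> 0 < r < 1.
  by move=> /andP[sr rt]; rewrite (lt_le_trans s0 sr) (le_lt_trans rt t1).
have D r : s <= r <= t ->
    is_derive r 1 (inflow f) (r `^ (n%:R + b) * avg b (fun x => - lapA a f x) r).
  by move=> /inI r01; exact: is_derive_inflow bE hf pf r01.
have cF r : s <= r <= t -> {for r, continuous (inflow f)}.
  by move=> /D[d _]; apply: differentiable_continuous; apply/derivable1_diffP.
rewrite (@continuous_FTC2 R _ (inflow f) s t st) ?EFinB//.
- apply: continuous_in_subspaceT => r; rewrite inE/= in_itv/= => /inI r01.
  have H := avg_weighted_continuous b0 hl r01; exact: H.
- split.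
  + move=> r; rewrite in_itv/= => /andP[sr rt].
    have rI : s <= r <= t by rewrite !ltW.
    by have [] := D r rI.
  + by apply/cvg_at_right_filter/cF; rewrite lexx ltW.
  + by apply/cvg_at_left_filter/cF; rewrite lexx ltW.
- move=> r; rewrite in_itv/= => /andP[sr rt]; rewrite derive1E.
  have rI : s <= r <= t by rewrite !ltW.
  by have [_] := D r rI.
Qed.

Lemma inflow_left_limit f : CK setT 1 f -> inflow f r @[r --> 1^'-] --> - sphere_mean b (radial f).
Proof.
move=> hf; apply: cvgN; rewrite -[X in _ --> X]mul1r.
have H := avg_left_limit b0 (CK_radial hf).
apply: cvgM; last exact: H.
have : {for (1 : R), continuous (fun r : R => r `^ (n%:R + b))}.
  apply: differentiable_continuous; apply/derivable1_diffP.
  by have [] := pow_derive (n%:R + b) (@ltr01 R).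
by rewrite /prop_for /continuous_at powR1 => /cvg_at_left_filter.
Qed.

Lemma integrable_outer k g (s : R) : CK setT k g -> 0 < s ->
  lam.-integrable (eball 1 `\` eball s) (fun x => (weight b x * g x)%:E).
Proof.
move=> hg s0; have [M M0 gM] := bounded_annulus hg s0.
have mD : measurable (eball 1 `\` eball s : set V) by exact: measurable_shell.
apply: measurable_bounded_integrable => //.
- apply: le_lt_trans (@lebesgue_rV_eball R n); apply: le_measure; rewrite ?inE//.
    exact: measurable_eball.
- apply: measurable_funM; first by apply: measurable_funTS; exact: measurable_weight.
  apply: (@measurable_funS _ _ _ _ (eball 1 `\ 0)).
  + by apply: open_measurable_rV; exact: open_punct.
  + move=> x /shellP/andP[sx x1]; split => // /= x0.
    by move: sx; rewrite x0 enorm0 leNgt s0.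
  + exact: CK_measurable hg.
- exists M; split => [|K MK x /shellP/andP[sx x1]]; first exact: num_real.
  apply: le_trans (ltW MK); rewrite /= normrM ger0_norm ?weight_ge0// -[M]mul1r.
  by rewrite ler_pM ?weight_ge0//; [apply: weight_le1 => //; exact: ltW|exact: gM].
Qed.

(** The shells of outer radius t < 1 exhaust the annulus as t -> 1, and the inflow
    through their outer spheres has a limit. *)
Lemma outer_inflow a f (s : R) : b = 2 * a - 1 -> CK setT 2 f -> parity 1 f -> 0 < s < 1 ->
  (\int[lam]_(x in eball 1 `\` eball s) (weight b x * - lapA a f x)%:E =
   (- sphere_mean b (radial f) - inflow f s)%:E)%E.
Proof.
move=> bE hf pf /andP[s0 s1].
pose t (m : nat) : R := 1 - (1 - s) / m.+2%:R.
have st m : s < t m.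
  rewrite /t ltrBrDr addrC -ltrBrDr ltr_pdivrMr ?ltr0n//.
  by rewrite ltr_pMr ?subr_gt0// ltr1n.
have t1 m : t m < 1 by rewrite /t ltrBlDr ltrDl divr_gt0 ?subr_gt0// ltr0n.
have tc : t m @[m --> \oo] --> (1 : R).
  rewrite -[X in _ --> X](subr0 (1 : R)); apply: cvgB; first exact: cvg_cst.
  rewrite -[X in _ --> X](mulr0 (1 - s)); apply: cvgM; first exact: cvg_cst.
  by have := @cvg_harmonic R; rewrite -(cvg_shiftS (@harmonic R)).
set D := eball 1 `\` eball s.
have mD : measurable (D : set V) by exact: measurable_shell.
pose h x : \bar R := (weight b x * - lapA a f x)%:E.
have hl : CK setT 0 (fun x => - lapA a f x).
  have := CKZ (-1) openT (CK_lapA a hf pf).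
  by apply: CK_eq; [exact: openT|move=> x _ _; rewrite mulN1r].
have ih := integrable_outer hl s0.
have c1 : (\int[lam]_(x in D) (h \_ (shell s (t m))) x)%E @[m --> \oo] --> (\int[lam]_(x in D) h x)%E.
  apply: (@dominated_cvg _ _ _ lam D mD (fun m => h \_ (shell s (t m))) h (fun x => `|h x|%E)).
  - move=> m; apply: (measurable_restrict _ (measurable_shell _ _) mD).1.
    by apply: measurable_funS (measurable_int _ ih) => // x [].
  - move=> x /shellP/andP[sx x1]; apply: cvg_near_cst.
    have n1 : \forall m \near \oo, enorm x < t m := tc _ (lt_nbhsr x1).
    near=> m; rewrite patchE mem_set//; apply/shellP; rewrite sx/=.
    by near: m; exact: n1.
  - by move=> x _.
  - exact: integrable_abse.
  - move=> m x _; rewrite patchE; case: ifP => // _.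
    by rewrite abse0 abse_ge0.
have c2 : (\int[lam]_(x in D) (h \_ (shell s (t m))) x)%E @[m --> \oo] -->
    (- sphere_mean b (radial f) - inflow f s)%:E.
  have c3 : inflow f (t m) - inflow f s @[m --> \oo] --> - sphere_mean b (radial f) - inflow f s.
    apply: cvgB; last exact: cvg_cst.
    have /cvg_at_leftP := inflow_left_limit (CK_pred hf).
    by apply; split.
  have E : (fun m => (\int[lam]_(x in D) (h \_ (shell s (t m))) x)%E) =
      (fun m => (inflow f (t m) - inflow f s)%:E).
    apply/funext => m; rewrite -integral_mkcondr setIidr.
      exact: shell_inflow bE hf pf s0 (st m) (t1 m).
    by move=> x /shellP/andP[sx xt]; apply/shellP; rewrite sx (lt_trans xt).
  rewrite E; apply: cvg_EFin; last exact: c3.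
  by apply: nearW.
exact: (cvg_unique _ c1 c2).
Unshelve. all: by end_near. Qed.

Lemma sphere_mean_radial_deriv k f : CK setT k.+1 f ->
  (\int[sig]_(x in S) (radial_deriv (fun y => weight b y * ball_ext f y) x
     - b * (weight b x * ball_ext f x))%:E = (sphere_mean b (radial f))%:E)%E.
Proof.
move=> hf; transitivity (\int[sig]_(x in S) (weight b x * ext (radial f) x)%:E)%E.
  by apply: eq_integral => x; rewrite inE => Sx; rewrite (radial_deriv_weight _ hf Sx).
have hr := CK_radial hf; have [M bM] := ext_bound b0 hr.
exact: integral_sphere_restrict (measurable_ext b hr) bM.
Qed.

End flux_balance.

(** * The superlinear source *)

Section superlinear.
Variables (R : realType) (n : nat) (b : R).
Hypothesis b0 : 0 < b.
Local Notation V := 'rV[R]_n.+1.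
Local Notation lam := (@lebesgue_rV R n.+1).
Local Notation sig := (@sphere_measure R n.+1).
Local Notation S := (esphere 1 : set V).
Implicit Types (f g : V -> R) (x y : V).

Lemma avg_ge0 f (r : R) : 0 < r < 1 -> (forall x, (eball 1 `\ 0) x -> 0 <= f x) -> 0 <= avg b f r.
Proof.
move=> r01 f0; apply: Rintegral_ge0 => x Sx; rewrite mulr_ge0 ?weight_ge0// f0//.
exact: ray_punct.
Qed.

(** A substitute for the tangent line of the convex power at K, which is linear in X and
    so can be integrated over spheres. *)
Lemma powR_tangent (X K alpha : R) : 0 <= X -> 0 < K -> 1 < alpha ->
  K `^ (alpha - 1) * (X - K) <= X `^ alpha.
Proof.
move=> X0 K0 al; have [XK|KX] := leP X K.
  apply: le_trans (powR_ge0 _ _).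
  by rewrite mulr_ge0_le0 ?powR_ge0// subr_le0.
have X1 : 0 < X := lt_trans K0 KX.
apply: (@le_trans _ _ (K `^ (alpha - 1) * X)).
  by rewrite ler_wpM2l ?powR_ge0// gerBl ltW.
have -> : X `^ alpha = X `^ (alpha - 1) * X.
  by rewrite -{3}[X]powRr1 ?ltW// -powD// subrK.
rewrite ler_wpM2r ?(ltW X1)//; apply: ge0_ler_powR; rewrite ?nnegrE ?subr_ge0 ?ltW//.
Qed.

Lemma avg_superlinear k j f g (alpha tau r K : R) : CK setT k f -> CK setT j g ->
  1 < alpha -> (forall x, (eball 1 `\ 0) x -> 0 <= f x) ->
  (forall x, (eball 1 `\ 0) x -> g x = enorm x `^ (- tau) * f x `^ alpha) ->
  0 < r < 1 -> 0 < K ->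
  r `^ (- tau) * (K `^ (alpha - 1) * (avg b f r - K * \int[sig]_(x in S) weight b x)) <= avg b g r.
Proof.
move=> hf hg al f0 gE r01 K0; have r0 : 0 < r by case/andP: r01.
have mS : measurable S by exact: measurable_esphere.
have iw : sig.-integrable S (EFin \o weight b).
  apply: (@integrable_sphere R n _ 1); first by apply: measurable_funTS; exact: measurable_weight.
  by move=> x Sx; rewrite ger0_norm ?weight_ge0// (weight_le1 b0)// Sx.
have iF := integrable_avg b0 hf r01.
have iG := integrable_avg b0 hg r01.
have iKw : sig.-integrable S (EFin \o (fun x => K * weight b x)).
  exact: (integrableZl mS K iw).
have iD : sig.-integrable S (EFin \o (fun x => weight b x * f (r *: x) - K * weight b x)).
  exact: (integrableB mS iF iKw).
have E1 : avg b f r - K * \int[sig]_(x in S) weight b x =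
    \int[sig]_(x in S) (weight b x * f (r *: x) - K * weight b x).
  by rewrite -RintegralZl// /avg -RintegralB.
rewrite mulrA E1 -RintegralZl//; apply: le_Rintegral => //.
  exact: (integrableZl mS _ iD).
move=> x Sx; have xp := ray_punct r01 Sx.
rewrite gE// (enorm_ray r0 Sx).
have -> : weight b x * f (r *: x) - K * weight b x = weight b x * (f (r *: x) - K) by ring.
have -> : weight b x * (r `^ (- tau) * f (r *: x) `^ alpha) =
  r `^ (- tau) * weight b x * f (r *: x) `^ alpha by ring.
have -> : r `^ (- tau) * K `^ (alpha - 1) * (weight b x * (f (r *: x) - K)) =
  r `^ (- tau) * weight b x * (K `^ (alpha - 1) * (f (r *: x) - K)) by ring.
rewrite ler_wpM2l//; first by rewrite mulr_ge0 ?powR_ge0 ?weight_ge0.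
by apply: powR_tangent => //; exact: f0.
Qed.

(** The increments of the inflow are integrals of the source over shells, hence
    nonnegative and at most its total mass. *)
Lemma inflow_bounded_below a f (F : V -> R) : b = 2 * a - 1 -> CK setT 2 f -> parity 1 f ->
  (forall x, (eball 1 `\ 0) x -> 0 <= - lapA a f x) ->
  (forall x, (eball 1 `\ 0) x -> weight b x * - lapA a f x = F x) ->
  lam.-integrable (eball 1) (fun x => (F x)%:E) ->
  exists C, forall r, 0 < r < 1 -> C <= inflow b f r.
Proof.
move=> bE hf pf l0 lF iF.
have sub s t : 0 < s -> t <= 1 -> shell s t `<=` (eball 1 `\ 0 : set V).
  move=> s0 t1 x /shellP/andP[sx xt]; split; first exact: lt_le_trans t1.
  by move=> /= x0; move: sx; rewrite x0 enorm0 leNgt s0.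
have inc s t : 0 < s -> s < t -> t < 1 -> (0 <= (inflow b f t - inflow b f s)%:E <=
    \int[lam]_(x in eball 1) `|F x|%:E)%E.
  move=> s0 st t1; rewrite -(shell_inflow b0 bE hf pf s0 st t1); apply/andP; split.
    apply: integral_ge0 => x xs; rewrite lee_fin mulr_ge0 ?weight_ge0// l0//.
    by apply: sub xs => //; exact: ltW.
  rewrite (eq_integral (fun x => `|F x|%:E)); last first.
    move=> x; rewrite inE => xs; have xp := sub _ _ s0 (ltW t1) _ xs.
    by rewrite -lF// ger0_norm// mulr_ge0 ?weight_ge0// l0.
  apply: ge0_subset_integral => //.
  - exact: measurable_shell.
  - exact: measurable_eball.
  - by have := measurable_int _ (integrable_abse iF).
  - by move=> x xs; have [] := sub _ _ s0 (ltW t1) _ xs.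
have [M ME] : exists M, (\int[lam]_(x in eball 1) `|F x|%:E = M%:E)%E.
  exists (fine (\int[lam]_(x in eball 1) `|F x|%:E)%E); rewrite fineK//.
  rewrite ge0_fin_numE; last exact: integral_ge0.
  by have /integrableP[] := iF.
have {}inc s t : 0 < s -> s < t -> t < 1 -> inflow b f s <= inflow b f t <= inflow b f s + M.
  move=> s0 st t1; have := inc s t s0 st t1; rewrite ME !lee_fin subr_ge0.
  by rewrite lerBlDl.
have M0 : 0 <= M by rewrite -lee_fin -ME integral_ge0.
have h0 : 0 < 1 / 2 :> R by lra.
have h1 : 1 / 2 < 1 :> R by lra.
exists (inflow b f (1 / 2) - M) => r /andP[r0 r1]; rewrite lerBlDr.
have [rh|rh|->] := ltgtP r (1 / 2); last by rewrite lerDl.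
  by have /andP[] := inc r _ r0 rh h1.
have /andP[h _] := inc _ r h0 rh r1; apply: le_trans h _.
by rewrite lerDl.
Qed.

End superlinear.

Theorem theorem1p3 (R : realType) (n p : nat) (a alpha tau : R)
    (u : 'rV[R]_n.+1 -> R) :
  (1 <= n)%N -> (1 <= p)%N -> 1 <= a -> 2 * p%:R < n%:R + 2 * a ->
  1 < alpha ->
  tau = (n%:R + 2 * a + 2 * p%:R) - alpha * (n%:R + 2 * a - 2 * p%:R) ->
  Ck_upto (2 * p) (eball 1 `\ 0) (ecball 1 `\ 0) u ->
  (forall x, (ecball 1 `\ 0) x -> 0 <= u x) ->
  (forall x, (ecball 1 `\ 0) x -> u (xreflect x) = u x) ->
  (forall x, (eball 1 `\ 0) x ->
    neg_lapA_iter a p u x = enorm x `^ (- tau) * u x `^ alpha) ->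
  (@lebesgue_rV R n.+1).-integrable (eball 1)
    (fun x => (`|xlast x| `^ (2 * a - 1) * enorm x `^ (- tau)
               * u x `^ alpha)%:E) ->
  forall i : nat, (i < p)%N ->
  exists L : R,
    (\int[lebesgue_rV n.+1]_(x in eball 1 `\` eball s) (v_ a u i.+1 x)%:E)%E
      @[s --> 0^'+] --> L%:E /\
    (\int[sphere_measure n.+1]_(x in esphere 1)
        (radial_deriv (v_ a u i) x - (2 * a - 1) * v_ a u i x)%:E
      + L%:E = 0)%E.
Proof.
move=> n1 p1 a1 pD al tauE Cu u0 eu equ iu i ip.
pose b := 2 * a - 1; have bE : b = 2 * a - 1 by [].
have b0 : 0 < b by rewrite /b; lra.
have hu : CK setT (2 * p) u by exact: Ck_upto_CK.
have pu : parity 1 u by move=> x xp; rewrite mul1r; apply: eu; exact: sub_punct.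
pose w j := neg_lapA_iter a j u.
have hw j : (j <= p)%N -> CK setT (2 * (p - j)) (w j) /\ parity 1 (w j).
  exact: CK_neg_lapA_iter.
have hw2 j : (j < p)%N -> CK setT 2 (w j) /\ parity 1 (w j).
  move=> jp; have [h1 h2] := hw j (ltnW jp); split => //.
  by apply: CK_le h1; rewrite -{1}[2%N]muln1 leq_mul2l subn_gt0.
have wS j x : w j.+1 x = - lapA a (w j) x by [].
have DE : n%:R + 2 * a - 1 = n%:R + b by rewrite /b; ring.
have u0' x : (eball 1 `\ 0) x -> 0 <= u x by move=> xp; apply: u0; exact: sub_punct.
have wp0 x : (eball 1 `\ 0) x -> 0 <= w p x.
  by move=> xp; rewrite /w equ// mulr_ge0 ?powR_ge0.
have hp : CK setT 0 (w p) by have [] := hw p (leqnn p); rewrite subnn.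
have pE : p.-1.+1 = p by rewrite prednK.
have p1p : (p.-1 < p)%N by rewrite pE.
have wpE x : w p x = - lapA a (w p.-1) x by rewrite -[in LHS]pE wS.
have flux0 : inflow b (w i) r @[r --> 0^'+] --> 0.
  apply: (@flux_cvg0 R p (n%:R + 2 * a) (fun j => avg b (w j)) (fun j => inflow b (w j)) pD
    _ _ _ _ alpha tau (\int[sphere_measure n.+1]_(x in esphere 1) weight b x)) => //.
  - move=> j r jp r01; have [h1 _] := hw2 j jp; have r0 : 0 < r by case/andP: r01.
    apply: is_derive_eq (is_derive_avg b0 h1 r01) _.
    rewrite /inflow -DE mulrN opprK mulrA -powD// (_ : 1 - _ + _ = 0); last by ring.
    by rewrite powRr0 mul1r.
  - move=> j r jp r01; have [h1 h2] := hw2 j jp.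
    by rewrite DE; have H := is_derive_inflow b0 bE h1 h2 r01; exact: H.
  - have [h1 h2] := hw2 _ p1p.
    apply: (inflow_bounded_below b0 bE h1 h2 _ _ iu) => // x xp; rewrite -wpE; first exact: wp0.
    by rewrite /w equ// mulrA.
  - by move=> r r01; exact: avg_ge0.
  - by apply: Rintegral_ge0 => x _; exact: weight_ge0.
  - by move=> r r01; exact: avg_ge0.
  - by move=> r K r01 K0; exact: (avg_superlinear b0 hu hp al u0' equ r01 K0).
have [h1 h2] := hw2 i ip.
exists (- sphere_mean b (radial (w i))); split; last first.
  rewrite [X in (X + _)%E](_ : _ = (sphere_mean b (radial (w i)))%:E).
    by rewrite -EFinD subrr.
  have H := sphere_mean_radial_deriv b0 h1; exact: H.
have c : (- sphere_mean b (radial (w i)) - inflow b (w i) s)%:E @[s --> 0^'+] -->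
    (- sphere_mean b (radial (w i)))%:E.
  apply: cvg_EFin; first by apply: nearW.
  rewrite -[X in _ --> X]subr0; apply: cvgB; [exact: cvg_cst|exact: flux0].
apply: cvg_trans c; apply: near_eq_cvg; near=> s.
have s01 : 0 < s < 1.
  by apply/andP; split; near: s; [exact: nbhs_right_gt|exact: nbhs_right_lt].
rewrite -(outer_inflow b0 bE h1 h2 s01); apply: eq_integral => x.
by rewrite inE => -[x1 _]; rewrite /v_ /ball_ext x1.
Unshelve. all: by end_near. Qed.
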